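(* Let $n\ge3$ and let $f:I\to\mathbb{Q}_n$ be a $1$-generic conformal geodesic, and let $e$ be a special third order frame along $f$. Then the linear subspace $$V(s)=\mathrm{span}\Big\{e_0(s),e_1(s),e_2(s),e_{n+1}(s),X(s),\frac{\nabla X}{ds}(s)\Big\}\subset\mathbb{R}^{n+2}$$ is a Lorentzian (time-like) subspace independent of $s\in I$; calling it $V$, one has $4\le\dim V\le6$, and the projectivization of the null cone of $V$ is a conformal sphere of dimension $\dim V-2$ containing $f(I)$.
   Context: On $\mathbb{R}^{n+2}$ (coordinates $0,\dots,n+1$) take $\langle v,w\rangle=\sum_{A=1}^nv^Aw^A-v^0w^{n+1}-v^{n+1}w^0$; $\mathbb{Q}_n$ is its projectivized null cone and $\mathrm{M\ddot{o}b}(n)$ the identity component of its isometry group. A conformal $k$-sphere is the projectivized null cone of a $(k+2)$-dimensional Lorentzian subspace. A frame along $f$ is a smooth $e=(e_0|\dots|e_{n+1})$ into $\mathrm{M\ddot{o}b}(n)$ with $[e_0]=f$; $\phi=e^{-1}de$, i.e. $de_b=\sum_a\phi^a_be_a$. Indices $2\le\alpha\le n$, $3\le b,c\le n$. Second order frames: $\phi^\alpha_0=\phi^\alpha_1=0$; with $\phi^0_\alpha=p^\alpha\phi^1_0$, $f$ is 1-generic if $\sum_\alpha(p^\alpha)^2\ne0$ everywhere; $ds=(\sum_\alpha(p^\alpha)^2)^{1/4}\phi^1_0$ is the conformal arclength. Special third order frames: second order frames with $\phi^1_0=\phi^0_2=ds$, $\phi^0_b=0$, $\phi^0_0=0$.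 In such a frame $\phi^0_1=\mu_1ds$, $\phi^b_2=q^bds$, $X=\sum_bq^be_b$ (section of $\Theta=\mathrm{span}\{e_3,\dots,e_n\}$), and $\nabla e_b=\sum_c\phi^c_be_c$ defines the connection on $\Theta$ (metric: $\{e_b\}$ orthonormal). A 1-generic $f$ is a conformal geodesic if it is a critical point of $\int_Dds$ for every compact subinterval $D$ under smooth variations through immersions supported in the interior of $D$. *)

(* Defs.v *)
From Stdlib Require Import Reals Lra List.
Open Scope R_scope.

(** Vectors of R^{n+2}: only components 0..n+1 are meaningful. *)
Definition vec := nat -> R.

Fixpoint rsum (k : nat) (g : nat -> R) : R :=
  match k with O => 0 | S k' => rsum k' g + g k' end.

Definition mink (n : nat) (v w : vec) : R :=
  rsum n (fun k => v (S k) * w (S k)) - v 0%nat * w (S n) - v (S n) * w 0%nat.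

Definition nonzero (n : nat) (v : vec) : Prop := exists i, (i <= S n)%nat /\ v i <> 0.

Definition unitv (j : nat) : vec := fun i => if Nat.eqb i j then 1 else 0.

Definition col (M : nat -> nat -> R) (j : nat) : vec := fun i => M i j.

Definition isometry (n : nat) (M : nat -> nat -> R) : Prop :=
  forall j k, (j <= S n)%nat -> (k <= S n)%nat ->
    mink n (col M j) (col M k) = mink n (unitv j) (unitv k).

(** Mob(n): identity (path-)component of the isometry group. *)
Definition moeb (n : nat) (M : nat -> nat -> R) : Prop :=
  isometry n M /\
  exists g : R -> nat -> nat -> R,
    (forall i j, continuity (fun u => g u i j)) /\
    (forall u, 0 <= u <= 1 -> isometry n (g u)) /\
    (forall i j, g 0 i j = unitv j i) /\
    (forall i j, (i <= S n)%nat -> (j <= S n)%nat -> g 1 i j = M i j).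

Definition is_open_interval (I : R -> Prop) : Prop :=
  (exists t, I t) /\
  (forall x y z, I x -> I z -> x <= y <= z -> I y) /\
  (forall t, I t -> exists eps, 0 < eps /\ forall u, Rabs (u - t) < eps -> I u).

Definition smooth_on (I : R -> Prop) (g : R -> R) : Prop :=
  exists D : nat -> R -> R, (forall t, D 0%nat t = g t) /\
    forall k t, I t -> derivable_pt_lim (D k) t (D (S k) t).

Definition cont2 (h : R -> R -> R) (x y : R) : Prop :=
  forall eps, 0 < eps -> exists del, 0 < del /\
    forall x' y', Rabs (x' - x) < del -> Rabs (y' - y) < del ->
      Rabs (h x' y' - h x y) < eps.

Definition smooth2 (U : R -> R -> Prop) (g : R -> R -> R) : Prop :=
  exists D : nat -> nat -> R -> R -> R, (forall x y, D 0%nat 0%nat x y = g x y) /\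
    forall j k x y, U x y ->
      derivable_pt_lim (fun x' => D j k x' y) x (D (S j) k x y) /\
      derivable_pt_lim (fun y' => D j k x y') y (D j (S k) x y) /\
      cont2 (D j k) x y.

(** A smooth immersed curve f : I -> Q_n, given by a smooth null nonvanishing
    lift F : I -> R^{n+2}, f(t) = [F(t)]. *)
Definition curve (n : nat) (I : R -> Prop) (F : R -> vec) : Prop :=
  (forall i, (i <= S n)%nat -> smooth_on I (fun t => F t i)) /\
  (forall t, I t -> nonzero n (F t) /\ mink n (F t) (F t) = 0) /\
  (forall t, I t -> forall dF : vec,
      (forall i, (i <= S n)%nat -> derivable_pt_lim (fun u => F u i) t (dF i)) ->
      ~ (exists c, forall i, (i <= S n)%nat -> dF i = c * F t i)).

Definition frame (n : nat) (I : R -> Prop) (F : R -> vec)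
  (e : R -> nat -> nat -> R) : Prop :=
  (forall i b, (i <= S n)%nat -> (b <= S n)%nat -> smooth_on I (fun t => e t i b)) /\
  (forall t, I t -> moeb n (e t) /\
     exists lam, lam <> 0 /\ forall i, (i <= S n)%nat -> e t i 0%nat = lam * F t i).

(** phi = e^{-1} de, i.e. de_b = sum_a phi^a_b e_a ;  phi t a b = phi^a_b (d/dt). *)
Definition mc_form (n : nat) (I : R -> Prop) (e phi : R -> nat -> nat -> R) : Prop :=
  forall t, I t -> forall i b, (i <= S n)%nat -> (b <= S n)%nat ->
    derivable_pt_lim (fun s => e s i b) t
      (rsum (S (S n)) (fun a => phi t a b * e t i a)).

Definition second_order_frame (n : nat) (I : R -> Prop) (F : R -> vec)
  (e phi : R -> nat -> nat -> R) : Prop :=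
  frame n I F e /\ mc_form n I e phi /\
  forall t al, I t -> (2 <= al <= n)%nat -> phi t al 0%nat = 0 /\ phi t al 1%nat = 0.

(** sum_alpha (p^alpha)^2 with phi^0_alpha = p^alpha phi^1_0, alpha = 2..n *)
Definition psq (n : nat) (phi : R -> nat -> nat -> R) (t : R) : R :=
  rsum (n - 1) (fun k => (phi t 0%nat (k + 2)%nat / phi t 1%nat 0%nat) ^ 2).

Definition ds (n : nat) (phi : R -> nat -> nat -> R) (t : R) : R :=
  sqrt (sqrt (psq n phi t)) * phi t 1%nat 0%nat.

Definition one_generic (n : nat) (I : R -> Prop) (F : R -> vec) : Prop :=
  exists e phi, second_order_frame n I F e phi /\
    forall t, I t -> psq n phi t <> 0.

Definition is_arclength (n : nat) (I : R -> Prop) (G : R -> vec) (a b L : R) : Prop :=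
  exists e phi, second_order_frame n I G e phi /\
    (forall t, I t -> phi t 1%nat 0%nat > 0) /\
    exists pr : Riemann_integrable (ds n phi) a b, L = RiemannInt pr.

Definition variation (n : nat) (I : R -> Prop) (F : R -> vec) (a b delta : R)
  (Fv : R -> R -> vec) : Prop :=
  0 < delta /\
  (forall i, (i <= S n)%nat ->
     smooth2 (fun eps t => - delta < eps < delta /\ I t) (fun eps t => Fv eps t i)) /\
  (forall t i, (i <= S n)%nat -> Fv 0 t i = F t i) /\
  (forall eps, - delta < eps < delta -> curve n I (Fv eps)) /\
  exists c d, a < c /\ c <= d /\ d < b /\
    forall eps t, - delta < eps < delta -> I t -> (t < c \/ d < t) ->
      forall i, (i <= S n)%nat -> Fv eps t i = F t i.

Definition conformal_geodesic (n : nat) (I : R -> Prop) (F : R -> vec) : Prop :=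
  one_generic n I F /\
  forall a b, I a -> I b -> a < b ->
    forall delta Fv, variation n I F a b delta Fv ->
      forall Lf : R -> R,
        (forall eps, - delta < eps < delta -> is_arclength n I (Fv eps) a b (Lf eps)) ->
        derivable_pt_lim Lf 0 0.

Definition special_third_order_frame (n : nat) (I : R -> Prop) (F : R -> vec)
  (e phi : R -> nat -> nat -> R) : Prop :=
  second_order_frame n I F e phi /\
  forall t, I t ->
    phi t 1%nat 0%nat = ds n phi t /\ phi t 0%nat 2%nat = ds n phi t /\
    (forall b, (3 <= b <= n)%nat -> phi t 0%nat b = 0) /\ phi t 0%nat 0%nat = 0.

(** q^b : phi^b_2 = q^b ds (in a special third order frame ds = phi^1_0) *)
Definition qf (n : nat) (phi : R -> nat -> nat -> R) (t : R) (b : nat) : R :=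
  phi t b 2%nat / ds n phi t.

Definition sumTheta (n : nat) (g : nat -> R) : R := rsum (n - 2) (fun k => g (k + 3)%nat).

Definition Xv (n : nat) (e phi : R -> nat -> nat -> R) (t : R) : vec :=
  fun i => sumTheta n (fun b => qf n phi t b * e t i b).

(** nabla X / ds = sum_c (dq^c/ds + sum_b q^b phi^c_b/ds) e_c, where dq t c is
    the t-derivative of q^c. *)
Definition nablaX_ds (n : nat) (e phi : R -> nat -> nat -> R) (dq : R -> nat -> R)
  (t : R) : vec :=
  fun i => sumTheta n (fun c =>
    ((dq t c + sumTheta n (fun b => qf n phi t b * phi t c b)) / ds n phi t) * e t i c).

Definition lincomb (cs : list R) (L : list vec) (i : nat) : R :=
  fold_right (fun p acc => fst p * snd p i + acc) 0 (combine cs L).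

Definition in_span (n : nat) (L : list vec) (v : vec) : Prop :=
  exists cs : list R, length cs = length L /\
    forall i, (i <= S n)%nat -> v i = lincomb cs L i.

(** W is a basis of its span in which the form is diag(-1,1,...,1):
    span W is a Lorentzian subspace of dimension length W. *)
Definition lorentz_basis (n : nat) (W : list vec) : Prop :=
  W <> nil /\
  forall k l, (k < length W)%nat -> (l < length W)%nat ->
    mink n (nth k W (fun _ => 0)) (nth l W (fun _ => 0)) =
      if Nat.eqb k l then (if Nat.eqb k 0 then -1 else 1) else 0.

(** Projectivized null cone of span W, as a (scale-invariant) predicate on
    representatives of points of Q_n. *)
Definition proj_null_cone (n : nat) (W : list vec) (v : vec) : Prop :=
  nonzero n v /\ mink n v v = 0 /\ in_span n W v.

Definition conformal_sphere (n k : nat) (S : vec -> Prop) : Prop :=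
  exists W, length W = (k + 2)%nat /\ lorentz_basis n W /\
    forall v, S v <-> proj_null_cone n W v.

Definition V_gens (n : nat) (e phi : R -> nat -> nat -> R) (dq : R -> nat -> R)
  (t : R) : list vec :=
  col (e t) 0%nat :: col (e t) 1%nat :: col (e t) 2%nat :: col (e t) (S n)
  :: Xv n e phi t :: nablaX_ds n e phi dq t :: nil.

(* Main.v *)
Require Import Defs.
From Stdlib Require Import Reals List.
From Stdlib Require Import Lra Lia Ranalysis5.
From Coquelicot Require Import Coquelicot.
Open Scope R_scope.

(** In a special third order frame put [v = phi^1_0], [v mu = phi^0_1],
    [X = sum q^b e_b] and [P = nabla X / ds].  The normal part of the
    Euler-Lagrange equation of the conformal arclength is
    [nabla P / ds = (2 mu + |q|^2) X].  Granted this, the six generators of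
    [V] satisfy a closed linear system of ordinary differential equations, so a
    vector orthogonal to [V] at one parameter is orthogonal to it at every
    parameter; as [V] is Lorentzian, it is its own double orthogonal and hence
    constant.

    The equation is obtained from the variations
    [e_0 + eps Y + eps^2 |Y|^2 / 2 e_(n+1)] with [Y] a section of [Theta], for
    which an explicit second order frame is found by a null rotation, a rotation
    and another null rotation of [e].  Only an upper bound of the perturbed
    arclength to first order in [eps] is needed: by assumption the arclength is
    differentiable with derivative zero, so an upper bound
    [L(0) + eps J + O(eps^2)], valid for both signs of [eps], forces [J = 0].
    Finally one takes [Y] to be a bump function times the Euler-Lagrange
    expression itself.

    If [v < 0], the vectors [e_1] and [e_2] are replaced by their opposites. *)

(** * Linear algebra of the Minkowski product *)

(** Two obstacles shape the proof. The geodesic hypothesis speaks of arclengths computed from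
    genuine second order frames of every perturbed curve, on all of [I], with [phi^1_0 > 0] and with
    values in the identity component. An infinitesimal computation is therefore not enough: the
    frame is written in closed form for every small [eps], and each expansion in [eps] is an exact
    identity whose remainder factor lies in a class of functions that is closed under [d/dt] and
    bounded on compact intervals. The term [eps^2 |Y|^2 / 2 e_(n+1)] keeps the perturbed vector
    null.

    Secondly, [X] and [P] may vanish or be dependent, so the dimension of [V(s)] is not known to be
    constant beforehand and no moving basis of [V] can be followed. Pairing the six generators with
    one fixed vector [u] gives six scalar functions that solve a linear system, and only the
    uniqueness of its zero solution is needed, whatever the rank of the generators. *)

Lemma rsum_ext k f g : (forall i, (i < k)%nat -> f i = g i) -> rsum k f = rsum k g.
Proof.
  induction k as [|k IH]; intros H; simpl; [reflexivity|].
  rewrite IH, H by (intros; auto with arith). reflexivity.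
Qed.

Lemma rsum_plus k f g : rsum k (fun i => f i + g i) = rsum k f + rsum k g.
Proof. induction k as [|k IH]; simpl; [ring|rewrite IH; ring]. Qed.

Lemma rsum_minus k f g : rsum k (fun i => f i - g i) = rsum k f - rsum k g.
Proof. induction k as [|k IH]; simpl; [ring|rewrite IH; ring]. Qed.

Lemma rsum_scal k a f : rsum k (fun i => a * f i) = a * rsum k f.
Proof. induction k as [|k IH]; simpl; [ring|rewrite IH; ring]. Qed.

Lemma rsum_scal_r k a f : rsum k (fun i => f i * a) = rsum k f * a.
Proof. induction k as [|k IH]; simpl; [ring|rewrite IH; ring]. Qed.

Lemma rsum_zero k f : (forall i, (i < k)%nat -> f i = 0) -> rsum k f = 0.
Proof.
  intros H. rewrite (rsum_ext k f (fun i => 0 * 0)) by (intros; rewrite H by auto; ring).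
  rewrite rsum_scal. ring.
Qed.

Lemma rsum_nonneg k f : (forall i, (i < k)%nat -> 0 <= f i) -> 0 <= rsum k f.
Proof.
  induction k as [|k IH]; intros H; simpl; [lra|].
  assert (0 <= rsum k f) by (apply IH; auto with arith).
  assert (0 <= f k) by (apply H; auto). lra.
Qed.

Lemma rsum_first k f : rsum (S k) f = f 0%nat + rsum k (fun i => f (S i)).
Proof. induction k as [|k IH]; simpl in *; [ring|rewrite IH; ring]. Qed.

Lemma rsum_swap k l (f : nat -> nat -> R) :
  rsum k (fun i => rsum l (fun j => f i j)) = rsum l (fun j => rsum k (fun i => f i j)).
Proof.
  induction k as [|k IH]; simpl.
  - symmetry. apply rsum_zero; auto.
  - rewrite IH, rsum_plus. reflexivity.
Qed.

Lemma rsum_single k j f :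
  (j < k)%nat -> (forall i, (i < k)%nat -> i <> j -> f i = 0) -> rsum k f = f j.
Proof.
  induction k as [|k IH]; intros Hj H; [lia|]. simpl.
  destruct (Nat.eq_dec j k) as [->|n].
  - rewrite rsum_zero by (intros i Hi; apply H; lia). ring.
  - rewrite IH, (H k) by (try lia; intros; apply H; lia). ring.
Qed.

Lemma rsum_nonneg_zero k f :
  (forall i, (i < k)%nat -> 0 <= f i) -> rsum k f = 0 ->
  forall i, (i < k)%nat -> f i = 0.
Proof.
  induction k as [|k IH]; intros Hp H i Hi; [lia|]. simpl in H.
  assert (0 <= rsum k f) by (apply rsum_nonneg; auto with arith).
  assert (0 <= f k) by (apply Hp; auto).
  destruct (Nat.eq_dec i k) as [->|ne]; [lra|].
  apply IH; try lia; [auto with arith|lra].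
Qed.

(** Sum over the space-like indices [1..n]. *)
Definition ssum (n : nat) (g : nat -> R) : R := rsum n (fun k => g (S k)).

Lemma ssum_ext n f g : (forall i, (1 <= i <= n)%nat -> f i = g i) -> ssum n f = ssum n g.
Proof. intros H; apply rsum_ext; intros; apply H; lia. Qed.

Lemma ssum_plus n f g : ssum n (fun i => f i + g i) = ssum n f + ssum n g.
Proof. apply rsum_plus. Qed.

Lemma ssum_minus n f g : ssum n (fun i => f i - g i) = ssum n f - ssum n g.
Proof. apply rsum_minus. Qed.

Lemma ssum_scal n a f : ssum n (fun i => a * f i) = a * ssum n f.
Proof. apply rsum_scal. Qed.

Lemma ssum_scal_r n a f : ssum n (fun i => f i * a) = ssum n f * a.
Proof. unfold ssum. apply (rsum_scal_r n a (fun k => f (S k))). Qed.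

Lemma ssum_zero n f : (forall i, (1 <= i <= n)%nat -> f i = 0) -> ssum n f = 0.
Proof. intros H; apply rsum_zero; intros; apply H; lia. Qed.

Lemma ssum_swap n (f : nat -> nat -> R) :
  ssum n (fun i => ssum n (fun j => f i j)) = ssum n (fun j => ssum n (fun i => f i j)).
Proof. apply (rsum_swap n n (fun i j => f (S i) (S j))). Qed.

Lemma ssum_single n j f :
  (1 <= j <= n)%nat -> (forall i, (1 <= i <= n)%nat -> i <> j -> f i = 0) -> ssum n f = f j.
Proof.
  intros Hj H. unfold ssum. rewrite (rsum_single n (j - 1)) by (try lia; intros; apply H; lia).
  f_equal; lia.
Qed.

Lemma ssum_delta n j f :
  (1 <= j <= n)%nat -> ssum n (fun i => f i * (if Nat.eqb i j then 1 else 0)) = f j.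
Proof.
  intros Hj. rewrite (ssum_single n j) by
    (auto; intros i _ Hi; rewrite (proj2 (Nat.eqb_neq i j) Hi); ring).
  rewrite Nat.eqb_refl. ring.
Qed.

Lemma ssum_first n f : (1 <= n)%nat -> ssum n f = f 1%nat + rsum (n - 1) (fun k => f (k + 2)%nat).
Proof.
  intros H. unfold ssum. replace n with (S (n - 1)) at 1 by lia.
  rewrite rsum_first. f_equal. apply rsum_ext; intros; f_equal; lia.
Qed.

Lemma ssum_first2 n f :
  (2 <= n)%nat -> ssum n f = f 1%nat + f 2%nat + sumTheta n f.
Proof.
  intros H. rewrite ssum_first by lia. unfold sumTheta.
  replace (n - 1)%nat with (S (n - 2)) by lia. rewrite rsum_first.
  replace (0 + 2)%nat with 2%nat by lia. rewrite Rplus_assoc. f_equal. f_equal.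
  apply rsum_ext; intros; f_equal; lia.
Qed.

Lemma rsum_ends n f :
  rsum (S (S n)) f = f 0%nat + ssum n f + f (S n).
Proof. change (rsum (S n) f + f (S n) = f 0%nat + ssum n f + f (S n)).
  rewrite rsum_first. reflexivity. Qed.

Lemma mink_ssum n v w :
  mink n v w = ssum n (fun A => v A * w A) - v 0%nat * w (S n) - v (S n) * w 0%nat.
Proof. reflexivity. Qed.

Lemma mink_sym n v w : mink n v w = mink n w v.
Proof.
  rewrite !mink_ssum, (ssum_ext n _ (fun A => w A * v A)) by (intros; ring). ring.
Qed.

Lemma mink_ext n v v' w w' :
  (forall i, (i <= S n)%nat -> v i = v' i) -> (forall i, (i <= S n)%nat -> w i = w' i) ->
  mink n v w = mink n v' w'.
Proof.
  intros H H'. rewrite !mink_ssum, !H, !H' by lia.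
  rewrite (ssum_ext n _ (fun A => v' A * w' A)) by (intros; rewrite H, H' by lia; ring).
  reflexivity.
Qed.

Lemma mink_plus n u v w : mink n (fun i => u i + v i) w = mink n u w + mink n v w.
Proof.
  rewrite !mink_ssum,
    (ssum_ext n _ (fun A => u A * w A + v A * w A)) by (intros; ring).
  rewrite ssum_plus. ring.
Qed.

Lemma mink_scal n a v w : mink n (fun i => a * v i) w = a * mink n v w.
Proof.
  rewrite !mink_ssum,
    (ssum_ext n _ (fun A => a * (v A * w A))) by (intros; ring).
  rewrite ssum_scal. ring.
Qed.

Lemma mink_minus n u v w : mink n (fun i => u i - v i) w = mink n u w - mink n v w.
Proof.
  rewrite !mink_ssum,
    (ssum_ext n _ (fun A => u A * w A - v A * w A)) by (intros; ring).
  rewrite ssum_minus. ring.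
Qed.

Lemma mink_rsum n k (f : nat -> vec) w :
  mink n (fun i => rsum k (fun j => f j i)) w = rsum k (fun j => mink n (f j) w).
Proof.
  induction k as [|k IH]; simpl.
  - rewrite mink_ssum, ssum_zero by (intros; ring). ring.
  - rewrite (mink_plus n (fun i => rsum k (fun j => f j i)) (f k)), IH. reflexivity.
Qed.

Lemma mink_comb n k (c : nat -> R) (f : nat -> vec) w :
  mink n (fun i => rsum k (fun j => c j * f j i)) w = rsum k (fun j => c j * mink n (f j) w).
Proof.
  rewrite (mink_rsum n k (fun j i => c j * f j i)).
  apply rsum_ext; intros; apply mink_scal.
Qed.

Lemma mink_scomb n (c : nat -> R) (f : nat -> vec) w :
  mink n (fun i => ssum n (fun j => c j * f j i)) w = ssum n (fun j => c j * mink n (f j) w).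
Proof. apply (mink_comb n n (fun j => c (S j)) (fun j => f (S j))). Qed.

Lemma mink_plus_r n u v w : mink n w (fun i => u i + v i) = mink n w u + mink n w v.
Proof. rewrite mink_sym, mink_plus, !(mink_sym n w). reflexivity. Qed.

Lemma mink_minus_r n u v w : mink n w (fun i => u i - v i) = mink n w u - mink n w v.
Proof. rewrite mink_sym, mink_minus, !(mink_sym n w). reflexivity. Qed.

Lemma mink_scal_r n a v w : mink n w (fun i => a * v i) = a * mink n w v.
Proof. rewrite mink_sym, mink_scal, (mink_sym n w). reflexivity. Qed.

Lemma mink_scomb_r n (c : nat -> R) (f : nat -> vec) w :
  mink n w (fun i => ssum n (fun j => c j * f j i)) = ssum n (fun j => c j * mink n w (f j)).
Proof.
  rewrite mink_sym, mink_scomb. apply ssum_ext; intros. rewrite mink_sym. reflexivity.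
Qed.

Lemma unitv_same j : unitv j j = 1.
Proof. unfold unitv. rewrite Nat.eqb_refl. reflexivity. Qed.

Lemma unitv_diff i j : i <> j -> unitv j i = 0.
Proof. intros H. unfold unitv. rewrite (proj2 (Nat.eqb_neq i j) H). reflexivity. Qed.

Lemma ssum_unitv n j f : (1 <= j <= n)%nat -> ssum n (fun i => f i * unitv j i) = f j.
Proof. apply ssum_delta. Qed.

Lemma ssum_unitv0 n j f : (j = 0 \/ n < j)%nat -> ssum n (fun i => f i * unitv j i) = 0.
Proof. intros. apply ssum_zero. intros i Hi. rewrite unitv_diff by lia. ring. Qed.

Lemma mink_unitv0 n v : mink n v (unitv 0) = - v (S n).
Proof.
  rewrite mink_ssum, ssum_unitv0, unitv_same, unitv_diff by lia. ring.
Qed.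

Lemma mink_unitvS n v : mink n v (unitv (S n)) = - v 0%nat.
Proof.
  rewrite mink_ssum, ssum_unitv0, unitv_same, unitv_diff by lia. ring.
Qed.

Lemma mink_unitv n v A : (1 <= A <= n)%nat -> mink n v (unitv A) = v A.
Proof.
  intros. rewrite mink_ssum, ssum_unitv, !unitv_diff by lia. ring.
Qed.

(** A basis [p, B 1, ..., B n, q] of R^{n+2} with the same products as the
    standard one; the last field says that it spans. *)
Record nullframe (n : nat) (p q : vec) (B : nat -> vec) : Prop := {
  nf_pp : mink n p p = 0;
  nf_qq : mink n q q = 0;
  nf_pq : mink n p q = -1;
  nf_pB : forall A, (1 <= A <= n)%nat -> mink n p (B A) = 0;
  nf_qB : forall A, (1 <= A <= n)%nat -> mink n q (B A) = 0;
  nf_BB : forall A A', (1 <= A <= n)%nat -> (1 <= A' <= n)%nat ->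
    mink n (B A) (B A') = if Nat.eqb A A' then 1 else 0;
  nf_span : forall v i, (i <= S n)%nat ->
    v i = - mink n v q * p i - mink n v p * q i + ssum n (fun A => mink n v (B A) * B A i)
}.

Lemma nullframe_unit n : nullframe n (unitv 0) (unitv (S n)) unitv.
Proof.
  split; intros.
  - rewrite mink_unitv0, unitv_diff by lia. ring.
  - rewrite mink_unitvS, unitv_diff by lia. ring.
  - rewrite mink_unitvS, unitv_same. ring.
  - rewrite mink_unitv, unitv_diff by lia. ring.
  - rewrite mink_unitv, unitv_diff by lia. ring.
  - rewrite mink_unitv by lia. unfold unitv. rewrite Nat.eqb_sym. reflexivity.
  - rewrite mink_unitv0, mink_unitvS.
    rewrite (ssum_ext n _ (fun A => v A * unitv i A)).
    2:{ intros A HA. rewrite mink_unitv by lia. unfold unitv. rewrite Nat.eqb_sym. reflexivity. }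
    destruct (Nat.eq_dec i 0) as [->|h0].
    { rewrite ssum_unitv0, unitv_same, unitv_diff by lia. ring. }
    destruct (Nat.eq_dec i (S n)) as [->|hS].
    { rewrite ssum_unitv0, unitv_same, unitv_diff by lia. ring. }
    rewrite ssum_unitv, !unitv_diff by lia. ring.
Qed.

Lemma nullframe_sym n p q B : nullframe n p q B -> nullframe n q p B.
Proof.
  intros [pp qq pq pB qB BB sp]; split; auto.
  - rewrite mink_sym; auto.
  - intros v i Hi. rewrite (sp v i Hi) at 1. ring.
Qed.

Lemma nullframe_ext n p q B p' q' B' :
  nullframe n p q B ->
  (forall i, (i <= S n)%nat -> p' i = p i) -> (forall i, (i <= S n)%nat -> q' i = q i) ->
  (forall A i, (1 <= A <= n)%nat -> (i <= S n)%nat -> B' A i = B A i) ->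
  nullframe n p' q' B'.
Proof.
  intros [pp qq pq pB qB BB sp] Hp Hq HB; split; intros.
  - rewrite (mink_ext n p' p p' p); auto.
  - rewrite (mink_ext n q' q q' q); auto.
  - rewrite (mink_ext n p' p q' q); auto.
  - rewrite (mink_ext n p' p (B' A) (B A)); auto.
  - rewrite (mink_ext n q' q (B' A) (B A)); auto.
  - rewrite (mink_ext n (B' A) (B A) (B' A') (B A')); auto.
  - rewrite (mink_ext n v v q' q), (mink_ext n v v p' p), Hp, Hq by auto.
    rewrite (sp v i) at 1 by auto. f_equal. apply ssum_ext. intros A HA.
    rewrite (mink_ext n v v (B' A) (B A)), HB by auto. reflexivity.
Qed.

(** The null rotation that fixes [p]; the coefficient [|x|^2 / 2] is what keeps the new [q] null.
    After exchanging [p] and [q] it moves [e_0] along the variation, and in its direct form it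
    corrects the frame to second order. *)
Lemma nullframe_nullrot n p q B (x : nat -> R) :
  nullframe n p q B ->
  nullframe n p
    (fun i => q i + ssum n (fun A => x A * B A i) + ssum n (fun A => x A * x A) / 2 * p i)
    (fun A i => B A i + x A * p i).
Proof.
  intros [pp qq pq pB qB BB sp]. set (X := ssum n (fun A => x A * x A)).
  assert (Hq : forall v, mink n v (fun i => q i + ssum n (fun A => x A * B A i) + X / 2 * p i)
     = mink n v q + ssum n (fun A => x A * mink n v (B A)) + X / 2 * mink n v p).
  { intros v. rewrite (mink_plus_r n (fun i => q i + ssum n (fun A => x A * B A i))),
      mink_plus_r, mink_scomb_r, mink_scal_r. reflexivity. }
  assert (HB : forall v A, mink n v (fun i => B A i + x A * p i) = mink n v (B A) + x A * mink n v p).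
  { intros. rewrite mink_plus_r, mink_scal_r. reflexivity. }
  assert (qp : mink n q p = -1) by (rewrite mink_sym; auto).
  assert (Bp : forall A, (1 <= A <= n)%nat -> mink n (B A) p = 0) by (intros; rewrite mink_sym; auto).
  assert (Bq : forall A, (1 <= A <= n)%nat -> mink n (B A) q = 0) by (intros; rewrite mink_sym; auto).
  set (q' := fun i => q i + ssum n (fun A => x A * B A i) + X / 2 * p i) in *.
  assert (q'p : mink n q' p = -1).
  { rewrite mink_sym, Hq, pq, pp, ssum_zero by (intros; rewrite pB by auto; ring). ring. }
  assert (q'B : forall A, (1 <= A <= n)%nat -> mink n q' (B A) = x A).
  { intros A HA. rewrite mink_sym, Hq, Bq, Bp by auto.
    rewrite (ssum_ext n _ (fun i => x i * (if Nat.eqb i A then 1 else 0)))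
      by (intros; rewrite BB, Nat.eqb_sym by auto; reflexivity).
    rewrite ssum_delta by auto. ring. }
  split; auto.
  - rewrite Hq, q'p, mink_sym, Hq, qq, qp.
    rewrite ssum_zero by (intros; rewrite qB by auto; ring).
    rewrite (ssum_ext n _ (fun A => x A * x A)) by (intros; rewrite q'B by auto; ring).
    fold X. field.
  - rewrite mink_sym; auto.
  - intros A HA. cbv beta. rewrite HB, pB, pp by auto. ring.
  - intros A HA. cbv beta. rewrite HB, q'B, q'p by auto. ring.
  - intros A A' HA HA'. cbv beta. rewrite HB, mink_sym, HB, Bp by auto. rewrite (mink_sym n _ p), HB.
    rewrite BB, !pB, pp, Nat.eqb_sym by auto. ring.
  - intros v i Hi. rewrite (sp v i Hi) at 1. rewrite Hq.
    rewrite (ssum_ext n (fun A => mink n v (fun j => B A j + x A * p j) * (B A i + x A * p i))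
      (fun A => mink n v (B A) * B A i + x A * mink n v (B A) * p i
              + mink n v p * (x A * B A i) + (mink n v p * p i) * (x A * x A)))
      by (intros; rewrite HB; ring).
    rewrite !ssum_plus, !ssum_scal, ssum_scal_r. fold X. unfold q'. field.
Qed.

(** The rotation taking [B 1] to the unit vector [W = sum_A w_A B_A] in the
    plane of these two vectors. *)
Lemma nullframe_rot n p q B (w : nat -> R) (W := fun i => ssum n (fun A => w A * B A i)) :
  (1 <= n)%nat -> nullframe n p q B -> ssum n (fun A => w A * w A) = 1 -> 1 + w 1%nat <> 0 ->
  nullframe n p q (fun A i => if Nat.eqb A 1 then W i
                              else B A i - w A / (1 + w 1%nat) * (B 1%nat i + W i)).
Proof.
  intros Hn [pp qq pq pB qB BB sp] Hw H1.
  assert (qp : mink n q p = -1) by (rewrite mink_sym; auto).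
  assert (HW : forall v, mink n v W = ssum n (fun A => w A * mink n v (B A)))
    by (intros; apply mink_scomb_r).
  set (B' := fun A i => if Nat.eqb A 1 then W i
                        else B A i - w A / (1 + w 1%nat) * (B 1%nat i + W i)).
  assert (HB : forall v A, A <> 1%nat -> mink n v (B' A) =
     mink n v (B A) - w A / (1 + w 1%nat) * (mink n v (B 1%nat) + mink n v W)).
  { intros v A HA. unfold B'. rewrite (proj2 (Nat.eqb_neq _ _) HA).
    rewrite mink_minus_r, mink_scal_r, mink_plus_r. reflexivity. }
  assert (HB1 : forall v, mink n v (B' 1%nat) = mink n v W) by (intros; apply mink_ext; auto).
  assert (BW : forall A, (1 <= A <= n)%nat -> mink n (B A) W = w A).
  { intros A HA. rewrite HW, (ssum_ext n _ (fun i => w i * (if Nat.eqb i A then 1 else 0)))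
      by (intros; rewrite BB, Nat.eqb_sym by auto; reflexivity).
    apply ssum_delta; auto. }
  assert (WB : forall A, (1 <= A <= n)%nat -> mink n W (B A) = w A)
    by (intros; rewrite mink_sym; auto).
  assert (WW : mink n W W = 1).
  { rewrite HW, <- Hw. apply ssum_ext; intros. rewrite WB by auto. ring. }
  assert (pW : mink n p W = 0) by (rewrite HW; apply ssum_zero; intros; rewrite pB by auto; ring).
  assert (qW : mink n q W = 0) by (rewrite HW; apply ssum_zero; intros; rewrite qB by auto; ring).
  assert (B1B : forall A, (1 <= A <= n)%nat -> A <> 1%nat -> mink n (B 1%nat) (B A) = 0).
  { intros. rewrite BB by lia. rewrite (proj2 (Nat.eqb_neq _ _)) by lia. reflexivity. }
  assert (B11 : mink n (B 1%nat) (B 1%nat) = 1) by (rewrite BB by lia; reflexivity).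
  split; auto.
  - intros A HA. destruct (Nat.eq_dec A 1) as [->|h]; [rewrite HB1; auto|].
    rewrite HB, !pB, pW by (auto; lia). ring.
  - intros A HA. destruct (Nat.eq_dec A 1) as [->|h]; [rewrite HB1; auto|].
    rewrite HB, !qB, qW by (auto; lia). ring.
  - intros A A' HA HA'.
    destruct (Nat.eq_dec A 1) as [->|h]; destruct (Nat.eq_dec A' 1) as [->|h'].
    + rewrite HB1, mink_sym, HB1. simpl. auto.
    + assert (B1v : forall v, mink n (B' 1%nat) v = mink n W v)
        by (intros; rewrite mink_sym, HB1, mink_sym; reflexivity).
      rewrite HB, (B1v (B A')), (B1v (B 1%nat)), (B1v W), !WB, WW by lia.
      rewrite (proj2 (Nat.eqb_neq 1 A')) by lia. field; auto.
    + rewrite HB1, mink_sym, HB, WW by auto. rewrite !WB by lia.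
      rewrite (proj2 (Nat.eqb_neq A 1)) by lia. field; auto.
    + rewrite HB by auto. rewrite !(mink_sym n (B' A)), !HB by auto.
      rewrite WW, !WB, !BW, (mink_sym n (B A') (B 1%nat)), !B1B, B11, BB by lia.
      rewrite Nat.eqb_sym. field; auto.
  - intros v i Hi. rewrite (sp v i Hi) at 1. f_equal.
    rewrite (ssum_first n (fun A => mink n v (B A) * B A i)) by lia.
    rewrite (ssum_first n (fun A => mink n v (B' A) * B' A i)) by lia.
    set (a := mink n v (B 1%nat)). set (b := mink n v W).
    rewrite (rsum_ext (n-1) (fun k => mink n v (B' (k+2)%nat) * B' (k+2)%nat i)
     (fun k => mink n v (B (k+2)%nat) * B (k+2)%nat i
       - ((B 1%nat i + W i) / (1 + w 1%nat)) * (w (k+2)%nat * mink n v (B (k+2)%nat))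
       - ((a + b) / (1 + w 1%nat)) * (w (k+2)%nat * B (k+2)%nat i)
       + ((a + b) * (B 1%nat i + W i) / (1 + w 1%nat) ^ 2) * (w (k+2)%nat * w (k+2)%nat))).
    2:{ intros k Hk. rewrite HB by lia. fold a b. unfold B'.
        rewrite (proj2 (Nat.eqb_neq (k+2) 1)) by lia. field; auto. }
    rewrite rsum_plus, !rsum_minus, !rsum_scal.
    rewrite (ssum_first n) in Hw by lia.
    assert (Hb := HW v). rewrite (ssum_first n) in Hb by lia. fold a b in Hb.
    assert (Hi' : W i = ssum n (fun A => w A * B A i)) by reflexivity.
    rewrite (ssum_first n) in Hi' by lia.
    replace (rsum (n-1) (fun k => w (k+2)%nat * w (k+2)%nat)) with (1 - w 1%nat * w 1%nat) by lra.
    replace (rsum (n-1) (fun k => w (k+2)%nat * mink n v (B (k+2)%nat))) with (b - w 1%nat * a) by lra.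
    replace (rsum (n-1) (fun k => w (k+2)%nat * B (k+2)%nat i)) with (W i - w 1%nat * B 1%nat i) by lra.
    rewrite HB1. fold b. change (B' 1%nat i) with (W i). field; auto.
Qed.

(** * Isometry matrices and vectors given by their components in a frame *)

Definition frame_cols (n : nat) (p q : vec) (B : nat -> vec) : nat -> nat -> R :=
  fun i j => if Nat.eqb j 0 then p i else if Nat.eqb j (S n) then q i else B j i.

Lemma isometry_intro n M :
  mink n (col M 0) (col M 0) = 0 -> mink n (col M (S n)) (col M (S n)) = 0 ->
  mink n (col M 0) (col M (S n)) = -1 ->
  (forall A, (1 <= A <= n)%nat -> mink n (col M 0) (col M A) = 0) ->
  (forall A, (1 <= A <= n)%nat -> mink n (col M (S n)) (col M A) = 0) ->
  (forall A A', (1 <= A <= n)%nat -> (1 <= A' <= n)%nat ->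
     mink n (col M A) (col M A') = if Nat.eqb A A' then 1 else 0) ->
  isometry n M.
Proof.
  intros H00 HSS H0S H0 HS HA j k Hj Hk.
  assert (cases : forall i, (i <= S n)%nat -> (i = 0 \/ i = S n \/ (1 <= i <= n))%nat) by lia.
  destruct (nullframe_unit n) as [pp qq pq pB qB BB _].
  destruct (cases j Hj) as [->|[->|h]]; destruct (cases k Hk) as [->|[->|h']].
  - congruence.
  - congruence.
  - rewrite H0, pB; auto.
  - rewrite mink_sym, H0S, mink_sym; auto.
  - congruence.
  - rewrite HS, qB; auto.
  - rewrite mink_sym, H0, mink_sym, pB; auto.
  - rewrite mink_sym, HS, mink_sym, qB; auto.
  - rewrite HA, BB; auto.
Qed.

Lemma isometry_frame_cols n p q B : nullframe n p q B -> isometry n (frame_cols n p q B).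
Proof.
  intros [pp qq pq pB qB BB _].
  assert (c0 : forall i, col (frame_cols n p q B) 0 i = p i) by reflexivity.
  assert (cS : forall i, col (frame_cols n p q B) (S n) i = q i).
  { intros. unfold col, frame_cols. rewrite Nat.eqb_refl. reflexivity. }
  assert (cA : forall A i, (1 <= A <= n)%nat -> col (frame_cols n p q B) A i = B A i).
  { intros. unfold col, frame_cols. rewrite !(proj2 (Nat.eqb_neq _ _)) by lia. reflexivity. }
  apply isometry_intro; intros.
  - rewrite <- pp. apply mink_ext; auto.
  - rewrite <- qq. apply mink_ext; auto.
  - rewrite <- pq. apply mink_ext; auto.
  - rewrite <- (pB A) by auto. apply mink_ext; auto.
  - rewrite <- (qB A) by auto. apply mink_ext; auto.
  - rewrite <- (BB A A') by auto. apply mink_ext; auto.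
Qed.

Definition comb (n : nat) (M : nat -> nat -> R) (c : vec) : vec :=
  fun i => rsum (S (S n)) (fun a => c a * M i a).

Lemma comb_ext n M c d i : (forall a, (a <= S n)%nat -> c a = d a) -> comb n M c i = comb n M d i.
Proof. intros H. apply rsum_ext. intros. rewrite H by lia. reflexivity. Qed.

Lemma comb_unitv n M j i : (j <= S n)%nat -> comb n M (unitv j) i = M i j.
Proof.
  intros H. unfold comb. rewrite (rsum_single _ j) by
    (try lia; intros; rewrite unitv_diff by auto; ring).
  rewrite unitv_same. ring.
Qed.

Lemma mink_comb2 n M c d :
  mink n (comb n M c) (comb n M d) =
  rsum (S (S n)) (fun a => c a * rsum (S (S n)) (fun b => d b * mink n (col M b) (col M a))).
Proof.
  unfold comb. rewrite (mink_comb n (S (S n)) c (fun a i => M i a)).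
  apply rsum_ext. intros a _. f_equal.
  rewrite mink_sym, (mink_comb n (S (S n)) d (fun a i => M i a)). reflexivity.
Qed.

Lemma comb_id n c i : (i <= S n)%nat -> comb n (fun i j => unitv j i) c i = c i.
Proof.
  intros H. unfold comb. rewrite (rsum_single _ i) by
    (try lia; intros j _ hj; rewrite unitv_diff by auto; ring).
  rewrite unitv_same. ring.
Qed.

Lemma mink_comb_iso n M c d :
  isometry n M -> mink n (comb n M c) (comb n M d) = mink n c d.
Proof.
  intros H. rewrite mink_comb2.
  transitivity (mink n (comb n (fun i j => unitv j i) c) (comb n (fun i j => unitv j i) d)).
  - rewrite mink_comb2. apply rsum_ext; intros a Ha; f_equal. apply rsum_ext; intros b Hb; f_equal.
    rewrite H by lia. reflexivity.
  - apply mink_ext; intros; apply comb_id; auto.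
Qed.

Lemma isometry_mult n M C :
  isometry n M -> isometry n C -> isometry n (fun i j => comb n M (col C j) i).
Proof.
  intros HM HC j k Hj Hk. rewrite <- (HC j k Hj Hk).
  exact (mink_comb_iso n M (col C j) (col C k) HM).
Qed.

Lemma mink_col_comb n M c k :
  isometry n M -> (k <= S n)%nat -> mink n (comb n M c) (col M k) = mink n c (unitv k).
Proof.
  intros H Hk. rewrite <- (mink_comb_iso n M c (unitv k) H). apply mink_ext; auto.
  intros i _. symmetry. exact (comb_unitv n M k i Hk).
Qed.

(** * Quantities depending on the variation parameter *)

Lemma smooth_on_is_derive (I : R -> Prop) g :
  smooth_on I g -> exists g', smooth_on I g' /\ forall t, I t -> is_derive g t (g' t).
Proof.
  intros [D [H0 H]]. exists (D 1%nat). split.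
  - exists (fun k => D (S k)). split; auto.
  - intros t It. apply is_derive_ext with (D 0%nat); auto. apply is_derive_Reals. auto.
Qed.

Lemma smooth_on_const (I : R -> Prop) c : smooth_on I (fun _ => c).
Proof.
  exists (fun k _ => match k with O => c | S _ => 0 end). split; auto.
  intros [|k] t _; apply is_derive_Reals; auto_derive; auto.
Qed.

Lemma open_interval_locally (I : R -> Prop) t : is_open_interval I -> I t -> locally t I.
Proof.
  intros (_ & _ & H) It. destruct (H t It) as (e & he & H').
  exists (mkposreal e he). intros y hy. apply H'. exact hy.
Qed.

Section Gen.

Context (I : R -> Prop) (a b delta : R).
Hypothesis I_open : is_open_interval I.
Hypothesis ab_I : forall t, a <= t <= b -> I t.

Local Notation dom e := (- delta < e < delta).

(** The class of functions of [(eps, t)] used for perturbed quantities.  It is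
    closed under [d/dt], and the lower bounds required of denominators and
    radicands make its members bounded on [a, b] uniformly in [eps]. *)
Inductive Gen : (R -> R -> R) -> Prop :=
| Gen_smooth g : smooth_on I g -> Gen (fun _ t => g t)
| Gen_eps : Gen (fun e _ => e)
| Gen_plus f g : Gen f -> Gen g -> Gen (fun e t => f e t + g e t)
| Gen_mult f g : Gen f -> Gen g -> Gen (fun e t => f e t * g e t)
| Gen_inv f m : Gen f -> 0 < m ->
    (forall e t, dom e -> I t -> f e t <> 0) ->
    (forall e t, dom e -> a <= t <= b -> m <= Rabs (f e t)) ->
    Gen (fun e t => / f e t)
| Gen_sqrt f m : Gen f -> 0 < m ->
    (forall e t, dom e -> I t -> 0 < f e t) ->
    (forall e t, dom e -> a <= t <= b -> m <= f e t) ->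
    Gen (fun e t => sqrt (f e t))
| Gen_ext f g : Gen f -> (forall e t, dom e -> I t -> f e t = g e t) -> Gen g.

Lemma Gen_const c : Gen (fun _ _ => c).
Proof. apply (Gen_smooth (fun _ => c)). apply smooth_on_const. Qed.

Lemma Gen_opp f : Gen f -> Gen (fun e t => - f e t).
Proof.
  intros H. apply Gen_ext with (fun e t => -1 * f e t).
  - apply Gen_mult; auto using Gen_const.
  - intros; ring.
Qed.

Lemma Gen_minus f g : Gen f -> Gen g -> Gen (fun e t => f e t - g e t).
Proof. intros. apply Gen_plus; auto using Gen_opp. Qed.

Lemma Gen_rsum k (f : nat -> R -> R -> R) :
  (forall j, (j < k)%nat -> Gen (f j)) -> Gen (fun e t => rsum k (fun j => f j e t)).
Proof.
  induction k as [|k IH]; intros H; simpl; [apply Gen_const|].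
  apply Gen_plus; auto.
Qed.

Lemma Gen_ssum n (f : nat -> R -> R -> R) :
  (forall j, (1 <= j <= n)%nat -> Gen (f j)) -> Gen (fun e t => ssum n (fun j => f j e t)).
Proof. intros H. apply (Gen_rsum n (fun j => f (S j))). intros; apply H; lia. Qed.

(** The derivatives of an inverse and of a root involve only inverses and roots already present, so
    the lower bounds [m] and [sqrt m] can be reused. *)
Lemma Gen_derivable f : Gen f ->
  exists f', Gen f' /\ forall e t, dom e -> I t -> is_derive (f e) t (f' e t).
Proof.
  induction 1 as [g Hg| |f g Hf [f' [Gf Df]] Hg [g' [Gg Dg]]|f g Hf [f' [Gf Df]] Hg [g' [Gg Dg]]
    |f m Hf [f' [Gf Df]] Hm H0 Hb|f m Hf [f' [Gf Df]] Hm H0 Hb|f g Hf [f' [Gf Df]] Hfg].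
  - destruct (smooth_on_is_derive _ _ Hg) as (g' & Sg & Dg).
    exists (fun _ t => g' t). split; [apply Gen_smooth|]; auto.
  - exists (fun _ _ => 0). split; [apply Gen_const|]. intros. apply @is_derive_const.
  - exists (fun e t => f' e t + g' e t). split; [apply Gen_plus; auto|].
    intros. apply @is_derive_plus; auto.
  - exists (fun e t => f' e t * g e t + f e t * g' e t). split.
    + apply Gen_plus; apply Gen_mult; auto.
    + intros. apply (is_derive_mult (f e) (g e)); auto. intros; apply Rmult_comm.
  - exists (fun e t => - (f' e t) * (/ f e t * / f e t)). split.
    + apply Gen_mult; [apply Gen_opp; auto|]. apply Gen_mult; apply Gen_inv with m; auto.
    + intros. replace (- f' e t * (/ f e t * / f e t)) with (- f' e t / f e t ^ 2) by (field; auto).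
      apply is_derive_inv; auto.
  - exists (fun e t => f' e t * (/ 2 * / sqrt (f e t))). split.
    + apply Gen_mult; auto. apply Gen_mult; [apply Gen_const|].
      apply Gen_inv with (sqrt m).
      * apply Gen_sqrt with m; auto.
      * apply sqrt_lt_R0; auto.
      * intros e t he ht. apply Rgt_not_eq, sqrt_lt_R0; auto.
      * intros e t he ht. rewrite Rabs_pos_eq by apply sqrt_pos.
        apply sqrt_le_1_alt; auto.
    + intros e t he ht. assert (h := H0 e t he ht).
      assert (h' := sqrt_lt_R0 _ h).
      replace (f' e t * (/ 2 * / sqrt (f e t))) with (f' e t / (2 * sqrt (f e t))) by (field; lra).
      apply is_derive_sqrt; auto.
  - exists f'. split; auto. intros e t he ht.
    apply is_derive_ext_loc with (f e); auto.
    apply (filter_imp I); [intros; apply Hfg; auto|].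
    apply open_interval_locally; auto.
Qed.

Definition Dt (f : R -> R -> R) : R -> R -> R := fun e t => Derive (f e) t.

Lemma Gen_is_derive f e t : Gen f -> dom e -> I t -> is_derive (f e) t (Dt f e t).
Proof.
  intros H he ht. destruct (Gen_derivable f H) as (f' & _ & D).
  unfold Dt. rewrite (is_derive_unique _ _ _ (D e t he ht)). auto.
Qed.

Lemma Gen_Dt f : Gen f -> Gen (Dt f).
Proof.
  intros H. destruct (Gen_derivable f H) as (f' & G & D).
  apply Gen_ext with f'; auto. intros. symmetry. apply is_derive_unique; auto.
Qed.

Lemma Gen_smooth_on f e : Gen f -> dom e -> smooth_on I (f e).
Proof.
  intros H he.
  assert (K : forall k, Gen (fun e t => Derive_n (f e) k t)).
  { induction k; simpl; auto. apply (Gen_Dt _ IHk). }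
  exists (fun k t => Derive_n (f e) k t). split; auto. intros k t ht.
  apply is_derive_Reals. apply (Gen_is_derive _ e t (K k)); auto.
Qed.

(** Compactness of [[a, b]] enters only for the smooth functions of [t]; the other constructors
    propagate bounds, an inverse being controlled by its lower bound [m]. This is what makes
    remainders uniform in [eps]. *)
Lemma Gen_bounded f : Gen f ->
  exists C, 0 <= C /\ forall e t, dom e -> a <= t <= b -> Rabs (f e t) <= C.
Proof.
  induction 1 as [g Hg| |f g Hf [C [C0 HC]] Hg [C' [C0' HC']]|f g Hf [C [C0 HC]] Hg [C' [C0' HC']]
    |f m Hf [C [C0 HC]] Hm H0 Hb|f m Hf [C [C0 HC]] Hm H0 Hb|f g Hf [C [C0 HC]] Hfg].
  - destruct (smooth_on_is_derive _ _ Hg) as (g' & _ & D).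
    destruct (Rle_dec a b) as [h|h].
    + destruct (continuity_ab_maj (fun t => Rabs (g t)) a b h) as [M [HM _]].
      { intros c hc. apply (continuity_pt_comp g Rabs); [|apply Rcontinuity_abs].
        apply derivable_continuous_pt. exists (g' c). apply is_derive_Reals. apply D. apply ab_I. auto. }
      exists (Rabs (g M)). split; [apply Rabs_pos|]. auto.
    + exists 0. split; [lra|]. intros; lra.
  - exists (Rabs delta). split; [apply Rabs_pos|]. intros e t he _.
    apply Rabs_le. assert (h := Rle_abs delta). lra.
  - exists (C + C'). split; [lra|]. intros e t he ht.
    eapply Rle_trans; [apply Rabs_triang|]. apply Rplus_le_compat; auto.
  - exists (C * C'). split; [apply Rmult_le_pos; auto|]. intros e t he ht.
    rewrite Rabs_mult. apply Rmult_le_compat; auto using Rabs_pos.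
  - exists (/ m). split; [left; apply Rinv_0_lt_compat; auto|]. intros e t he ht.
    rewrite Rabs_inv. apply Rinv_le_contravar; auto.
  - exists (sqrt C). split; [apply sqrt_pos|]. intros e t he ht.
    rewrite Rabs_pos_eq by apply sqrt_pos. apply sqrt_le_1_alt.
    eapply Rle_trans; [apply Rle_abs|]. auto.
  - exists C. split; auto. intros e t he ht. rewrite <- Hfg; auto.
Qed.

(** Continuity in the variation parameter: letting it run from 0 gives the path that keeps the
    perturbed frame in the identity component. *)
Lemma Gen_continuity_eps f e t : Gen f -> dom e -> I t -> continuity_pt (fun e => f e t) e.
Proof.
  intros H he ht. induction H as [g Hg| | | |f m Hf IH Hm H0 Hb|f m Hf IH Hm H0 Hb|f g Hf IH Hfg].
  - apply continuity_pt_const. intros x y; reflexivity.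
  - apply (derivable_continuous_pt id). apply derivable_pt_id.
  - apply continuity_pt_plus; auto.
  - apply continuity_pt_mult; auto.
  - apply continuity_pt_inv; auto.
  - apply (continuity_pt_comp (fun e => f e t) sqrt); auto.
    apply continuity_pt_sqrt. left; auto.
  - apply continuity_pt_ext_loc with (fun e => f e t); auto.
    assert (hp : 0 < Rmin (delta - e) (delta + e)) by (apply Rmin_glb_lt; lra).
    exists (mkposreal _ hp). intros y hy. apply Hfg; auto.
    change (Rabs (y - e) < Rmin (delta - e) (delta + e)) in hy.
    apply Rabs_def2 in hy. assert (h1 := Rmin_l (delta - e) (delta + e)).
    assert (h2 := Rmin_r (delta - e) (delta + e)). lra.
Qed.

(** Exact factorizations instead of estimates: since the cofactor [r] stays in [Gen] and [eps] is
    constant for [d/dt], the orders survive differentiation in [t], and [Gen_bounded] turns them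
    into uniform bounds on [[a, b]]. *)
Definition O1 (f : R -> R -> R) : Prop :=
  exists r, Gen r /\ forall e t, dom e -> I t -> f e t = e * r e t.

Definition O2 (f : R -> R -> R) : Prop :=
  exists r, Gen r /\ forall e t, dom e -> I t -> f e t = e * e * r e t.

Lemma O1_ext f g : O1 f -> (forall e t, dom e -> I t -> f e t = g e t) -> O1 g.
Proof. intros [r [G H]] E. exists r. split; auto. intros. rewrite <- E; auto. Qed.

Lemma O2_ext f g : O2 f -> (forall e t, dom e -> I t -> f e t = g e t) -> O2 g.
Proof. intros [r [G H]] E. exists r. split; auto. intros. rewrite <- E; auto. Qed.

Lemma O1_Gen f : O1 f -> Gen f.
Proof.
  intros [r [G H]]. apply Gen_ext with (fun e t => e * r e t).
  - apply Gen_mult; auto using Gen_eps.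
  - intros; symmetry; auto.
Qed.

Lemma O2_O1 f : O2 f -> O1 f.
Proof.
  intros [r [G H]]. exists (fun e t => e * r e t). split.
  - apply Gen_mult; auto using Gen_eps.
  - intros; rewrite H; auto; ring.
Qed.

Lemma O1_eps f : Gen f -> O1 (fun e t => e * f e t).
Proof. intros H. exists f. auto. Qed.

Lemma O2_eps f : Gen f -> O2 (fun e t => e * e * f e t).
Proof. intros H. exists f. auto. Qed.

Lemma O1_plus f g : O1 f -> O1 g -> O1 (fun e t => f e t + g e t).
Proof.
  intros [r [G H]] [r' [G' H']]. exists (fun e t => r e t + r' e t).
  split; [apply Gen_plus; auto|]. intros; rewrite H, H'; auto; ring.
Qed.

Lemma O2_plus f g : O2 f -> O2 g -> O2 (fun e t => f e t + g e t).
Proof.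
  intros [r [G H]] [r' [G' H']]. exists (fun e t => r e t + r' e t).
  split; [apply Gen_plus; auto|]. intros; rewrite H, H'; auto; ring.
Qed.

Lemma O1_mult f g : Gen f -> O1 g -> O1 (fun e t => f e t * g e t).
Proof.
  intros Gf [r [G H]]. exists (fun e t => f e t * r e t).
  split; [apply Gen_mult; auto|]. intros; rewrite H; auto; ring.
Qed.

Lemma O2_mult f g : Gen f -> O2 g -> O2 (fun e t => f e t * g e t).
Proof.
  intros Gf [r [G H]]. exists (fun e t => f e t * r e t).
  split; [apply Gen_mult; auto|]. intros; rewrite H; auto; ring.
Qed.

Lemma O1_mult_O1 f g : O1 f -> O1 g -> O2 (fun e t => f e t * g e t).
Proof.
  intros [r [G H]] [r' [G' H']]. exists (fun e t => r e t * r' e t).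
  split; [apply Gen_mult; auto|]. intros; rewrite H, H'; auto; ring.
Qed.

Lemma O1_opp f : O1 f -> O1 (fun e t => - f e t).
Proof.
  intros H. apply O1_ext with (fun e t => -1 * f e t); [|intros; ring].
  apply O1_mult; auto using Gen_const.
Qed.

Lemma O2_opp f : O2 f -> O2 (fun e t => - f e t).
Proof.
  intros H. apply O2_ext with (fun e t => -1 * f e t); [|intros; ring].
  apply O2_mult; auto using Gen_const.
Qed.

Lemma O2_minus f g : O2 f -> O2 g -> O2 (fun e t => f e t - g e t).
Proof. intros; apply O2_plus; auto using O2_opp. Qed.

Lemma O1_minus f g : O1 f -> O1 g -> O1 (fun e t => f e t - g e t).
Proof. intros; apply O1_plus; auto using O1_opp. Qed.

Lemma O1_zero : O1 (fun _ _ => 0).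
Proof. exists (fun _ _ => 0). split; [apply Gen_const|]; intros; ring. Qed.

Lemma O2_zero : O2 (fun _ _ => 0).
Proof. exists (fun _ _ => 0). split; [apply Gen_const|]; intros; ring. Qed.

Lemma O1_rsum k (f : nat -> R -> R -> R) :
  (forall j, (j < k)%nat -> O1 (f j)) -> O1 (fun e t => rsum k (fun j => f j e t)).
Proof.
  induction k as [|k IH]; intros H; simpl; [apply O1_zero|]. apply O1_plus; auto.
Qed.

Lemma O2_rsum k (f : nat -> R -> R -> R) :
  (forall j, (j < k)%nat -> O2 (f j)) -> O2 (fun e t => rsum k (fun j => f j e t)).
Proof.
  induction k as [|k IH]; intros H; simpl; [apply O2_zero|]. apply O2_plus; auto.
Qed.

Lemma O1_ssum n (f : nat -> R -> R -> R) :
  (forall j, (1 <= j <= n)%nat -> O1 (f j)) -> O1 (fun e t => ssum n (fun j => f j e t)).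
Proof. intros H. apply (O1_rsum n (fun j => f (S j))). intros; apply H; lia. Qed.

Lemma O2_ssum n (f : nat -> R -> R -> R) :
  (forall j, (1 <= j <= n)%nat -> O2 (f j)) -> O2 (fun e t => ssum n (fun j => f j e t)).
Proof. intros H. apply (O2_rsum n (fun j => f (S j))). intros; apply H; lia. Qed.

Lemma Dt_ext f g e t : dom e -> I t ->
  (forall e t, dom e -> I t -> f e t = g e t) -> Dt f e t = Dt g e t.
Proof.
  intros he ht H. apply Derive_ext_loc. apply (filter_imp I); [intros; apply H; auto|].
  apply open_interval_locally; auto.
Qed.

Lemma O1_Dt f : O1 f -> O1 (Dt f).
Proof.
  intros [r [G H]]. exists (Dt r). split; [apply Gen_Dt; auto|]. intros.
  rewrite (Dt_ext f (fun e t => e * r e t)) by auto. unfold Dt. apply Derive_scal.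
Qed.

Lemma O2_Dt f : O2 f -> O2 (Dt f).
Proof.
  intros [r [G H]]. exists (Dt r). split; [apply Gen_Dt; auto|]. intros.
  rewrite (Dt_ext f (fun e t => e * e * r e t)) by auto. unfold Dt. apply Derive_scal.
Qed.

Lemma O1_at0 f t : 0 < delta -> O1 f -> I t -> f 0 t = 0.
Proof. intros hd [r [G H]] ht. rewrite H by (auto; lra). ring. Qed.

Lemma Gen_ex_derive f e t : Gen f -> dom e -> I t -> ex_derive (f e) t.
Proof. intros. eexists. apply Gen_is_derive; eauto. Qed.

Lemma Dt_plus f g e t : Gen f -> Gen g -> dom e -> I t ->
  Dt (fun e t => f e t + g e t) e t = Dt f e t + Dt g e t.
Proof. intros. apply Derive_plus; apply Gen_ex_derive; auto. Qed.

Lemma Dt_minus f g e t : Gen f -> Gen g -> dom e -> I t ->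
  Dt (fun e t => f e t - g e t) e t = Dt f e t - Dt g e t.
Proof. intros. apply Derive_minus; apply Gen_ex_derive; auto. Qed.

Lemma Dt_mult f g e t : Gen f -> Gen g -> dom e -> I t ->
  Dt (fun e t => f e t * g e t) e t = Dt f e t * g e t + f e t * Dt g e t.
Proof. intros. apply Derive_mult; apply Gen_ex_derive; auto. Qed.

Lemma Dt_const f e t c : dom e -> I t -> (forall e t, dom e -> I t -> f e t = c) -> Dt f e t = 0.
Proof.
  intros he ht H. rewrite (Dt_ext f (fun _ _ => c)) by auto. unfold Dt. apply Derive_const.
Qed.

Lemma Dt_rsum k (f : nat -> R -> R -> R) e t :
  (forall j, (j < k)%nat -> Gen (f j)) -> dom e -> I t ->
  Dt (fun e t => rsum k (fun j => f j e t)) e t = rsum k (fun j => Dt (f j) e t).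
Proof.
  intros H he ht. induction k as [|k IH]; simpl.
  - unfold Dt. apply Derive_const.
  - rewrite (Dt_plus (fun e t => rsum k (fun j => f j e t)) (f k)), IH; auto.
    apply Gen_rsum; auto.
Qed.

Lemma Dt_ssum n (f : nat -> R -> R -> R) e t :
  (forall j, (1 <= j <= n)%nat -> Gen (f j)) -> dom e -> I t ->
  Dt (fun e t => ssum n (fun j => f j e t)) e t = ssum n (fun j => Dt (f j) e t).
Proof. intros H. apply (Dt_rsum n (fun j => f (S j))). intros; apply H; lia. Qed.

End Gen.

(** * Moving frames *)

Lemma is_derive_rsum k (f : nat -> R -> R) (f' : nat -> R) t :
  (forall j, (j < k)%nat -> is_derive (f j) t (f' j)) ->
  is_derive (fun s => rsum k (fun j => f j s)) t (rsum k f').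
Proof.
  induction k as [|k IH]; intros H; simpl.
  - apply @is_derive_const.
  - apply @is_derive_plus; auto.
Qed.

Lemma is_derive_Rmult (f g : R -> R) t f' g' :
  is_derive f t f' -> is_derive g t g' ->
  is_derive (fun s => f s * g s) t (f' * g t + f t * g').
Proof. intros. apply (is_derive_mult f g); auto. intros; apply Rmult_comm. Qed.

Lemma is_derive_mink n (V W : R -> vec) (V' W' : vec) t :
  (forall i, (i <= S n)%nat -> is_derive (fun s => V s i) t (V' i)) ->
  (forall i, (i <= S n)%nat -> is_derive (fun s => W s i) t (W' i)) ->
  is_derive (fun s => mink n (V s) (W s)) t (mink n V' (W t) + mink n (V t) W').
Proof.
  intros HV HW.
  replace (mink n V' (W t) + mink n (V t) W') with
    (rsum n (fun k => V' (S k) * W t (S k) + V t (S k) * W' (S k))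
     - (V' 0%nat * W t (S n) + V t 0%nat * W' (S n))
     - (V' (S n) * W t 0%nat + V t (S n) * W' 0%nat))
    by (rewrite rsum_plus; unfold mink; ring).
  apply @is_derive_minus; [apply @is_derive_minus|].
  - apply (is_derive_rsum n (fun k s => V s (S k) * W s (S k))). intros.
    apply is_derive_Rmult; [apply HV|apply HW]; lia.
  - apply is_derive_Rmult; [apply HV|apply HW]; lia.
  - apply is_derive_Rmult; [apply HV|apply HW]; lia.
Qed.

Lemma is_derive_locally_const (f : R -> R) t c d :
  locally t (fun s => f s = c) -> is_derive f t d -> d = 0.
Proof.
  intros H D. rewrite <- (is_derive_unique _ _ _ D).
  rewrite (Derive_ext_loc f (fun _ => c)) by auto. apply Derive_const.
Qed.

Lemma comb_plus n M c d i : comb n M (fun a => c a + d a) i = comb n M c i + comb n M d i.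
Proof. unfold comb. rewrite <- rsum_plus. apply rsum_ext; intros; ring. Qed.

Lemma comb_scal n M x c i : comb n M (fun a => x * c a) i = x * comb n M c i.
Proof. unfold comb. rewrite <- rsum_scal. apply rsum_ext; intros; ring. Qed.

Lemma comb_rsum n M k (f : nat -> vec) i :
  comb n M (fun a => rsum k (fun j => f j a)) i = rsum k (fun j => comb n M (f j) i).
Proof.
  unfold comb. rewrite (rsum_swap k). apply rsum_ext; intros. rewrite rsum_scal_r. reflexivity.
Qed.

(** * Paths in the identity component *)

Definition clamp01 (u : R) : R := Rmax 0 (Rmin 1 u).

Lemma clamp01_range u : 0 <= clamp01 u <= 1.
Proof.
  unfold clamp01, Rmax, Rmin. repeat destruct Rle_dec; lra.
Qed.

Lemma clamp01_le u : u <= 0 -> clamp01 u = 0.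
Proof. unfold clamp01, Rmax, Rmin. repeat destruct Rle_dec; lra. Qed.

Lemma clamp01_ge u : 1 <= u -> clamp01 u = 1.
Proof. unfold clamp01, Rmax, Rmin. repeat destruct Rle_dec; lra. Qed.

Lemma continuity_clamp01 : continuity clamp01.
Proof.
  intros u. unfold clamp01. intros eps heps. exists eps. split; auto.
  intros y [_ hy]. simpl in *. unfold R_dist in *.
  eapply Rle_lt_trans; [|exact hy].
  unfold Rmax, Rmin. repeat destruct Rle_dec; unfold Rabs; repeat destruct Rcase_abs; lra.
Qed.

Lemma isometry_ext n M M' :
  (forall i j, (i <= S n)%nat -> (j <= S n)%nat -> M i j = M' i j) ->
  isometry n M -> isometry n M'.
Proof.
  intros E H j k Hj Hk. rewrite <- H by auto.
  apply mink_ext; intros; symmetry; apply E; auto.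
Qed.

(** Concatenation of paths. It serves for the perturbed frame, reached from [e] by increasing [eps],
    and for the frame with two columns negated, reached by a rotation. *)
Lemma moeb_path n (M : nat -> nat -> R) (h : R -> nat -> nat -> R) :
  moeb n M ->
  (forall i j u, (i <= S n)%nat -> (j <= S n)%nat -> 0 <= u <= 1 ->
     continuity_pt (fun u => h u i j) u) ->
  (forall u, 0 <= u <= 1 -> isometry n (h u)) ->
  (forall i j, (i <= S n)%nat -> (j <= S n)%nat -> h 0 i j = M i j) ->
  moeb n (h 1).
Proof.
  intros [_ (g & gc & gi & g0 & g1)] hc hi h0. split; [apply hi; lra|].
  exists (fun u i j => if andb (Nat.leb i (S n)) (Nat.leb j (S n))
     then g (clamp01 (2 * u)) i j + (h (clamp01 (2 * u - 1)) i j - M i j) else unitv j i).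
  assert (cl : forall k, continuity (fun u => clamp01 (2 * u - k))).
  { intros k u. apply (continuity_pt_comp (fun u => 2 * u - k) clamp01); [|apply continuity_clamp01].
    apply derivable_continuous_pt. reg. }
  assert (dec : forall i j, (i <= S n)%nat -> (j <= S n)%nat ->
    andb (Nat.leb i (S n)) (Nat.leb j (S n)) = true).
  { intros i j hi' hj. rewrite !(proj2 (Nat.leb_le _ _)) by auto. reflexivity. }
  repeat split.
  - intros i j u. destruct (Nat.leb_spec i (S n)) as [hi'|hi'];
      [destruct (Nat.leb_spec j (S n)) as [hj|hj]|]; simpl;
      try (apply continuity_pt_const; intros ? ?; reflexivity).
    apply continuity_pt_plus.
    + apply (continuity_pt_comp (fun u => clamp01 (2 * u)) (fun u => g u i j)); [|apply gc].
      apply continuity_pt_ext with (fun u => clamp01 (2 * u - 0)); [|apply cl].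
      intros; f_equal; ring.
    + apply continuity_pt_minus.
      * apply (continuity_pt_comp (fun u => clamp01 (2 * u - 1)) (fun u => h u i j)); [apply cl|].
        apply hc; auto using clamp01_range.
      * apply continuity_pt_const; intros ? ?; reflexivity.
  - intros u hu. destruct (Rle_dec u (/2)).
    + apply isometry_ext with (g (clamp01 (2 * u))); [|apply gi, clamp01_range].
      intros i j Hi Hj. rewrite dec, (clamp01_le (2 * u - 1)), h0 by (auto; lra). ring.
    + apply isometry_ext with (h (clamp01 (2 * u - 1))); [|apply hi, clamp01_range].
      intros i j Hi Hj. rewrite dec, (clamp01_ge (2 * u)), g1 by (auto; lra). ring.
  - intros i j. destruct (Nat.leb_spec i (S n)) as [hi'|hi'];
      [destruct (Nat.leb_spec j (S n)) as [hj|hj]|]; simpl; auto.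
    rewrite (clamp01_le (2 * 0)), (clamp01_le (2 * 0 - 1)), g0, h0 by (auto; lra). ring.
  - intros i j Hi Hj. rewrite dec, (clamp01_ge (2 * 1)), (clamp01_ge (2 * 1 - 1)), g1 by (auto; lra). ring.
Qed.

(** * Differentiation in the components of a moving frame *)

Section MovingFrame.

Context (n : nat) (I : R -> Prop) (e phi : R -> nat -> nat -> R).
Hypothesis I_open : is_open_interval I.
Hypothesis e_smooth : forall i b, (i <= S n)%nat -> (b <= S n)%nat -> smooth_on I (fun t => e t i b).
Hypothesis e_iso : forall t, I t -> isometry n (e t).
Hypothesis e_mc : mc_form n I e phi.

Lemma frame_is_derive t i b : I t -> (i <= S n)%nat -> (b <= S n)%nat ->
  is_derive (fun s => e s i b) t (comb n (e t) (fun a => phi t a b) i).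
Proof. intros. apply is_derive_Reals. apply e_mc; auto. Qed.

(** Derivative of the constant products of the columns: [phi] takes values in the Lie algebra of the
    isometry group. *)
Lemma phi_skew t j k : I t -> (j <= S n)%nat -> (k <= S n)%nat ->
  mink n (fun a => phi t a j) (unitv k) + mink n (fun a => phi t a k) (unitv j) = 0.
Proof.
  intros It Hj Hk.
  rewrite <- (mink_col_comb n (e t) _ k), <- (mink_col_comb n (e t) _ j) by auto.
  rewrite (mink_sym n _ (col (e t) j)).
  apply (is_derive_locally_const (fun s => mink n (col (e s) j) (col (e s) k)) t
    (mink n (unitv j) (unitv k))).
  - apply (filter_imp I); [|apply open_interval_locally; auto].
    intros s Is. apply e_iso; auto.
  - apply (is_derive_mink n (fun s => col (e s) j) (fun s => col (e s) k));
      intros i Hi; apply frame_is_derive; auto.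
Qed.

Context (a b delta : R).
Hypothesis ab_I : forall t, a <= t <= b -> I t.

Local Notation dom e := (- delta < e < delta).
Local Notation Gen := (Gen I a b delta).

Lemma Gen_mink (c d : R -> R -> vec) :
  (forall i, (i <= S n)%nat -> Gen (fun x t => c x t i)) ->
  (forall i, (i <= S n)%nat -> Gen (fun x t => d x t i)) ->
  Gen (fun x t => mink n (c x t) (d x t)).
Proof.
  intros Hc Hd. unfold mink. repeat apply Gen_minus.
  - apply (Gen_rsum I a b delta n (fun k x t => c x t (S k) * d x t (S k))).
    intros; apply Gen_mult; [apply Hc|apply Hd]; lia.
  - apply Gen_mult; [apply Hc|apply Hd]; lia.
  - apply Gen_mult; [apply Hc|apply Hd]; lia.
Qed.

Lemma Gen_frame i j : (i <= S n)%nat -> (j <= S n)%nat -> Gen (fun _ t => e t i j).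
Proof. intros. apply (Gen_smooth I a b delta (fun t => e t i j)). auto. Qed.

(** Nothing is assumed about the regularity of [phi]; it is recovered on [I] from the smooth frame
    as the products of the derivatives of the columns with the columns. *)
Lemma Gen_phi i j : (i <= S n)%nat -> (j <= S n)%nat -> Gen (fun _ t => phi t i j).
Proof.
  intros Hi Hj.
  assert (K : forall k, (k <= S n)%nat -> Gen (fun _ t => mink n (fun i => phi t i j) (unitv k))).
  { intros k Hk. apply Gen_ext with
      (fun x t => mink n (fun i => Dt (fun _ t => e t i j) x t) (fun i => e t i k)).
    - apply Gen_mink; intros; [|apply Gen_frame; auto].
      apply (Gen_Dt I a b delta I_open (fun _ t => e t i0 j)). apply Gen_frame; auto.
    - intros x t hx ht. rewrite <- (mink_col_comb n (e t)) by auto.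
      apply mink_ext; intros; auto. apply is_derive_unique. apply frame_is_derive; auto. }
  destruct (Nat.eq_dec i 0) as [->|h0]; [|destruct (Nat.eq_dec i (S n)) as [->|hS]].
  - apply Gen_ext with (fun _ t => - mink n (fun i => phi t i j) (unitv (S n))).
    + apply (Gen_opp I a b delta (fun _ t => mink n (fun i => phi t i j) (unitv (S n)))); auto.
    + intros. rewrite mink_unitvS. ring.
  - apply Gen_ext with (fun _ t => - mink n (fun i => phi t i j) (unitv 0)).
    + apply (Gen_opp I a b delta (fun _ t => mink n (fun i => phi t i j) (unitv 0))). apply K. lia.
    + intros. rewrite mink_unitv0. ring.
  - apply Gen_ext with (fun _ t => mink n (fun i => phi t i j) (unitv i)); auto.
    intros. rewrite mink_unitv by lia. reflexivity.
Qed.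

(** Components, in the frame [e], of the derivative of the vector with components [c]. *)
Definition Dop (c : R -> R -> vec) (x t : R) : vec :=
  fun i => Dt (fun x t => c x t i) x t + rsum (S (S n)) (fun j => phi t i j * c x t j).

Definition Gvec (c : R -> R -> vec) : Prop :=
  forall i, (i <= S n)%nat -> Gen (fun x t => c x t i).

Lemma Gvec_Dop c : Gvec c -> Gvec (Dop c).
Proof.
  intros H i Hi. apply Gen_plus.
  - apply (Gen_Dt I a b delta I_open (fun x t => c x t i)); auto.
  - apply (Gen_rsum I a b delta _ (fun j x t => phi t i j * c x t j)). intros.
    apply Gen_mult; [apply Gen_phi|apply H]; lia.
Qed.

Lemma Gvec_comb c : Gvec c -> Gvec (fun x t => comb n (e t) (c x t)).
Proof.
  intros H i Hi. apply (Gen_rsum I a b delta _ (fun j x t => c x t j * e t i j)). intros.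
  apply Gen_mult; [apply H|apply Gen_frame]; lia.
Qed.

Lemma is_derive_comb c x t i : Gvec c -> dom x -> I t -> (i <= S n)%nat ->
  is_derive (fun t => comb n (e t) (c x t) i) t (comb n (e t) (Dop c x t) i).
Proof.
  intros H hx ht Hi.
  replace (comb n (e t) (Dop c x t) i) with
    (rsum (S (S n)) (fun j => Dt (fun x t => c x t j) x t * e t i j
        + c x t j * comb n (e t) (fun k => phi t k j) i)).
  - apply (is_derive_rsum _ (fun j t => c x t j * e t i j)). intros j Hj.
    apply is_derive_Rmult.
    + apply (Gen_is_derive I a b delta I_open (fun x t => c x t j)); auto. apply H; lia.
    + apply frame_is_derive; auto; lia.
  - rewrite rsum_plus. unfold Dop. rewrite comb_plus. unfold comb at 2. f_equal.
    transitivity (comb n (e t) (fun k => rsum (S (S n)) (fun j => c x t j * phi t k j)) i).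
    + rewrite (comb_rsum n (e t) (S (S n)) (fun j k => c x t j * phi t k j)).
      apply rsum_ext; intros. rewrite comb_scal. reflexivity.
    + apply comb_ext; intros. apply rsum_ext; intros; ring.
Qed.

(** The isometry [e t] carries components to vectors of the fixed space, where [Dop] becomes the
    ordinary derivative and the product rule applies. *)
Lemma Dop_mink c d x t : Gvec c -> Gvec d -> dom x -> I t ->
  mink n (Dop c x t) (d x t) + mink n (c x t) (Dop d x t)
  = Dt (fun x t => mink n (c x t) (d x t)) x t.
Proof.
  intros Hc Hd hx ht.
  rewrite <- (mink_comb_iso n (e t) (Dop c x t)), <- (mink_comb_iso n (e t) (c x t) (Dop d x t)) by auto. symmetry.
  rewrite (Dt_ext I delta I_open _ (fun x t => mink n (comb n (e t) (c x t)) (comb n (e t) (d x t)))).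
  - apply is_derive_unique.
    apply (is_derive_mink n (fun t => comb n (e t) (c x t)) (fun t => comb n (e t) (d x t)));
      intros; apply is_derive_comb; auto.
  - auto.
  - auto.
  - intros. rewrite mink_comb_iso; auto.
Qed.

Lemma Dop_mink_const c d x t k : Gvec c -> Gvec d -> dom x -> I t ->
  (forall x t, dom x -> I t -> mink n (c x t) (d x t) = k) ->
  mink n (Dop c x t) (d x t) = - mink n (c x t) (Dop d x t).
Proof.
  intros Hc Hd hx ht H. assert (E := Dop_mink c d x t Hc Hd hx ht).
  rewrite (Dt_const I delta I_open _ x t k) in E by auto. lra.
Qed.

(** The Maurer-Cartan matrix of the frame [e * (p | B_1 | ... | B_n | q)]. *)
Definition newphi (p q : R -> R -> vec) (B : nat -> R -> R -> vec) (x t : R) (i j : nat) : R :=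
  let C j := if Nat.eqb j 0 then p else if Nat.eqb j (S n) then q else B j in
  if Nat.eqb i 0 then - mink n (Dop (C j) x t) (q x t)
  else if Nat.eqb i (S n) then - mink n (Dop (C j) x t) (p x t)
  else mink n (Dop (C j) x t) (B i x t).

Definition newframe (p q : R -> R -> vec) (B : nat -> R -> R -> vec) (x t : R) (i j : nat) : R :=
  comb n (e t) (col (frame_cols n (p x t) (q x t) (fun A => B A x t)) j) i.

Lemma newframe_second_order (F : R -> R -> vec) p q B x :
  0 < delta ->
  (forall t, I t -> moeb n (e t)) ->
  Gvec p -> Gvec q -> (forall A, (1 <= A <= n)%nat -> Gvec (B A)) ->
  (forall x t, dom x -> I t -> nullframe n (p x t) (q x t) (fun A => B A x t)) ->
  (forall t i, I t -> (i <= S n)%nat -> p 0 t i = unitv 0 i /\ q 0 t i = unitv (S n) i) ->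
  (forall t A i, I t -> (i <= S n)%nat -> (1 <= A <= n)%nat -> B A 0 t i = unitv A i) ->
  (forall t, I t -> exists lam, lam <> 0 /\
     forall i, (i <= S n)%nat -> comb n (e t) (p x t) i = lam * F x t i) ->
  dom x ->
  (forall t al, I t -> (2 <= al <= n)%nat -> mink n (Dop p x t) (B al x t) = 0) ->
  (forall t al, I t -> (2 <= al <= n)%nat -> mink n (Dop (B 1%nat) x t) (B al x t) = 0) ->
  second_order_frame n I (F x) (newframe p q B x) (newphi p q B x).
Proof.
  intros hd e_moeb Gp Gq GB NF pq0 B0 Hlam hx H0 H1.
  set (C := fun j => if Nat.eqb j 0 then p else if Nat.eqb j (S n) then q else B j).
  assert (GC : forall j, (j <= S n)%nat -> Gvec (C j)).
  { intros j Hj. unfold C. destruct (Nat.eqb_spec j 0); auto.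
    destruct (Nat.eqb_spec j (S n)); auto. apply GB. lia. }
  assert (EC : forall x t j i, col (frame_cols n (p x t) (q x t) (fun A => B A x t)) j i = C j x t i).
  { intros. unfold col, frame_cols, C. destruct (Nat.eqb j 0); auto. destruct (Nat.eqb j (S n)); auto. }
  assert (EN : forall x t i j, newframe p q B x t i j = comb n (e t) (C j x t) i).
  { intros. unfold newframe. apply comb_ext; intros; apply EC. }
  assert (GN : forall i j, (i <= S n)%nat -> (j <= S n)%nat -> Gen (fun x t => newframe p q B x t i j)).
  { intros i j Hi Hj. apply Gen_ext with (fun x t => comb n (e t) (C j x t) i).
    - apply Gvec_comb; auto.
    - intros; rewrite EN; reflexivity. }
  assert (NI : forall x t, dom x -> I t -> isometry n (newframe p q B x t)).
  { intros y t hy ht. apply isometry_mult; [apply e_iso; auto|]. apply isometry_frame_cols. auto. }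
  split; [split|split].
  - intros i j Hi Hj. apply (Gen_smooth_on I a b delta I_open (fun x t => newframe p q B x t i j)); auto.
  - intros t ht. split.
    2:{ destruct (Hlam t ht) as (lam & hl & E). exists lam. split; [exact hl|].
        intros i Hi. rewrite EN. apply E; auto. }
    (* The path joining [e t] to the new frame is [u |-> newframe] at the parameter [u * x]; at
       [u = 0] it is [e t] by [pq0] and [B0]. *)
    replace x with (1 * x) by ring.
    assert (M : forall u, 0 <= u <= 1 -> dom (u * x)) by (intros; split; nra).
    refine (moeb_path n (e t) (fun u => newframe p q B (u * x) t) _ _ _ _); auto.
    + intros i j u Hi Hj hu.
      apply (continuity_pt_comp (fun u => u * x) (fun x => newframe p q B x t i j)).
      * apply derivable_continuous_pt. reg.
      * apply (Gen_continuity_eps I a b delta (fun x t => newframe p q B x t i j)); auto.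
    + intros i j Hi Hj. rewrite Rmult_0_l, EN, <- (comb_unitv n (e t) j) by auto.
      apply comb_ext. intros k Hk. unfold C.
      destruct (Nat.eqb_spec j 0) as [->|]; [apply pq0; auto|].
      destruct (Nat.eqb_spec j (S n)) as [->|]; [apply pq0; auto|]. apply B0; auto; lia.
  - intros t ht i j Hi Hj. apply is_derive_Reals.
    apply is_derive_ext with (fun t => comb n (e t) (C j x t) i); [intros s; symmetry; apply EN|].
    replace (rsum (S (S n)) (fun a0 => newphi p q B x t a0 j * newframe p q B x t i a0))
      with (comb n (e t) (Dop (C j) x t) i); [apply is_derive_comb; auto|].
    rewrite (rsum_ext _ _ (fun k => comb n (e t) (fun l => newphi p q B x t k j * C k x t l) i))
      by (intros; rewrite comb_scal, EN; reflexivity).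
    rewrite <- (comb_rsum n (e t) _ (fun k l => newphi p q B x t k j * C k x t l)).
    apply comb_ext. intros l Hl. rewrite rsum_ends.
    (* The entries of [newphi] are the coefficients of this expansion in the null frame. *)
    rewrite (nf_span _ _ _ _ (NF x t hx ht) (Dop (C j) x t) l Hl) at 1.
    assert (CS : C (S n) = q) by (unfold C; rewrite Nat.eqb_refl; reflexivity).
    assert (N0 : newphi p q B x t 0 j = - mink n (Dop (C j) x t) (q x t)) by reflexivity.
    assert (NS : newphi p q B x t (S n) j = - mink n (Dop (C j) x t) (p x t))
      by (unfold newphi; rewrite Nat.eqb_refl; reflexivity).
    rewrite N0, NS, CS. change (C 0%nat) with p.
    rewrite (ssum_ext n (fun A => newphi p q B x t A j * C A x t l)
      (fun A => mink n (Dop (C j) x t) (B A x t) * B A x t l)).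
    + ring.
    + intros A HA. unfold newphi, C. rewrite !(proj2 (Nat.eqb_neq A _)) by lia. reflexivity.
  - intros t al ht Hal. unfold newphi. rewrite !(proj2 (Nat.eqb_neq al _)) by lia.
    rewrite (proj2 (Nat.eqb_neq 1 (S n))) by lia. simpl. auto.
Qed.

End MovingFrame.

(** * The variation of a special third order frame *)

Ltac gen :=
  lazymatch goal with
  | |- Gen _ _ _ _ (fun e t => @?f e t + @?g e t) => refine (Gen_plus _ _ _ _ f g _ _); cbv beta; gen
  | |- Gen _ _ _ _ (fun e t => @?f e t - @?g e t) => refine (Gen_minus _ _ _ _ f g _ _); cbv beta; gen
  | |- Gen _ _ _ _ (fun e t => @?f e t * @?g e t) => refine (Gen_mult _ _ _ _ f g _ _); cbv beta; gen
  | |- Gen _ _ _ _ (fun e t => - @?f e t) => refine (Gen_opp _ _ _ _ f _); cbv beta; gen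
  | |- Gen _ _ _ _ (fun e t => @?f e t / 2) =>
      refine (Gen_mult _ _ _ _ f (fun _ _ => / 2) _ (Gen_const _ _ _ _ (/ 2))); cbv beta; gen
  | |- Gen _ _ _ _ (fun e t => ssum ?n (fun j => @?f j e t)) =>
      refine (Gen_ssum _ _ _ _ n f _); intros; cbv beta; gen
  | |- Gen _ _ _ _ (fun e _ => e) => apply Gen_eps
  | |- Gen _ _ _ _ (fun _ _ => ?c) => apply (Gen_const _ _ _ _ c)
  | |- Gen _ _ _ _ (Dt ?f) => refine (Gen_Dt _ _ _ _ _ f _); auto; gen
  | |- Gen _ _ _ _ (fun e t => Dt ?f e t) => refine (Gen_Dt _ _ _ _ _ f _); auto; gen
  | |- _ => auto with gen
  end.

Create HintDb gen.

Section SpecialFrame.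

Context (n : nat) (I : R -> Prop) (F : R -> vec) (e phi : R -> nat -> nat -> R).
Hypothesis n_ge3 : (3 <= n)%nat.
Hypothesis I_open : is_open_interval I.
Hypothesis e_special : special_third_order_frame n I F e phi.

(** * Structure equations of a special third order frame *)

Lemma special_smooth i j : (i <= S n)%nat -> (j <= S n)%nat -> smooth_on I (fun t => e t i j).
Proof. apply e_special. Qed.

Lemma special_moeb t : I t -> moeb n (e t).
Proof. intros ht. apply e_special; auto. Qed.

Lemma special_iso t : I t -> isometry n (e t).
Proof. intros ht. apply special_moeb; auto. Qed.

Lemma special_mc : mc_form n I e phi.
Proof. apply e_special. Qed.

Lemma special_ds t : I t -> ds n phi t = phi t 1%nat 0%nat.
Proof. intros ht. symmetry. apply e_special; auto. Qed.

Lemma special_phi_skew t j k : I t -> (j <= S n)%nat -> (k <= S n)%nat ->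
  mink n (fun a => phi t a j) (unitv k) + mink n (fun a => phi t a k) (unitv j) = 0.
Proof.
  intros. apply (phi_skew n I e phi); auto.
  - intros; apply special_iso; auto.
  - apply special_mc.
Qed.

Lemma phi_00 t : I t -> phi t 0%nat 0%nat = 0.
Proof. intros; apply e_special; auto. Qed.

Lemma phi_S0 t : I t -> phi t (S n) 0%nat = 0.
Proof.
  intros ht. assert (H := special_phi_skew t 0 0 ht ltac:(lia) ltac:(lia)).
  rewrite !mink_unitv0 in H. lra.
Qed.

Lemma phi_0S t : I t -> phi t 0%nat (S n) = 0.
Proof.
  intros ht. assert (H := special_phi_skew t (S n) (S n) ht ltac:(lia) ltac:(lia)).
  rewrite !mink_unitvS in H. lra.
Qed.

Lemma phi_SS t : I t -> phi t (S n) (S n) = 0.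
Proof.
  intros ht. assert (H := special_phi_skew t 0 (S n) ht ltac:(lia) ltac:(lia)).
  rewrite mink_unitv0, mink_unitvS in H. assert (H' := phi_00 t ht). lra.
Qed.

Lemma phi_A0 t A : I t -> (2 <= A <= n)%nat -> phi t A 0%nat = 0.
Proof. intros; apply e_special; auto. Qed.

Lemma phi_SA t A : I t -> (1 <= A <= n)%nat -> phi t (S n) A = phi t A 0%nat.
Proof.
  intros ht HA. assert (H := special_phi_skew t 0 A ht ltac:(lia) ltac:(lia)).
  rewrite mink_unitv0, mink_unitv in H by auto. lra.
Qed.

Lemma phi_AS t A : I t -> (1 <= A <= n)%nat -> phi t A (S n) = phi t 0%nat A.
Proof.
  intros ht HA. assert (H := special_phi_skew t (S n) A ht ltac:(lia) ltac:(lia)).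
  rewrite mink_unitvS, mink_unitv in H by auto. lra.
Qed.

Lemma phi_AB t A B : I t -> (1 <= A <= n)%nat -> (1 <= B <= n)%nat -> phi t A B = - phi t B A.
Proof.
  intros ht HA HB. assert (H := special_phi_skew t B A ht ltac:(lia) ltac:(lia)).
  rewrite !mink_unitv in H by auto. lra.
Qed.

Lemma phi_A1 t A : I t -> (1 <= A <= n)%nat -> phi t A 1%nat = 0.
Proof.
  intros ht HA. destruct (Nat.eq_dec A 1) as [->|h].
  - assert (H := phi_AB t 1 1 ht HA HA). lra.
  - apply e_special; auto; lia.
Qed.

Lemma phi_1A t A : I t -> (1 <= A <= n)%nat -> phi t 1%nat A = 0.
Proof. intros ht HA. rewrite phi_AB, phi_A1 by (auto; lia). ring. Qed.

Lemma phi_22 t : I t -> phi t 2%nat 2%nat = 0.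
Proof. intros ht. assert (H := phi_AB t 2 2 ht ltac:(lia) ltac:(lia)). lra. Qed.

Lemma phi_02 t : I t -> phi t 0%nat 2%nat = phi t 1%nat 0%nat.
Proof. intros ht. rewrite <- special_ds by auto. apply e_special; auto. Qed.

Lemma phi_0b t c : I t -> (3 <= c <= n)%nat -> phi t 0%nat c = 0.
Proof. intros ht Hc. apply e_special; auto. Qed.

Context (a b delta : R).
Hypothesis ab_I : forall t, a <= t <= b -> I t.

Local Notation dom x := (- delta < x < delta).
Local Notation Gen := (Gen I a b delta).
Local Notation Gvec := (Gvec n I a b delta).
Local Notation Dphi := (Dop n phi).

Lemma Gen_phi' i j : (i <= S n)%nat -> (j <= S n)%nat -> Gen (fun _ t => phi t i j).
Proof.
  intros. apply Gen_phi with n e; auto.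
  - apply special_smooth.
  - apply special_iso.
  - apply special_mc.
Qed.

Lemma Gvec_Dop' c : Gvec c -> Gvec (Dphi c).
Proof.
  intros. apply Gvec_Dop with e; auto.
  - apply special_smooth.
  - apply special_iso.
  - apply special_mc.
Qed.

Lemma Dop_mink_const' c d x t k : Gvec c -> Gvec d -> dom x -> I t ->
  (forall x t, dom x -> I t -> mink n (c x t) (d x t) = k) ->
  mink n (Dphi c x t) (d x t) = - mink n (c x t) (Dphi d x t).
Proof.
  intros. apply (Dop_mink_const n I e phi) with (a := a) (b := b) (delta := delta) (k := k);
    auto using special_smooth, special_iso, special_mc.
Qed.

Lemma Dop_mink' c d x t : Gvec c -> Gvec d -> dom x -> I t ->
  mink n (Dphi c x t) (d x t) + mink n (c x t) (Dphi d x t)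
  = Dt (fun x t => mink n (c x t) (d x t)) x t.
Proof.
  intros. apply (Dop_mink n I e phi) with (a := a) (b := b) (delta := delta);
    auto using special_smooth, special_iso, special_mc.
Qed.

Lemma Dop_0 c x t : I t ->
  Dphi c x t 0%nat = Dt (fun x t => c x t 0%nat) x t + ssum n (fun A => phi t 0%nat A * c x t A).
Proof.
  intros ht. unfold Dop. rewrite rsum_ends, phi_00, phi_0S by auto. ring.
Qed.

Lemma Dop_A c x t A : I t -> (1 <= A <= n)%nat ->
  Dphi c x t A = Dt (fun x t => c x t A) x t + phi t A 0%nat * c x t 0%nat
   + ssum n (fun B => phi t A B * c x t B) + phi t 0%nat A * c x t (S n).
Proof.
  intros ht HA. unfold Dop. rewrite rsum_ends, phi_AS by auto. ring.
Qed.

Lemma Dop_S c x t : I t ->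
  Dphi c x t (S n) = Dt (fun x t => c x t (S n)) x t + phi t 1%nat 0%nat * c x t 1%nat.
Proof.
  intros ht. unfold Dop. rewrite rsum_ends, phi_S0, phi_SS by auto.
  rewrite (ssum_single n 1).
  - rewrite phi_SA by (auto; lia). ring.
  - lia.
  - intros A HA h. rewrite phi_SA, phi_A0 by (auto; lia). ring.
Qed.

Lemma Dop_ext c d x t i : dom x -> I t -> (i <= S n)%nat ->
  (forall x t i, dom x -> I t -> (i <= S n)%nat -> c x t i = d x t i) -> Dphi c x t i = Dphi d x t i.
Proof.
  intros hx ht Hi H. unfold Dop. f_equal.
  - apply (Dt_ext I delta I_open); auto.
  - apply rsum_ext; intros. rewrite H by (auto; lia). reflexivity.
Qed.


Hypothesis v_pos : forall t, I t -> 0 < phi t 1%nat 0%nat.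
Hypothesis delta_pos : 0 < delta.
Hypothesis I_a : I a.
Hypothesis I_b : I b.
Hypothesis a_lt_b : a < b.

(** * The perturbed curve and its second order frame *)

Context (y : nat -> R -> R).
Hypothesis y_smooth : forall A, smooth_on I (y A).
Hypothesis y_theta : forall A t, ~ (3 <= A <= n)%nat -> y A t = 0.

Definition ynorm (t : R) : R := ssum n (fun A => y A t * y A t).

(** The right-hand side is the [e_1] component of the derivative of the perturbed vector, since
    [zeta 1] vanishes. Keeping it above [v / 2] makes the speed positive on [I] and bounded below on
    [[a, b]], and makes the first component of the unit tangent positive, so that the rotation
    formula has a denominator larger than 1. *)
Hypothesis y_small : forall x t, dom x -> I t ->
  phi t 1%nat 0%nat / 2 <= phi t 1%nat 0%nat + x * x * (phi t 0%nat 1%nat * (ynorm t / 2)).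

Lemma Gen_y A : Gen (fun _ t => y A t).
Proof. apply Gen_smooth. auto. Qed.

Lemma Gen_y' A : Gen (fun _ t => Derive (y A) t).
Proof. apply (Gen_Dt I a b delta I_open (fun _ t => y A t)). apply Gen_y. Qed.

Local Hint Resolve Gen_y Gen_y' : gen.
Local Hint Extern 2 (Gen (fun _ t => phi t _ _)) => (apply Gen_phi'; lia) : gen.

Lemma Gen_ynorm : Gen (fun _ t => ynorm t).
Proof. unfold ynorm. gen. Qed.
Local Hint Resolve Gen_ynorm : gen.

Lemma y_1 t : y 1%nat t = 0.
Proof. apply y_theta. lia. Qed.

Lemma Derive_y_theta A t : ~ (3 <= A <= n)%nat -> Derive (y A) t = 0.
Proof.
  intros h. rewrite (Derive_ext _ (fun _ => 0)); [apply Derive_const|].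
  intros; apply y_theta; auto.
Qed.

(** The covariant derivative of [Y = sum_A y_A e_A] in [span(e_1, ..., e_n)]. *)
Definition zeta (A : nat) (t : R) : R :=
  Derive (y A) t + ssum n (fun B => phi t A B * y B t).

Lemma Gen_zeta A : (1 <= A <= n)%nat -> Gen (fun _ t => zeta A t).
Proof. intros. unfold zeta. gen. Qed.
Local Hint Extern 2 (Gen (fun _ t => zeta _ t)) => (apply Gen_zeta; lia) : gen.

Lemma zeta_1 t : I t -> zeta 1 t = 0.
Proof.
  intros ht. unfold zeta. rewrite Derive_y_theta by lia.
  rewrite ssum_zero; [ring|]. intros. rewrite phi_1A by auto. ring.
Qed.

(** The connection form is skew, so its quadratic contribution equals its own opposite. *)
Lemma sum_zeta_y t : I t ->
  ssum n (fun A => zeta A t * y A t) = ssum n (fun A => y A t * Derive (y A) t).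
Proof.
  intros ht. unfold zeta.
  rewrite (ssum_ext n _ (fun A => y A t * Derive (y A) t
    + ssum n (fun B => phi t A B * y B t) * y A t)) by (intros; ring).
  rewrite ssum_plus. apply Rplus_eq_reg_l with (- ssum n (fun A => y A t * Derive (y A) t)).
  ring_simplify.
  set (Q := ssum n (fun A => ssum n (fun B => phi t A B * y B t) * y A t)).
  assert (E : Q = -1 * Q); [|lra].
  unfold Q at 1. rewrite (ssum_ext n _ (fun A => ssum n (fun B => phi t A B * y B t * y A t)))
    by (intros; rewrite ssum_scal_r; reflexivity).
  rewrite ssum_swap. unfold Q. rewrite <- ssum_scal.
  apply ssum_ext; intros A HA. rewrite <- !ssum_scal_r, <- ssum_scal. apply ssum_ext; intros B HB.
  rewrite (phi_AB t B A) by auto. ring.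
Qed.

(** Component along [e_A] of the derivative of the perturbed vector; the last term comes from
    differentiating [e_(n+1)], whose [e_A] coefficient is [phi^A_(n+1) = phi^0_A]. *)
Definition gcomp (A : nat) (x t : R) : R :=
  phi t A 0%nat + x * zeta A t + x * x * (phi t 0%nat A * (ynorm t / 2)).

(** In the components of [e]: the varied curve [Gvar]; the frame
    [Gvar, Evar, e_(n+1)] obtained from [e] by the null rotation taking [e_0] to
    [Gvar]; its rotation [Bvar] with [Bvar 1 = Wvar] the unit tangent; and the
    null rotation [Gvar, Cvar, Qvar] making the frame second order. *)
Definition Gvar (x t : R) : vec := fun i =>
  if Nat.eqb i 0 then 1 else if Nat.eqb i (S n) then x * x * (ynorm t / 2) else x * y i t.

Lemma Gvar_0 x t : Gvar x t 0%nat = 1.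
Proof. reflexivity. Qed.

Lemma Gvar_S x t : Gvar x t (S n) = x * x * (ynorm t / 2).
Proof. unfold Gvar. rewrite Nat.eqb_refl. reflexivity. Qed.

Lemma Gvar_A x t A : (1 <= A <= n)%nat -> Gvar x t A = x * y A t.
Proof. intros. unfold Gvar. rewrite !(proj2 (Nat.eqb_neq _ _)) by lia. reflexivity. Qed.

Lemma index_cases (P : nat -> Prop) :
  P 0%nat -> P (S n) -> (forall A, (1 <= A <= n)%nat -> P A) ->
  forall i, (i <= S n)%nat -> P i.
Proof.
  intros H0 HS HA i Hi. destruct (Nat.eq_dec i 0) as [->|]; auto.
  destruct (Nat.eq_dec i (S n)) as [->|]; auto. apply HA; lia.
Qed.

Lemma Gvec_Gvar : Gvec Gvar.
Proof.
  intros i Hi. unfold Gvar. destruct (Nat.eqb i 0); [gen|]. destruct (Nat.eqb i (S n)); gen.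
Qed.

Definition Evar (A : nat) (x t : R) : vec := fun i => unitv A i + x * y A t * unitv (S n) i.

Lemma Gvec_Evar A : Gvec (Evar A).
Proof. intros i Hi. unfold Evar. gen. Qed.

Lemma nullframe_Evar x t : nullframe n (Gvar x t) (unitv (S n)) (fun A => Evar A x t).
Proof.
  apply nullframe_sym.
  refine (nullframe_ext _ _ _ _ _ _ _
    (nullframe_nullrot n (unitv (S n)) (unitv 0) unitv (fun A => x * y A t)
       (nullframe_sym _ _ _ _ (nullframe_unit n))) _ _ _); auto.
  assert (E : ssum n (fun A => x * y A t * (x * y A t)) = x * x * ynorm t).
  { unfold ynorm. rewrite <- ssum_scal. apply ssum_ext; intros; ring. }
  rewrite E. apply index_cases.
  - rewrite Gvar_0, unitv_same, unitv_diff by lia.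
    rewrite ssum_zero; [field|]. intros A HA. rewrite unitv_diff by lia. ring.
  - rewrite Gvar_S, unitv_same, unitv_diff by lia.
    rewrite ssum_zero; [field|]. intros A HA. rewrite unitv_diff by lia. ring.
  - intros A HA. rewrite Gvar_A, !unitv_diff by lia.
    rewrite (ssum_single n A); auto.
    + rewrite unitv_same. ring.
    + intros B HB h. rewrite unitv_diff by auto. ring.
Qed.

Definition speed2 (x t : R) : R := ssum n (fun A => gcomp A x t * gcomp A x t).
Definition speed (x t : R) : R := sqrt (speed2 x t).
Definition wcomp (A : nat) (x t : R) : R := gcomp A x t * / speed x t.

Lemma Gen_gcomp A : (1 <= A <= n)%nat -> Gen (gcomp A).
Proof. intros. unfold gcomp. gen. Qed.
Local Hint Extern 2 (Gen (gcomp _)) => (apply Gen_gcomp; lia) : gen.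
Local Hint Extern 2 (Gen (fun x t => gcomp _ x t)) => (apply Gen_gcomp; lia) : gen.

Lemma gcomp_1 x t : dom x -> I t -> phi t 1%nat 0%nat / 2 <= gcomp 1 x t.
Proof. intros hx ht. unfold gcomp. rewrite zeta_1 by auto. assert (H := y_small x t hx ht). lra. Qed.

Lemma speed2_ge x t : dom x -> I t ->
  gcomp 1 x t * gcomp 1 x t <= speed2 x t.
Proof.
  intros hx ht. unfold speed2. rewrite ssum_first by lia.
  assert (0 <= rsum (n - 1) (fun k => gcomp (k + 2) x t * gcomp (k + 2) x t)).
  { apply rsum_nonneg. intros. apply Rle_0_sqr. }
  lra.
Qed.

Lemma gcomp_1_pos x t : dom x -> I t -> 0 < gcomp 1 x t.
Proof. intros hx ht. assert (h := v_pos t ht). assert (h' := gcomp_1 x t hx ht). lra. Qed.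

Lemma speed2_pos x t : dom x -> I t -> 0 < speed2 x t.
Proof.
  intros hx ht. assert (h := gcomp_1_pos x t hx ht). assert (h' := speed2_ge x t hx ht). nra.
Qed.

Lemma v_lower : exists m, 0 < m /\ forall t, a <= t <= b -> m <= phi t 1%nat 0%nat.
Proof.
  assert (G : Gen (fun _ t => phi t 1%nat 0%nat)) by (apply Gen_phi'; lia).
  destruct (continuity_ab_min (fun t => phi t 1%nat 0%nat) a b) as [m [Hm Hm']]; [lra| |].
  - intros c hc. apply derivable_continuous_pt. eexists. apply is_derive_Reals.
    apply (Gen_is_derive I a b delta I_open (fun _ t => phi t 1%nat 0%nat) 0); auto. lra.
  - exists (phi m 1%nat 0%nat). split; auto.
Qed.

Lemma Gen_vinv : Gen (fun _ t => / phi t 1%nat 0%nat).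
Proof.
  destruct v_lower as (m & Hm & Hv).
  apply (Gen_inv I a b delta (fun _ t => phi t 1%nat 0%nat) m); auto.
  - apply Gen_phi'; lia.
  - intros x t _ ht. apply Rgt_not_eq. apply v_pos; auto.
  - intros x t _ ht. eapply Rle_trans; [|apply Rle_abs]. auto.
Qed.
Local Hint Resolve Gen_vinv : gen.

Lemma Gen_speed2 : Gen speed2.
Proof. unfold speed2. gen. Qed.
Local Hint Resolve Gen_speed2 : gen.

Lemma speed2_lower : exists m, 0 < m /\ forall x t, dom x -> a <= t <= b -> m <= speed2 x t.
Proof.
  destruct v_lower as (m & Hm & Hv).
  exists (m / 2 * (m / 2)). split; [nra|]. intros x t hx ht.
  assert (h := gcomp_1 x t hx (ab_I t ht)). assert (h' := speed2_ge x t hx (ab_I t ht)).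
  assert (h'' := Hv t ht). nra.
Qed.

Lemma Gen_speed : Gen speed.
Proof.
  destruct speed2_lower as (m & Hm & H).
  apply (Gen_sqrt I a b delta speed2 m); auto using Gen_speed2, speed2_pos.
Qed.
Local Hint Resolve Gen_speed : gen.

Lemma speed_pos x t : dom x -> I t -> 0 < speed x t.
Proof. intros. apply sqrt_lt_R0. apply speed2_pos; auto. Qed.

Lemma speed_sqr x t : dom x -> I t -> speed x t * speed x t = speed2 x t.
Proof. intros. apply sqrt_sqrt. left. apply speed2_pos; auto. Qed.

Lemma Gen_speedinv : Gen (fun x t => / speed x t).
Proof.
  destruct speed2_lower as (m & Hm & H).
  apply (Gen_inv I a b delta speed (sqrt m)); auto using Gen_speed.
  - apply sqrt_lt_R0; auto.
  - intros. apply Rgt_not_eq. apply speed_pos; auto.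
  - intros x t hx ht. eapply Rle_trans; [|apply Rle_abs]. apply sqrt_le_1_alt; auto.
Qed.
Local Hint Resolve Gen_speedinv : gen.

Lemma Gen_wcomp A : (1 <= A <= n)%nat -> Gen (wcomp A).
Proof. intros. unfold wcomp. gen. Qed.
Local Hint Extern 2 (Gen (wcomp _)) => (apply Gen_wcomp; lia) : gen.
Local Hint Extern 2 (Gen (fun x t => wcomp _ x t)) => (apply Gen_wcomp; lia) : gen.

Lemma wcomp_speed A x t : dom x -> I t -> speed x t * wcomp A x t = gcomp A x t.
Proof. intros. unfold wcomp. field. apply Rgt_not_eq, speed_pos; auto. Qed.

Lemma wcomp_1_pos x t : dom x -> I t -> 0 < wcomp 1 x t.
Proof.
  intros. apply Rmult_lt_0_compat; [apply gcomp_1_pos; auto|].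
  apply Rinv_0_lt_compat. apply speed_pos; auto.
Qed.

Lemma wcomp_unit x t : dom x -> I t -> ssum n (fun A => wcomp A x t * wcomp A x t) = 1.
Proof.
  intros hx ht. apply Rmult_eq_reg_l with (speed2 x t); [|apply Rgt_not_eq, speed2_pos; auto].
  rewrite Rmult_1_r, <- ssum_scal. unfold speed2 at 2. apply ssum_ext; intros.
  rewrite <- !wcomp_speed, <- speed_sqr by auto. ring.
Qed.

Definition Wvar (x t : R) : vec := fun i => ssum n (fun A => wcomp A x t * Evar A x t i).
Definition kappa (A : nat) (x t : R) : R := wcomp A x t * / (1 + wcomp 1 x t).
Definition Bvar (A : nat) (x t : R) : vec := fun i =>
  if Nat.eqb A 1 then Wvar x t i
  else Evar A x t i - kappa A x t * (Evar 1 x t i + Wvar x t i).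

Lemma Gen_kappa A : (1 <= A <= n)%nat -> Gen (kappa A).
Proof.
  intros. unfold kappa. apply Gen_mult; [gen|].
  apply (Gen_inv I a b delta (fun x t => 1 + wcomp 1 x t) 1).
  - gen.
  - lra.
  - intros x t hx ht. assert (h := wcomp_1_pos x t hx ht). lra.
  - intros x t hx ht. eapply Rle_trans; [|apply Rle_abs].
    assert (h := wcomp_1_pos x t hx (ab_I t ht)). lra.
Qed.
Local Hint Extern 2 (Gen (kappa _)) => (apply Gen_kappa; lia) : gen.
Local Hint Extern 2 (Gen (fun x t => kappa _ x t)) => (apply Gen_kappa; lia) : gen.

Lemma Gvec_Wvar : Gvec Wvar.
Proof. intros i Hi. unfold Wvar. gen. apply Gvec_Evar; auto. Qed.

Lemma Gvec_Bvar A : (1 <= A <= n)%nat -> Gvec (Bvar A).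
Proof.
  intros HA i Hi. unfold Bvar. destruct (Nat.eqb A 1); [apply Gvec_Wvar; auto|].
  gen; first [apply Gvec_Evar; auto|apply Gvec_Wvar; auto].
Qed.

Lemma nullframe_Bvar x t : dom x -> I t ->
  nullframe n (Gvar x t) (unitv (S n)) (fun A => Bvar A x t).
Proof.
  intros hx ht.
  refine (nullframe_ext _ _ _ _ _ _ _
    (nullframe_rot n _ _ _ (fun A => wcomp A x t) _ (nullframe_Evar x t) (wcomp_unit x t hx ht) _) _ _ _); auto.
  - lia.
  - assert (h := wcomp_1_pos x t hx ht). lra.
Qed.

Lemma Wvar_0 x t : Wvar x t 0%nat = 0.
Proof.
  apply ssum_zero. intros A HA. unfold Evar. rewrite !unitv_diff by lia. ring.
Qed.

Lemma Wvar_A x t A : (1 <= A <= n)%nat -> Wvar x t A = wcomp A x t.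
Proof.
  intros HA. unfold Wvar. rewrite (ssum_single n A); auto.
  - unfold Evar. rewrite unitv_same, unitv_diff by lia. ring.
  - intros B HB h. unfold Evar. rewrite !unitv_diff by lia. ring.
Qed.

Lemma Wvar_S x t : Wvar x t (S n) = x * ssum n (fun A => wcomp A x t * y A t).
Proof.
  unfold Wvar. rewrite <- ssum_scal. apply ssum_ext; intros A HA.
  unfold Evar. rewrite unitv_same, unitv_diff by lia. ring.
Qed.

(** The derivative has no [e_0] component, because [phi^0_A] vanishes for [A >= 3] and [Y] has no
    component of index below 3; this is the reason for varying inside [Theta]. The [e_(n+1)]
    components agree since [<zeta, y>] is half the derivative of [|Y|^2]. *)
Lemma Dop_Gvar x t i : dom x -> I t -> (i <= S n)%nat ->
  Dphi Gvar x t i = speed x t * Wvar x t i.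
Proof.
  intros hx ht. revert i. apply index_cases.
  - rewrite Dop_0, Wvar_0 by auto.
    rewrite (Dt_const I delta I_open _ x t 1) by auto.
    rewrite ssum_zero; [ring|]. intros A HA. rewrite Gvar_A by auto.
    destruct (Nat.le_gt_cases 3 A); [rewrite phi_0b|rewrite y_theta]; auto; try lia; ring.
  - rewrite Dop_S, Wvar_S, (Gvar_A _ _ 1), y_1 by (auto; lia).
    replace (speed x t * (x * ssum n (fun A => wcomp A x t * y A t))) with
      (x * ssum n (fun A => gcomp A x t * y A t)).
    2:{ rewrite (ssum_ext n (fun A => gcomp A x t * y A t) (fun A => speed x t * (wcomp A x t * y A t))).
        - rewrite ssum_scal. ring.
        - intros. rewrite <- wcomp_speed by auto. ring. }
    rewrite (ssum_ext n (fun A => gcomp A x t * y A t) (fun A => x * (zeta A t * y A t))).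
    2:{ intros A HA. unfold gcomp. destruct (Nat.le_gt_cases 3 A).
        - rewrite phi_0b, phi_A0 by (auto; lia). ring.
        - rewrite y_theta by lia. ring. }
    rewrite ssum_scal, sum_zeta_y by auto.
    rewrite (Dt_ext I delta I_open _ (fun x t => (x * x) * (ynorm t * / 2))) by
      (auto; intros; rewrite Gvar_S; reflexivity).
    unfold Dt. rewrite Derive_scal, Derive_scal_l.
    assert (E : Derive ynorm t = 2 * ssum n (fun A => y A t * Derive (y A) t)).
    { change (Derive ynorm t) with (Dt (fun _ t => ssum n (fun A => y A t * y A t)) x t).
      rewrite (Dt_ssum I a b delta I_open n (fun A _ t => y A t * y A t)) by (auto; intros; gen).
      rewrite <- ssum_scal. apply ssum_ext; intros A HA.
      rewrite (Dt_mult I a b delta I_open (fun _ => y A) (fun _ => y A)) by (auto; gen).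
      change (Dt (fun _ => y A) x t) with (Derive (y A) t). ring. }
    rewrite E. field.
  - intros A HA. rewrite Dop_A, Wvar_A, wcomp_speed, Gvar_0, Gvar_S by auto.
    rewrite (Dt_ext I delta I_open _ (fun x t => x * y A t)) by (auto; intros; apply Gvar_A; auto).
    unfold Dt. rewrite Derive_scal. unfold gcomp, zeta.
    rewrite (ssum_ext n (fun B => phi t A B * Gvar x t B) (fun B => x * (phi t A B * y B t)))
      by (intros; rewrite Gvar_A by auto; ring).
    rewrite ssum_scal. ring.
Qed.

(** Solution of the second order condition: adding [x_A Gvar] to [Bvar A] changes its product with
    the derivative of [Wvar] by [x_A <D Wvar, Gvar> = - x_A speed], which has to cancel
    [<D Wvar, Bvar A>]. The value 0 at index 1 leaves the unit tangent unchanged. *)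
Definition xcomp (A : nat) (x t : R) : R :=
  if Nat.eqb A 1 then 0 else mink n (Bvar A x t) (Dphi Wvar x t) * / speed x t.
Definition Qvar (x t : R) : vec := fun i =>
  unitv (S n) i + ssum n (fun A => xcomp A x t * Bvar A x t i)
  + ssum n (fun A => xcomp A x t * xcomp A x t) / 2 * Gvar x t i.
Definition Cvar (A : nat) (x t : R) : vec := fun i =>
  Bvar A x t i + xcomp A x t * Gvar x t i.

Lemma Gen_xcomp A : (1 <= A <= n)%nat -> Gen (xcomp A).
Proof.
  intros. unfold xcomp. destruct (Nat.eqb A 1); [gen|]. apply Gen_mult; [|gen].
  apply Gen_mink.
  - apply Gvec_Bvar; auto.
  - apply Gvec_Dop'. apply Gvec_Wvar.
Qed.
Local Hint Extern 2 (Gen (xcomp _)) => (apply Gen_xcomp; lia) : gen.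
Local Hint Extern 2 (Gen (fun x t => xcomp _ x t)) => (apply Gen_xcomp; lia) : gen.

Lemma Gvec_Qvar : Gvec Qvar.
Proof.
  intros i Hi. unfold Qvar. gen; [apply Gvec_Bvar|apply Gvec_Gvar]; auto.
Qed.

Lemma Gvec_Cvar A : (1 <= A <= n)%nat -> Gvec (Cvar A).
Proof.
  intros HA i Hi. unfold Cvar. gen; [apply Gvec_Bvar|apply Gvec_Gvar]; auto.
Qed.

Lemma nullframe_Cvar x t : dom x -> I t ->
  nullframe n (Gvar x t) (Qvar x t) (fun A => Cvar A x t).
Proof.
  intros hx ht. exact (nullframe_nullrot n _ _ _ (fun A => xcomp A x t) (nullframe_Bvar x t hx ht)).
Qed.

Lemma Cvar_1 x t i : Cvar 1 x t i = Wvar x t i.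
Proof. unfold Cvar, xcomp, Bvar. simpl. ring. Qed.

Lemma mink_W_C x t al : dom x -> I t -> (2 <= al <= n)%nat -> mink n (Wvar x t) (Cvar al x t) = 0.
Proof.
  intros hx ht Hal. rewrite <- (mink_ext n (Cvar 1 x t) _ (Cvar al x t) _) by (auto using Cvar_1).
  rewrite (nf_BB _ _ _ _ (nullframe_Cvar x t hx ht)) by lia.
  rewrite (proj2 (Nat.eqb_neq _ _)) by lia. reflexivity.
Qed.

Lemma mink_W_B x t al : dom x -> I t -> (2 <= al <= n)%nat -> mink n (Wvar x t) (Bvar al x t) = 0.
Proof.
  intros hx ht Hal. change (Wvar x t) with (Bvar 1 x t).
  rewrite (nf_BB _ _ _ _ (nullframe_Bvar x t hx ht)) by lia.
  rewrite (proj2 (Nat.eqb_neq _ _)) by lia. reflexivity.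
Qed.

Lemma mink_W_W x t : dom x -> I t -> mink n (Wvar x t) (Wvar x t) = 1.
Proof.
  intros hx ht. change (Wvar x t) with (Bvar 1 x t).
  rewrite (nf_BB _ _ _ _ (nullframe_Bvar x t hx ht)) by lia. reflexivity.
Qed.

Lemma mink_DG x t c : dom x -> I t -> mink n (Dphi Gvar x t) c = speed x t * mink n (Wvar x t) c.
Proof.
  intros hx ht. rewrite <- mink_scal. apply mink_ext; auto. intros; apply Dop_Gvar; auto.
Qed.

Lemma second_order_0 x t al : dom x -> I t -> (2 <= al <= n)%nat ->
  mink n (Dphi Gvar x t) (Cvar al x t) = 0.
Proof. intros. rewrite mink_DG, mink_W_C by auto. ring. Qed.

Lemma second_order_1 x t al : dom x -> I t -> (2 <= al <= n)%nat ->
  mink n (Dphi (Cvar 1) x t) (Cvar al x t) = 0.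
Proof.
  intros hx ht Hal.
  rewrite (mink_ext n _ (Dphi Wvar x t) _ (Cvar al x t)).
  2:{ intros. apply Dop_ext; auto using Cvar_1. }
  2:{ auto. }
  unfold Cvar at 1. rewrite mink_plus_r, mink_scal_r.
  rewrite (Dop_mink_const' Wvar Gvar x t 0); auto using Gvec_Wvar, Gvec_Gvar.
  - rewrite mink_sym, (mink_sym n (Wvar x t)), mink_DG, mink_W_W by auto.
    unfold xcomp. rewrite (proj2 (Nat.eqb_neq al 1)) by lia. field.
    apply Rgt_not_eq, speed_pos; auto.
  - intros x' t' hx' ht'. rewrite mink_sym. change (Wvar x' t') with (Bvar 1 x' t').
    apply (nf_pB _ _ _ _ (nullframe_Bvar x' t' hx' ht')). lia.
Qed.

(** * Expansion of the perturbed frame in [eps] *)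

Local Notation O1 := (O1 I a b delta).
Local Notation O2 := (O2 I a b delta).

Lemma gcomp_1_O2 : O2 (fun x t => gcomp 1 x t - phi t 1%nat 0%nat).
Proof.
  apply O2_ext with (fun x t => x * x * (phi t 0%nat 1%nat * (ynorm t / 2))).
  - apply O2_eps. gen.
  - intros x t hx ht. unfold gcomp. rewrite zeta_1 by auto. ring.
Qed.

Lemma gcomp_O2 A : (2 <= A <= n)%nat -> O2 (fun x t => gcomp A x t - x * zeta A t).
Proof.
  intros HA. apply O2_ext with (fun x t => x * x * (phi t 0%nat A * (ynorm t / 2))).
  - apply O2_eps. gen.
  - intros x t hx ht. unfold gcomp. rewrite phi_A0 by auto. ring.
Qed.

Lemma gcomp_O1 A : (2 <= A <= n)%nat -> O1 (gcomp A).
Proof.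
  intros HA. apply O1_ext with (fun x t => (gcomp A x t - x * zeta A t) + x * zeta A t).
  - apply O1_plus; [apply O2_O1; apply gcomp_O2; auto|]. apply O1_eps. gen.
  - intros; ring.
Qed.

(** No linear term appears: the [e_1] component changes only at second order because [zeta 1 = 0],
    and the other components are of first order and enter squared. *)
Lemma speed2_O2 : O2 (fun x t => speed2 x t - phi t 1%nat 0%nat * phi t 1%nat 0%nat).
Proof.
  apply O2_ext with (fun x t => (gcomp 1 x t + phi t 1%nat 0%nat) * (gcomp 1 x t - phi t 1%nat 0%nat)
    + rsum (n - 1) (fun k => gcomp (k + 2) x t * gcomp (k + 2) x t)).
  - apply O2_plus.
    + apply O2_mult; [gen|apply gcomp_1_O2].
    + apply (O2_rsum I a b delta (n - 1) (fun k x t => gcomp (k + 2) x t * gcomp (k + 2) x t)).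
      intros k Hk. apply O1_mult_O1; apply gcomp_O1; lia.
  - intros x t hx ht. unfold speed2. rewrite ssum_first by lia. ring.
Qed.

Lemma speed_O2 : O2 (fun x t => speed x t - phi t 1%nat 0%nat).
Proof.
  apply O2_ext with (fun x t => / (speed x t + phi t 1%nat 0%nat)
     * (speed2 x t - phi t 1%nat 0%nat * phi t 1%nat 0%nat)).
  - apply O2_mult; [|apply speed2_O2].
    destruct v_lower as (m & Hm & Hv).
    apply (Gen_inv I a b delta (fun x t => speed x t + phi t 1%nat 0%nat) m); auto.
    + gen.
    + intros x t hx ht. assert (h := speed_pos x t hx ht). assert (h' := v_pos t ht). lra.
    + intros x t hx ht. eapply Rle_trans; [|apply Rle_abs].
      assert (h := speed_pos x t hx (ab_I t ht)). assert (h' := Hv t ht). lra.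
  - intros x t hx ht. rewrite <- speed_sqr by auto. field.
    assert (h := speed_pos x t hx ht). assert (h' := v_pos t ht). lra.
Qed.

Lemma speedinv_O2 : O2 (fun x t => / speed x t - / phi t 1%nat 0%nat).
Proof.
  apply O2_ext with (fun x t => - (/ speed x t * / phi t 1%nat 0%nat)
     * (speed x t - phi t 1%nat 0%nat)).
  - apply O2_mult; [gen|apply speed_O2].
  - intros x t hx ht. field.
    assert (h := speed_pos x t hx ht). assert (h' := v_pos t ht). lra.
Qed.

Lemma wcomp_1_O2 : O2 (fun x t => wcomp 1 x t - 1).
Proof.
  apply O2_ext with (fun x t => / speed x t *
     ((gcomp 1 x t - phi t 1%nat 0%nat) - (speed x t - phi t 1%nat 0%nat))).
  - apply O2_mult; [gen|]. apply O2_minus; [apply gcomp_1_O2|apply speed_O2].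
  - intros x t hx ht. unfold wcomp. field. assert (h := speed_pos x t hx ht). lra.
Qed.

(** The coefficient of [eps] in [wcomp A]. *)
Definition zv (A : nat) (t : R) : R := zeta A t * / phi t 1%nat 0%nat.

Lemma Gen_zv A : (1 <= A <= n)%nat -> Gen (fun _ t => zv A t).
Proof. intros. unfold zv. gen. Qed.
Local Hint Extern 2 (Gen (fun _ t => zv _ t)) => (apply Gen_zv; lia) : gen.

Lemma Gen_zv' A : (1 <= A <= n)%nat -> Gen (fun _ t => Derive (zv A) t).
Proof. intros. apply (Gen_Dt I a b delta I_open (fun _ t => zv A t)). gen. Qed.
Local Hint Extern 2 (Gen (fun _ t => Derive (zv _) t)) => (apply Gen_zv'; lia) : gen.

Lemma wcomp_O2 A : (2 <= A <= n)%nat -> O2 (fun x t => wcomp A x t - x * zv A t).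
Proof.
  intros HA.
  apply O2_ext with (fun x t => gcomp A x t * (/ speed x t - / phi t 1%nat 0%nat)
    + / phi t 1%nat 0%nat * (gcomp A x t - x * zeta A t)).
  - apply O2_plus; apply O2_mult; [gen|apply speedinv_O2|gen|apply gcomp_O2; auto].
  - intros. unfold wcomp, zv. ring.
Qed.

Lemma wcomp_O1 A : (2 <= A <= n)%nat -> O1 (wcomp A).
Proof.
  intros HA. apply O1_ext with (fun x t => / speed x t * gcomp A x t).
  - apply O1_mult; [gen|apply gcomp_O1; auto].
  - intros; unfold wcomp; ring.
Qed.

Lemma kappa_O1 A : (2 <= A <= n)%nat -> O1 (kappa A).
Proof.
  intros HA. apply O1_ext with (fun x t => / (1 + wcomp 1 x t) * wcomp A x t).
  - apply O1_mult; [|apply wcomp_O1; auto].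
    apply (Gen_inv I a b delta (fun x t => 1 + wcomp 1 x t) 1).
    + gen.
    + lra.
    + intros x t hx ht. assert (h := wcomp_1_pos x t hx ht). lra.
    + intros x t hx ht. eapply Rle_trans; [|apply Rle_abs].
      assert (h := wcomp_1_pos x t hx (ab_I t ht)). lra.
  - intros; unfold kappa; ring.
Qed.

Lemma Wvar_S_O2 : O2 (fun x t => Wvar x t (S n)).
Proof.
  apply O2_ext with (fun x t => ssum n (fun A => x * y A t * wcomp A x t)).
  - apply (O2_ssum I a b delta n (fun A x t => x * y A t * wcomp A x t)). intros A HA.
    destruct (Nat.eq_dec A 1) as [->|h].
    + apply O2_ext with (fun _ _ => 0); [apply O2_zero|]. intros; rewrite y_1; ring.
    + apply O1_mult_O1; [apply O1_eps; gen|apply wcomp_O1; lia].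
  - intros x t hx ht. rewrite Wvar_S, <- ssum_scal. apply ssum_ext; intros; ring.
Qed.

Lemma mink_Evar A x t c : (1 <= A <= n)%nat ->
  mink n (Evar A x t) c = c A - x * y A t * c 0%nat.
Proof.
  intros HA. unfold Evar. rewrite mink_plus, mink_scal, !(mink_sym n (unitv _)).
  rewrite mink_unitv, mink_unitvS by auto. ring.
Qed.

Lemma mink_W_DW x t : dom x -> I t -> mink n (Wvar x t) (Dphi Wvar x t) = 0.
Proof.
  intros hx ht. assert (G := Gvec_Wvar).
  assert (H := Dop_mink_const' Wvar Wvar x t 1 G G hx ht mink_W_W).
  rewrite (mink_sym n (Dphi Wvar x t)) in H. lra.
Qed.

Lemma Bvar_ge2 A x t i : (2 <= A)%nat ->
  Bvar A x t i = Evar A x t i - kappa A x t * (Evar 1 x t i + Wvar x t i).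
Proof. intros. unfold Bvar. rewrite (proj2 (Nat.eqb_neq A 1)) by lia. reflexivity. Qed.

(** [Bvar A] differs from [Evar A] by a multiple of [Evar 1 + Wvar], and [Wvar], being a unit
    vector, is orthogonal to its derivative. *)
Lemma xcomp_eq A x t : dom x -> I t -> (2 <= A <= n)%nat ->
  xcomp A x t = / speed x t * (Dphi Wvar x t A - x * y A t * Dphi Wvar x t 0%nat
                               - kappa A x t * Dphi Wvar x t 1%nat).
Proof.
  intros hx ht HA. unfold xcomp. rewrite (proj2 (Nat.eqb_neq A 1)) by lia.
  rewrite (mink_ext n (Bvar A x t) (fun i => Evar A x t i - kappa A x t * (Evar 1 x t i + Wvar x t i))
     (Dphi Wvar x t) (Dphi Wvar x t)); auto.
  2:{ intros; apply Bvar_ge2; lia. }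
  rewrite mink_minus, mink_scal, mink_plus, mink_W_DW, !mink_Evar, y_1 by (auto; lia). ring.
Qed.

Lemma Dop_Wvar_0 x t : dom x -> I t ->
  Dphi Wvar x t 0%nat = ssum n (fun A => phi t 0%nat A * wcomp A x t).
Proof.
  intros hx ht. rewrite Dop_0 by auto.
  rewrite (Dt_const I delta I_open _ x t 0) by (auto; intros; apply Wvar_0).
  rewrite (ssum_ext n _ (fun A => phi t 0%nat A * wcomp A x t))
    by (intros; rewrite Wvar_A by auto; reflexivity). ring.
Qed.

Lemma Dop_Wvar_A x t A : dom x -> I t -> (1 <= A <= n)%nat ->
  Dphi Wvar x t A = Dt (wcomp A) x t + ssum n (fun B => phi t A B * wcomp B x t)
                    + phi t 0%nat A * Wvar x t (S n).
Proof.
  intros hx ht HA. rewrite Dop_A, Wvar_0 by auto.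
  rewrite (Dt_ext I delta I_open _ (wcomp A)) by (auto; intros; apply Wvar_A; auto).
  rewrite (ssum_ext n _ (fun B => phi t A B * wcomp B x t))
    by (intros; rewrite Wvar_A by auto; reflexivity). ring.
Qed.

Lemma Dop_Wvar_0_O1 : O1 (fun x t => Dphi Wvar x t 0%nat - phi t 0%nat 1%nat).
Proof.
  apply O1_ext with (fun x t => phi t 0%nat 1%nat * (wcomp 1 x t - 1)
    + rsum (n - 1) (fun k => phi t 0%nat (k + 2)%nat * wcomp (k + 2) x t)).
  - apply O1_plus.
    + apply O1_mult; [gen|apply O2_O1, wcomp_1_O2].
    + apply (O1_rsum I a b delta (n - 1) (fun k x t => phi t 0%nat (k + 2)%nat * wcomp (k + 2) x t)).
      intros. apply O1_mult; [gen|apply wcomp_O1; lia].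
  - intros x t hx ht. rewrite Dop_Wvar_0, ssum_first by (auto; lia). ring.
Qed.

Lemma Dop_Wvar_1_O1 : O1 (fun x t => Dphi Wvar x t 1%nat).
Proof.
  apply O1_ext with (fun x t => Dt (fun x t => wcomp 1 x t - 1) x t
    + phi t 0%nat 1%nat * Wvar x t (S n)).
  - apply O1_plus.
    + apply (O1_Dt I a b delta I_open). apply O2_O1, wcomp_1_O2.
    + apply O1_mult; [gen|apply O2_O1, Wvar_S_O2].
  - intros x t hx ht. rewrite Dop_Wvar_A by (auto; lia).
    rewrite ssum_zero by (intros; rewrite phi_1A by auto; ring).
    rewrite (Dt_minus I a b delta I_open (wcomp 1) (fun _ _ => 1)) by (auto; gen).
    unfold Dt at 2. rewrite Derive_const. ring.
Qed.

(** The coefficient of [eps] in [xcomp A]. *)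
Definition xfirst (A : nat) (t : R) : R :=
  / phi t 1%nat 0%nat * (Derive (zv A) t + ssum n (fun B => phi t A B * zv B t)
                         - y A t * phi t 0%nat 1%nat).

Lemma Gen_xfirst A : (1 <= A <= n)%nat -> Gen (fun _ t => xfirst A t).
Proof. intros. unfold xfirst. gen. Qed.
Local Hint Extern 2 (Gen (fun _ t => xfirst _ t)) => (apply Gen_xfirst; lia) : gen.

(** The summand [y_A phi^0_1] of [xfirst] arises from the [e_(n+1)] part of [Evar A] paired with the
    [e_0] component of the derivative of [Wvar], which tends to [phi^0_1]. The [kappa] term is a
    product of two first order quantities. *)
Lemma xcomp_O2 A : (2 <= A <= n)%nat -> O2 (fun x t => xcomp A x t - x * xfirst A t).
Proof.
  intros HA.
  apply O2_ext with (fun x t =>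
    / speed x t * (Dt (fun x t => wcomp A x t - x * zv A t) x t
       + ssum n (fun B => phi t A B * (wcomp B x t - x * zv B t))
       + phi t 0%nat A * Wvar x t (S n)
       - (x * y A t) * (Dphi Wvar x t 0%nat - phi t 0%nat 1%nat)
       - kappa A x t * Dphi Wvar x t 1%nat)
    + (x * (Derive (zv A) t + ssum n (fun B => phi t A B * zv B t) - y A t * phi t 0%nat 1%nat))
      * (/ speed x t - / phi t 1%nat 0%nat)).
  - apply O2_plus.
    + apply O2_mult; [gen|]. repeat apply O2_minus; [repeat apply O2_plus| |].
      * apply (O2_Dt I a b delta I_open). apply wcomp_O2; auto.
      * apply (O2_ssum I a b delta n (fun B x t => phi t A B * (wcomp B x t - x * zv B t))).
        intros B HB. destruct (Nat.eq_dec B 1) as [->|h].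
        { apply O2_ext with (fun _ _ => 0); [apply O2_zero|].
          intros x t hx ht. rewrite phi_A1 by (auto; lia). ring. }
        apply O2_mult; [gen|apply wcomp_O2; lia].
      * apply O2_mult; [gen|apply Wvar_S_O2].
      * apply O1_mult_O1; [apply O1_eps; gen|apply Dop_Wvar_0_O1].
      * apply O1_mult_O1; [apply kappa_O1; auto|apply Dop_Wvar_1_O1].
    + apply O2_mult; [gen|apply speedinv_O2].
  - intros x t hx ht. rewrite xcomp_eq, (Dop_Wvar_A x t A) by (auto; lia).
    rewrite (Dt_minus I a b delta I_open (wcomp A) (fun x t => x * zv A t)) by (auto; gen; lia).
    assert (E : Dt (fun x t => x * zv A t) x t = x * Derive (zv A) t) by apply Derive_scal.
    rewrite E. unfold xfirst.
    rewrite (ssum_ext n (fun B => phi t A B * (wcomp B x t - x * zv B t))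
      (fun B => phi t A B * wcomp B x t - x * (phi t A B * zv B t))) by (intros; ring).
    rewrite ssum_minus, ssum_scal. ring.
Qed.

Lemma xcomp_O1 A : (1 <= A <= n)%nat -> O1 (xcomp A).
Proof.
  intros HA. destruct (Nat.eq_dec A 1) as [->|h].
  - apply O1_zero.
  - apply O1_ext with (fun x t => (xcomp A x t - x * xfirst A t) + x * xfirst A t).
    + apply O1_plus; [apply O2_O1; apply xcomp_O2; lia|]. apply O1_eps. gen.
    + intros; ring.
Qed.

(** [phi^0_A] for the frame [Gvar, Cvar, Qvar]. *)
Definition ucomp (A : nat) (x t : R) : R := - mink n (Dphi (Cvar A) x t) (Qvar x t).

Lemma Gen_ucomp A : (1 <= A <= n)%nat -> Gen (ucomp A).
Proof.
  intros. unfold ucomp. gen. apply Gen_mink; [apply Gvec_Dop'; apply Gvec_Cvar; auto|apply Gvec_Qvar].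
Qed.
Local Hint Extern 2 (Gen (ucomp _)) => (apply Gen_ucomp; lia) : gen.
Local Hint Extern 2 (Gen (fun x t => ucomp _ x t)) => (apply Gen_ucomp; lia) : gen.

Lemma mink_Qvar x t c : mink n c (Qvar x t) =
  - c 0%nat + ssum n (fun A => xcomp A x t * mink n c (Bvar A x t))
  + ssum n (fun A => xcomp A x t * xcomp A x t) / 2 * mink n c (Gvar x t).
Proof.
  unfold Qvar.
  rewrite (mink_plus_r n (fun i => unitv (S n) i + ssum n (fun A => xcomp A x t * Bvar A x t i))),
    mink_plus_r, mink_scomb_r, mink_scal_r, mink_unitvS. reflexivity.
Qed.

Lemma mink_G_B x t A : dom x -> I t -> (1 <= A <= n)%nat -> mink n (Bvar A x t) (Gvar x t) = 0.
Proof.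
  intros hx ht HA. rewrite mink_sym. apply (nf_pB _ _ _ _ (nullframe_Bvar x t hx ht)); auto.
Qed.

Lemma Bvar_0 x t A : (1 <= A <= n)%nat -> Bvar A x t 0%nat = 0.
Proof.
  intros HA. unfold Bvar. rewrite Wvar_0. unfold Evar. rewrite !unitv_diff by lia.
  destruct (Nat.eqb A 1); ring.
Qed.

Lemma mink_B_Q x t A : dom x -> I t -> (1 <= A <= n)%nat -> mink n (Bvar A x t) (Qvar x t) = xcomp A x t.
Proof.
  intros hx ht HA. rewrite mink_Qvar, mink_G_B, Bvar_0 by auto.
  rewrite (ssum_ext n _ (fun B => xcomp B x t * (if Nat.eqb B A then 1 else 0))).
  - rewrite ssum_delta by auto. ring.
  - intros B HB. rewrite (nf_BB _ _ _ _ (nullframe_Bvar x t hx ht)), Nat.eqb_sym by auto. reflexivity.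
Qed.

Lemma mink_W_Q x t : dom x -> I t -> mink n (Wvar x t) (Qvar x t) = 0.
Proof.
  intros hx ht. change (Wvar x t) with (Bvar 1 x t). rewrite mink_B_Q by (auto; lia). reflexivity.
Qed.

Lemma Bvar_1comp x t A : dom x -> I t -> (2 <= A <= n)%nat -> Bvar A x t 1%nat = - wcomp A x t.
Proof.
  intros hx ht HA. rewrite Bvar_ge2, Wvar_A by lia. unfold Evar.
  rewrite unitv_same, !unitv_diff by lia. unfold kappa.
  assert (h := wcomp_1_pos x t hx ht). field. lra.
Qed.

Lemma Bvar_2comp x t A : (2 <= A <= n)%nat ->
  Bvar A x t 2%nat = unitv A 2%nat - kappa A x t * wcomp 2 x t.
Proof.
  intros HA. rewrite Bvar_ge2, Wvar_A by lia. unfold Evar.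
  rewrite (unitv_diff 2 (S n)), (unitv_diff 2 1) by lia. ring.
Qed.

(** Orthogonality moves the derivative from [Cvar A] to [Qvar]. The part along [Gvar] drops out,
    since [<Gvar, D Qvar> = - speed <Wvar, Qvar> = 0], and the product rule for
    [<Bvar A, Qvar> = xcomp A] returns the derivative to [Bvar A]. The terms in [phi^0_1] and
    [phi^0_2] are the [e_0] component of [D (Bvar A)]. *)
Lemma ucomp_eq x t A : dom x -> I t -> (2 <= A <= n)%nat ->
  ucomp A x t = Dt (xcomp A) x t - phi t 0%nat 1%nat * wcomp A x t
    + phi t 1%nat 0%nat * (unitv A 2%nat - kappa A x t * wcomp 2 x t)
    - ssum n (fun B => xcomp B x t * mink n (Dphi (Bvar A) x t) (Bvar B x t)).
Proof.
  intros hx ht HA. unfold ucomp.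
  assert (GB := Gvec_Bvar A ltac:(lia)). assert (GC := Gvec_Cvar A ltac:(lia)).
  rewrite (Dop_mink_const' (Cvar A) Qvar x t 0); auto using Gvec_Qvar.
  2:{ intros x' t' hx' ht'. rewrite mink_sym.
      apply (nf_qB _ _ _ _ (nullframe_Cvar x' t' hx' ht')). lia. }
  unfold Cvar at 1. rewrite mink_plus, mink_scal.
  assert (E1 : mink n (Gvar x t) (Dphi Qvar x t) = 0).
  { assert (H := Dop_mink_const' Gvar Qvar x t (-1) Gvec_Gvar Gvec_Qvar hx ht
      (fun x' t' hx' ht' => nf_pq _ _ _ _ (nullframe_Cvar x' t' hx' ht'))).
    rewrite mink_DG, mink_W_Q in H by auto. lra. }
  assert (E2 : mink n (Dphi (Bvar A) x t) (Gvar x t) = 0).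
  { assert (H := Dop_mink_const' (Bvar A) Gvar x t 0 GB Gvec_Gvar hx ht
      (fun x' t' hx' ht' => mink_G_B x' t' A hx' ht' ltac:(lia))).
    rewrite H, mink_sym, mink_DG, mink_W_B by auto. ring. }
  assert (E3 := Dop_mink' (Bvar A) Qvar x t GB Gvec_Qvar hx ht).
  rewrite (Dt_ext I delta I_open _ (xcomp A)) in E3 by (auto; intros; apply mink_B_Q; auto; lia).
  rewrite mink_Qvar, E2 in E3. rewrite Dop_0 in E3 by auto.
  rewrite (Dt_const I delta I_open _ x t 0) in E3 by (auto; intros; apply Bvar_0; lia).
  rewrite (ssum_first2 n (fun B => phi t 0%nat B * Bvar A x t B)) in E3 by lia.
  unfold sumTheta in E3. rewrite rsum_zero in E3 by (intros; rewrite phi_0b by (auto; lia); ring).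
  rewrite Bvar_1comp, Bvar_2comp, phi_02 in E3 by auto.
  rewrite E1. lra.
Qed.

Lemma O1_mink (c d : R -> R -> vec) :
  (forall i, (i <= S n)%nat -> O1 (fun x t => c x t i)) -> Gvec d ->
  O1 (fun x t => mink n (c x t) (d x t)).
Proof.
  intros Hc Hd.
  assert (H : forall i j, (i <= S n)%nat -> (j <= S n)%nat -> O1 (fun x t => c x t i * d x t j)).
  { intros i j Hi Hj. apply O1_ext with (fun x t => d x t j * c x t i); [|intros; ring].
    apply O1_mult; [apply Hd; auto|auto]. }
  unfold mink. repeat apply O1_minus; try (apply H; lia).
  apply (O1_rsum I a b delta n (fun k x t => c x t (S k) * d x t (S k))). intros; apply H; lia.
Qed.

Definition Brest (A : nat) (x t : R) : vec := fun i => Bvar A x t i - unitv A i.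

Lemma Brest_O1 A i : (2 <= A <= n)%nat -> (i <= S n)%nat -> O1 (fun x t => Brest A x t i).
Proof.
  intros HA Hi.
  apply O1_ext with (fun x t => x * (y A t * unitv (S n) i)
     - (Evar 1 x t i + Wvar x t i) * kappa A x t).
  - apply O1_minus.
    + apply O1_eps. gen.
    + apply O1_mult; [|apply kappa_O1; auto].
      gen; [apply Gvec_Evar; auto|apply Gvec_Wvar; auto].
  - intros x t hx ht. unfold Brest. rewrite Bvar_ge2 by lia. unfold Evar at 2. ring.
Qed.

(** At [eps = 0] the vectors [Bvar] are those of [e], with connection coefficient [phi^B_A]; the
    rest is linear in the first order differences [Brest]. *)
Lemma mink_DB_B_O1 A B : (2 <= A <= n)%nat -> (2 <= B <= n)%nat ->
  O1 (fun x t => mink n (Dphi (Bvar A) x t) (Bvar B x t) - phi t B A).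
Proof.
  intros HA HB.
  apply O1_ext with (fun x t => (Dt (fun x t => Brest A x t B) x t
      + phi t B 0%nat * Brest A x t 0%nat + ssum n (fun C => phi t B C * Brest A x t C)
      + phi t 0%nat B * Brest A x t (S n))
    + mink n (Brest B x t) (Dphi (Bvar A) x t)).
  - apply O1_plus; [|apply O1_mink].
    + repeat apply O1_plus.
      * apply (O1_Dt I a b delta I_open). apply Brest_O1; auto; lia.
      * apply O1_mult; [gen|apply Brest_O1; auto; lia].
      * apply (O1_ssum I a b delta n (fun C x t => phi t B C * Brest A x t C)). intros.
        apply O1_mult; [gen|apply Brest_O1; auto; lia].
      * apply O1_mult; [gen|apply Brest_O1; auto; lia].
    + intros; apply Brest_O1; auto.
    + apply Gvec_Dop'. apply Gvec_Bvar. lia.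
  - intros x t hx ht.
    rewrite (mink_sym n (Brest B x t)). unfold Brest at 5.
    change (fun i => ?f i) with f. rewrite mink_minus_r, mink_unitv by lia.
    rewrite Dop_A by (auto; lia).
    rewrite (Dt_ext I delta I_open (fun x t => Bvar A x t B) (fun x t => Brest A x t B + unitv A B))
      by (auto; intros; unfold Brest; ring).
    assert (GR : Gen (fun x t => Brest A x t B)) by (apply O1_Gen; apply Brest_O1; auto; lia).
    rewrite (Dt_plus I a b delta I_open (fun x t => Brest A x t B) (fun _ _ => unitv A B)) by (auto; gen).
    rewrite (Dt_const I delta I_open (fun _ _ => unitv A B) x t (unitv A B)) by auto.
    unfold Brest at 2 3 4.
    rewrite (ssum_ext n (fun C => phi t B C * (Bvar A x t C - unitv A C))
      (fun C => phi t B C * Bvar A x t C - phi t B C * unitv A C)) by (intros; ring).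
    rewrite ssum_minus, ssum_unitv by lia. rewrite (unitv_diff 0%nat), (unitv_diff (S n)) by lia. ring.
Qed.

(** Up to the derivative of [xcomp 2], twice the first variation of [ds]. *)
Definition first_var (t : R) : R :=
  - (phi t 0%nat 1%nat * zv 2 t) + ssum n (fun B => phi t 2%nat B * xfirst B t).

Lemma Gen_first_var : Gen (fun _ t => first_var t).
Proof. unfold first_var. gen. Qed.
Local Hint Resolve Gen_first_var : gen.

(** The derivative of [xcomp 2] is deliberately left unexpanded: it integrates to the boundary
    values of [xcomp 2], which vanish for [Y] supported in the interior. *)
Lemma ucomp_2_O2 :
  O2 (fun x t => ucomp 2 x t - phi t 1%nat 0%nat - (Dt (xcomp 2) x t + x * first_var t)).
Proof.
  apply O2_ext with (fun x t =>
    - phi t 0%nat 1%nat * (wcomp 2 x t - x * zv 2 t)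
    - phi t 1%nat 0%nat * (kappa 2 x t * wcomp 2 x t)
    - ssum n (fun B => xcomp B x t * mink n (Dphi (Bvar 2) x t) (Bvar B x t)
                       + x * (phi t 2%nat B * xfirst B t))).
  - repeat apply O2_minus.
    + apply O2_mult; [gen|apply wcomp_O2; lia].
    + apply O2_mult; [gen|]. apply O1_mult_O1; [apply kappa_O1; lia|apply wcomp_O1; lia].
    + apply (O2_ssum I a b delta n (fun B x t => xcomp B x t * mink n (Dphi (Bvar 2) x t) (Bvar B x t)
                       + x * (phi t 2%nat B * xfirst B t))).
      intros B HB. destruct (Nat.eq_dec B 1) as [->|h].
      { apply O2_ext with (fun _ _ => 0); [apply O2_zero|].
        intros x t hx ht. rewrite phi_A1 by (auto; lia). unfold xcomp. simpl. ring. }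
      apply O2_ext with (fun x t =>
        xcomp B x t * (mink n (Dphi (Bvar 2) x t) (Bvar B x t) - phi t B 2%nat)
        + phi t B 2%nat * (xcomp B x t - x * xfirst B t)).
      * apply O2_plus.
        -- apply O1_mult_O1; [apply xcomp_O1; auto|apply mink_DB_B_O1; lia].
        -- apply O2_mult; [gen|apply xcomp_O2; lia].
      * intros x t hx ht. rewrite (phi_AB t 2 B) by (auto; lia). ring.
  - intros x t hx ht. rewrite ucomp_eq, unitv_same, ssum_plus, ssum_scal by (auto; lia).
    unfold first_var. ring.
Qed.

Lemma ucomp_2_O1 : O1 (fun x t => ucomp 2 x t - phi t 1%nat 0%nat).
Proof.
  apply O1_ext with (fun x t => (ucomp 2 x t - phi t 1%nat 0%nat - (Dt (xcomp 2) x t + x * first_var t))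
    + (Dt (xcomp 2) x t + x * first_var t)); [|intros; ring].
  apply O1_plus; [apply O2_O1, ucomp_2_O2|]. apply O1_plus.
  - apply (O1_Dt I a b delta I_open). apply xcomp_O1. lia.
  - apply O1_eps. gen.
Qed.

Lemma ucomp_O1 A : (3 <= A <= n)%nat -> O1 (ucomp A).
Proof.
  intros HA.
  apply O1_ext with (fun x t => Dt (xcomp A) x t - phi t 0%nat 1%nat * wcomp A x t
    - (phi t 1%nat 0%nat * wcomp 2 x t) * kappa A x t
    - ssum n (fun B => mink n (Dphi (Bvar A) x t) (Bvar B x t) * xcomp B x t)).
  - repeat apply O1_minus.
    + apply (O1_Dt I a b delta I_open). apply xcomp_O1. lia.
    + apply O1_mult; [gen|apply wcomp_O1; lia].
    + apply O1_mult; [gen|apply kappa_O1; lia].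
    + apply (O1_ssum I a b delta n (fun B x t => mink n (Dphi (Bvar A) x t) (Bvar B x t) * xcomp B x t)).
      intros B HB. apply O1_mult; [|apply xcomp_O1; auto].
      apply Gen_mink; [apply Gvec_Dop'; apply Gvec_Bvar; lia|apply Gvec_Bvar; auto].
  - intros x t hx ht. rewrite ucomp_eq, unitv_diff by (auto; lia).
    rewrite (ssum_ext n (fun B => mink n (Dphi (Bvar A) x t) (Bvar B x t) * xcomp B x t)
      (fun B => xcomp B x t * mink n (Dphi (Bvar A) x t) (Bvar B x t))) by (intros; ring). ring.
Qed.

(** * A majorant of the arclength density without roots *)

Definition usum (x t : R) : R := rsum (n - 1) (fun k => ucomp (k + 2) x t * ucomp (k + 2) x t).

Lemma Gen_usum : Gen usum.
Proof.
  unfold usum. apply (Gen_rsum I a b delta (n - 1) (fun k x t => ucomp (k + 2) x t * ucomp (k + 2) x t)).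
  intros; gen.
Qed.
Local Hint Resolve Gen_usum : gen.

(** This is [v (3 + r^4) / 4] for [r = ds / v], where [ds^4] is [usum] times [speed2]. At [eps = 0]
    one has [r = 1], where [(3 + r^4) / 4] and [r] agree together with their first derivatives, so
    the majorant has the correct first order term. *)
Definition energy (x t : R) : R :=
  phi t 1%nat 0%nat * (3 + usum x t * speed2 x t * (/ phi t 1%nat 0%nat) ^ 4) / 4.

Lemma energy_O2 : O2 (fun x t => energy x t
  - (phi t 1%nat 0%nat + (Dt (xcomp 2) x t + x * first_var t) / 2)).
Proof.
  set (h := fun x t => ucomp 2 x t - phi t 1%nat 0%nat).
  assert (Gh : Gen h) by (unfold h; gen).
  assert (D1 : O2 (fun x t => usum x t - phi t 1%nat 0%nat * phi t 1%nat 0%nat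
                              - 2 * phi t 1%nat 0%nat * h x t)).
  { apply O2_ext with (fun x t => h x t * h x t
      + rsum (n - 2) (fun k => ucomp (k + 3) x t * ucomp (k + 3) x t)).
    - apply O2_plus; [apply O1_mult_O1; apply ucomp_2_O1|].
      apply (O2_rsum I a b delta (n - 2) (fun k x t => ucomp (k + 3) x t * ucomp (k + 3) x t)).
      intros. apply O1_mult_O1; apply ucomp_O1; lia.
    - intros x t hx ht. unfold usum. replace (n - 1)%nat with (S (n - 2)) by lia.
      rewrite rsum_first. rewrite (rsum_ext _ (fun i => ucomp (S i + 2) x t * ucomp (S i + 2) x t)
        (fun k => ucomp (k + 3) x t * ucomp (k + 3) x t)).
      + change (0 + 2)%nat with 2%nat. unfold h. ring.
      + intros i Hi. replace (S i + 2)%nat with (i + 3)%nat by lia. reflexivity. }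
  apply O2_ext with (fun x t =>
    (/ 4 * (/ phi t 1%nat 0%nat * (/ phi t 1%nat 0%nat * / phi t 1%nat 0%nat))) *
    (speed2 x t * (usum x t - phi t 1%nat 0%nat * phi t 1%nat 0%nat - 2 * phi t 1%nat 0%nat * h x t)
     + (phi t 1%nat 0%nat * phi t 1%nat 0%nat + 2 * phi t 1%nat 0%nat * h x t)
       * (speed2 x t - phi t 1%nat 0%nat * phi t 1%nat 0%nat))
    + / 2 * (ucomp 2 x t - phi t 1%nat 0%nat - (Dt (xcomp 2) x t + x * first_var t))).
  - apply O2_plus; apply O2_mult.
    + gen.
    + apply O2_plus; apply O2_mult; [gen|exact D1|gen|apply speed2_O2].
    + gen.
    + apply ucomp_2_O2.
  - intros x t hx ht. unfold energy, h. assert (hv := v_pos t ht). field. lra.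
Qed.

(** * Values at [eps = 0] and the perturbed lift of the curve *)

Lemma dom_0 : dom 0.
Proof. lra. Qed.

Lemma at0_O1 f t : O1 f -> I t -> f 0 t = 0.
Proof. intros. apply (O1_at0 I a b delta); auto. Qed.

Lemma at0_O2 f t : O2 f -> I t -> f 0 t = 0.
Proof. intros. apply at0_O1; auto. apply O2_O1; auto. Qed.

Lemma Evar_at0 A t i : Evar A 0 t i = unitv A i.
Proof. unfold Evar. ring. Qed.

Lemma wcomp_at0 A t : I t -> (1 <= A <= n)%nat -> wcomp A 0 t = unitv 1%nat A.
Proof.
  intros ht HA. destruct (Nat.eq_dec A 1) as [->|h].
  - rewrite unitv_same. assert (H := at0_O2 _ t wcomp_1_O2 ht). lra.
  - rewrite unitv_diff by auto. apply (at0_O1 (wcomp A)); auto. apply wcomp_O1. lia.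
Qed.

Lemma Wvar_at0 t i : I t -> (i <= S n)%nat -> Wvar 0 t i = unitv 1%nat i.
Proof.
  intros ht Hi. unfold Wvar. rewrite (ssum_single n 1).
  - rewrite wcomp_at0, Evar_at0, unitv_same by (auto; lia). ring.
  - lia.
  - intros A HA h. rewrite wcomp_at0, unitv_diff by auto. ring.
Qed.

Lemma Bvar_at0 A t i : I t -> (1 <= A <= n)%nat -> (i <= S n)%nat -> Bvar A 0 t i = unitv A i.
Proof.
  intros ht HA Hi. destruct (Nat.eq_dec A 1) as [->|h].
  - apply Wvar_at0; auto.
  - rewrite Bvar_ge2, Evar_at0, (at0_O1 (kappa A)) by (auto; try apply kappa_O1; lia). ring.
Qed.

Lemma xcomp_at0 A t : I t -> (1 <= A <= n)%nat -> xcomp A 0 t = 0.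
Proof. intros. apply (at0_O1 (xcomp A)); auto. apply xcomp_O1; auto. Qed.

Lemma Cvar_at0 A t i : I t -> (1 <= A <= n)%nat -> (i <= S n)%nat -> Cvar A 0 t i = unitv A i.
Proof. intros. unfold Cvar. rewrite Bvar_at0, xcomp_at0 by auto. ring. Qed.

Lemma Qvar_at0 t i : I t -> (i <= S n)%nat -> Qvar 0 t i = unitv (S n) i.
Proof.
  intros ht Hi. unfold Qvar. rewrite !ssum_zero by (intros; rewrite xcomp_at0 by auto; ring).
  field.
Qed.

Lemma Gvar_at0 t i : (i <= S n)%nat -> Gvar 0 t i = unitv 0%nat i.
Proof.
  revert i. apply index_cases.
  - reflexivity.
  - rewrite Gvar_S, unitv_diff by lia. ring.
  - intros. rewrite Gvar_A, unitv_diff by lia. ring.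
Qed.

(** The factor in [F = kap e_0]. *)
Definition kap (t : R) : R := - mink n (F t) (col (e t) (S n)).

(** On [I] this is [kap] times the vector with components [Gvar]. Keeping [F t i] itself as the
    constant term makes [Fvar 0] equal to [F] for every real [t], as [variation] demands, and the
    polynomial form in [x] gives joint smoothness. *)
Definition Fvar (x t : R) : vec := fun i =>
  F t i + x * (kap t * ssum n (fun A => y A t * e t i A))
        + x * x * (kap t * (ynorm t / 2) * e t i (S n)).

Hypothesis F_curve : curve n I F.

Lemma Gen_F i : (i <= S n)%nat -> Gen (fun _ t => F t i).
Proof. intros. apply (Gen_smooth I a b delta (fun t => F t i)). apply F_curve; auto. Qed.

Lemma Gen_e i j : (i <= S n)%nat -> (j <= S n)%nat -> Gen (fun _ t => e t i j).
Proof. intros. apply (Gen_smooth I a b delta (fun t => e t i j)). apply special_smooth; auto. Qed.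
Local Hint Extern 2 (Gen (fun _ t => F t _)) => (apply Gen_F; lia) : gen.
Local Hint Extern 2 (Gen (fun _ t => e t _ _)) => (apply Gen_e; lia) : gen.

Lemma Gen_kap : Gen (fun _ t => kap t).
Proof.
  unfold kap. gen.
  apply (Gen_mink n I a b delta (fun _ t => F t) (fun _ t => col (e t) (S n))); intros; [gen|].
  unfold col. gen.
Qed.
Local Hint Resolve Gen_kap : gen.

Lemma kap_frame t : I t -> kap t <> 0 /\
  forall i, (i <= S n)%nat -> F t i = kap t * e t i 0%nat.
Proof.
  intros ht. destruct e_special as [[[_ Hf] _] _]. destruct (Hf t ht) as [_ (lam & hl & E)].
  assert (K : kap t = / lam).
  { unfold kap. rewrite (mink_ext n (F t) (fun i => / lam * col (e t) 0 i) _ (col (e t) (S n))).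
    - rewrite mink_scal, (special_iso t ht 0%nat (S n)) by lia.
      rewrite mink_unitvS, unitv_same. ring.
    - intros i Hi. unfold col. rewrite E by auto. field. auto.
    - auto. }
  rewrite K. split; [apply Rinv_neq_0_compat; auto|].
  intros i Hi. rewrite E by auto. field. auto.
Qed.

Lemma Fvar_comb x t i : I t -> (i <= S n)%nat -> Fvar x t i = kap t * comb n (e t) (Gvar x t) i.
Proof.
  intros ht Hi. unfold comb. rewrite rsum_ends, Gvar_0, Gvar_S.
  rewrite (ssum_ext n (fun A => Gvar x t A * e t i A) (fun A => x * (y A t * e t i A)))
    by (intros; rewrite Gvar_A by auto; ring).
  rewrite ssum_scal. unfold Fvar. rewrite (proj2 (kap_frame t ht)) by auto. ring.
Qed.

Lemma Fvar_0 t i : Fvar 0 t i = F t i.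
Proof. unfold Fvar. ring. Qed.

Lemma all_zero_or_nonzero (w : vec) : (forall i, (i <= S n)%nat -> w i = 0) \/ Defs.nonzero n w.
Proof.
  unfold Defs.nonzero. generalize (S n). induction n0 as [|k IH].
  - destruct (Req_dec (w 0%nat) 0).
    + left. intros i Hi. replace i with 0%nat by lia. auto.
    + right. exists 0%nat. auto.
  - destruct IH as [IH|(i & Hi & h)]; [|right; exists i; split; auto].
    destruct (Req_dec (w (S k)) 0); [left|right; exists (S k); auto].
    intros i Hi. destruct (Nat.eq_dec i (S k)) as [->|]; auto. apply IH; lia.
Qed.

(** The vector with components [Gvar] has product -1 with [e_(n+1)], so it does not vanish. If the
    derivative were a multiple of the curve, pairing with the unit tangent [Wvar] would give
    [kap * speed = 0]. *)
Lemma curve_Fvar x : dom x -> curve n I (Fvar x).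
Proof.
  intros hx. split; [|split].
  - intros i Hi. apply (Gen_smooth_on I a b delta I_open (fun x t => Fvar x t i)); auto.
    unfold Fvar. gen.
  - intros t ht. destruct (kap_frame t ht) as [hk _]. split.
    + destruct (all_zero_or_nonzero (Fvar x t)) as [H|H]; auto. exfalso.
      assert (E : mink n (comb n (e t) (Gvar x t)) (col (e t) (S n)) = -1).
      { rewrite mink_col_comb, mink_unitvS, Gvar_0 by (auto using special_iso). ring. }
      rewrite (mink_ext n _ (fun i => 0 * 0) _ (col (e t) (S n))), mink_scal in E; auto; [lra|].
      intros i Hi. assert (H' := H i Hi). rewrite Fvar_comb in H' by auto.
      apply Rmult_integral in H'. destruct H' as [H'|H']; [contradiction|]. rewrite H'. ring.
    + rewrite (mink_ext n _ (fun i => kap t * comb n (e t) (Gvar x t) i)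
        _ (fun i => kap t * comb n (e t) (Gvar x t) i)) by (intros; apply Fvar_comb; auto).
      rewrite mink_scal, mink_scal_r, mink_comb_iso by (auto using special_iso).
      rewrite (nf_pp _ _ _ _ (nullframe_Evar x t)). ring.
  - intros t ht dF HdF [k Hk]. destruct (kap_frame t ht) as [hk _].
    assert (E : forall i, (i <= S n)%nat -> dF i = Derive kap t * comb n (e t) (Gvar x t) i
        + kap t * comb n (e t) (Dphi Gvar x t) i).
    { intros i Hi. apply (uniqueness_limite (fun u => Fvar x u i) t); auto.
      apply is_derive_Reals.
      apply is_derive_ext_loc with (fun t => kap t * comb n (e t) (Gvar x t) i).
      - apply (filter_imp I); [|apply open_interval_locally; auto].
        intros s hs. symmetry. apply Fvar_comb; auto.
      - apply is_derive_Rmult.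
        + apply (Gen_is_derive I a b delta I_open (fun _ t => kap t) x t); auto using Gen_kap.
        + apply (is_derive_comb n I e phi I_open special_mc a b delta);
            auto using Gvec_Gvar. }
    assert (M : mink n (fun i => Derive kap t * comb n (e t) (Gvar x t) i
        + kap t * comb n (e t) (Dphi Gvar x t) i) (comb n (e t) (Wvar x t))
      = mink n (fun i => (k * kap t) * comb n (e t) (Gvar x t) i) (comb n (e t) (Wvar x t))).
    { apply mink_ext; auto. intros i Hi. rewrite <- E, Hk, Fvar_comb by auto. ring. }
    rewrite (mink_plus n (fun i => Derive kap t * comb n (e t) (Gvar x t) i)),
      !mink_scal, !mink_comb_iso, mink_DG, mink_W_W in M by (auto using special_iso).
    assert (GW : mink n (Gvar x t) (Wvar x t) = 0).
    { change (Wvar x t) with (Bvar 1 x t).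
      apply (nf_pB _ _ _ _ (nullframe_Bvar x t hx ht)). lia. }
    rewrite GW in M. assert (hs := speed_pos x t hx ht).
    assert (kap t * speed x t <> 0) by (apply Rmult_integral_contrapositive_currified; lra). lra.
Qed.

Lemma second_order_var x : dom x ->
  second_order_frame n I (Fvar x) (newframe n e Gvar Qvar Cvar x) (newphi n phi Gvar Qvar Cvar x).
Proof.
  intros hx.
  apply (newframe_second_order n I e phi I_open special_smooth special_iso special_mc a b delta);
    auto using special_moeb, Gvec_Gvar, Gvec_Qvar, Gvec_Cvar, nullframe_Cvar,
      second_order_0, second_order_1.
  - intros t i ht Hi. split; [apply Gvar_at0|apply Qvar_at0]; auto.
  - intros. apply Cvar_at0; auto.
  - intros t ht. destruct (kap_frame t ht) as [hk _]. exists (/ kap t).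
    split; [apply Rinv_neq_0_compat; auto|]. intros i Hi. rewrite Fvar_comb by auto.
    field. auto.
Qed.

(** * Arclength of the perturbed curve *)

Local Notation nphi x := (newphi n phi Gvar Qvar Cvar x).

Lemma nphi_10 x t : dom x -> I t -> nphi x t 1%nat 0%nat = speed x t.
Proof.
  intros hx ht. unfold newphi. rewrite (proj2 (Nat.eqb_neq 1 (S n))) by lia. simpl.
  rewrite mink_DG by auto.
  rewrite (mink_ext n (Wvar x t) (Wvar x t) (Cvar 1 x t) (Wvar x t)) by (auto using Cvar_1).
  rewrite mink_W_W by auto. ring.
Qed.

Lemma nphi_0A x t A : (1 <= A <= n)%nat -> nphi x t 0%nat A = ucomp A x t.
Proof.
  intros HA. unfold newphi, ucomp. simpl. rewrite !(proj2 (Nat.eqb_neq A _)) by lia. reflexivity.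
Qed.

Definition dsvar (x t : R) : R := sqrt (sqrt (usum x t * (/ speed x t * / speed x t))) * speed x t.

Lemma ds_var x t : dom x -> I t -> ds n (nphi x) t = dsvar x t.
Proof.
  intros hx ht. unfold ds, dsvar, psq. rewrite nphi_10 by auto. f_equal. f_equal. f_equal.
  unfold usum. rewrite <- (rsum_scal_r (n - 1) _ (fun k => ucomp (k + 2) x t * ucomp (k + 2) x t)).
  apply rsum_ext. intros k Hk. rewrite nphi_0A by lia. unfold Rdiv. ring.
Qed.

Lemma usum_nonneg x t : 0 <= usum x t.
Proof. apply rsum_nonneg. intros. apply Rle_0_sqr. Qed.

(** [r <= (3 + r^4) / 4] with [r = ds / v]; this replaces the expansion of the
    fourth root of the energy density, of which only an upper bound is needed. *)
Lemma dsvar_le x t : dom x -> I t -> dsvar x t <= energy x t.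
Proof.
  intros hx ht. assert (hs := speed_pos x t hx ht). assert (hv := v_pos t ht).
  set (q := usum x t * (/ speed x t * / speed x t)).
  assert (hq : 0 <= q).
  { apply Rmult_le_pos; [apply usum_nonneg|]. apply Rle_0_sqr. }
  set (p := sqrt (sqrt q)). assert (hp : 0 <= p) by apply sqrt_pos.
  assert (E : p ^ 4 = q).
  { replace (p ^ 4) with ((p * p) * (p * p)) by ring.
    unfold p. rewrite sqrt_sqrt by apply sqrt_pos. apply sqrt_sqrt; auto. }
  set (r := p * speed x t * / phi t 1%nat 0%nat).
  assert (hr : 0 <= r).
  { apply Rmult_le_pos; [apply Rmult_le_pos; lra|]. left; apply Rinv_0_lt_compat; auto. }
  assert (K : r <= (3 + r ^ 4) / 4).
  (* The product is [r^4 - 4 r + 3]. *)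
  { assert (0 <= (r - 1) * (r - 1) * (r * r + 2 * r + 3)) 
      by (apply Rmult_le_pos; [apply Rle_0_sqr|]; assert (h := Rmult_le_pos r r hr hr); lra).
    lra. }
  replace (dsvar x t) with (phi t 1%nat 0%nat * r) by (unfold dsvar, r; fold q; fold p; field; lra).
  replace (energy x t) with (phi t 1%nat 0%nat * ((3 + r ^ 4) / 4)).
  - apply Rmult_le_compat_l; lra.
  - unfold energy, r. rewrite !Rpow_mult_distr, E. unfold q.
    rewrite <- speed_sqr by auto. field. lra.
Qed.

Lemma dsvar_at0 t : I t -> dsvar 0 t = phi t 1%nat 0%nat.
Proof.
  intros ht. assert (hv := v_pos t ht).
  assert (S0 : speed 0 t = phi t 1%nat 0%nat).
  { assert (H := at0_O2 _ t speed_O2 ht). simpl in H. lra. }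
  assert (U0 : usum 0 t = phi t 1%nat 0%nat * phi t 1%nat 0%nat).
  { unfold usum. rewrite (rsum_single _ 0).
    - assert (H := at0_O1 _ t ucomp_2_O1 ht). simpl in H. simpl. nra.
    - lia.
    - intros i Hi h. rewrite (at0_O1 (ucomp (i + 2))) by (auto; apply ucomp_O1; lia). ring. }
  unfold dsvar. rewrite S0, U0.
  replace (phi t 1%nat 0%nat * phi t 1%nat 0%nat * (/ phi t 1%nat 0%nat * / phi t 1%nat 0%nat)) with 1
    by (field; lra).
  rewrite !sqrt_1. ring.
Qed.

Lemma Gen_continuous f x t : Gen f -> dom x -> I t -> continuous (f x) t.
Proof.
  intros G hx ht. apply (ex_derive_continuous (f x)). eapply (Gen_ex_derive I a b delta); eauto.
Qed.

(** The class [Gen] does not apply to the fourth root, for lack of a positive lower bound on [usum];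
    continuity is enough for integrability. *)
Lemma continuous_dsvar x t : dom x -> I t -> continuous (dsvar x) t.
Proof.
  intros hx ht. unfold dsvar.
  apply (continuous_mult (K := R_AbsRing) (fun t => sqrt (sqrt (usum x t * (/ speed x t * / speed x t)))) (speed x)).
  - apply (continuous_comp (fun t => sqrt (usum x t * (/ speed x t * / speed x t))) sqrt);
      [|apply continuous_sqrt].
    apply (continuous_comp (fun t => usum x t * (/ speed x t * / speed x t)) sqrt);
      [|apply continuous_sqrt].
    apply (Gen_continuous (fun x t => usum x t * (/ speed x t * / speed x t))); auto. gen.
  - apply Gen_continuous; auto. gen.
Qed.

Lemma is_RInt_Gen f x : Gen f -> dom x -> ex_RInt (f x) a b.
Proof.
  intros G hx. apply (ex_RInt_continuous (f x)). intros t ht.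
  apply Gen_continuous; auto. apply ab_I. rewrite Rmin_left, Rmax_right in ht; lra.
Qed.

Lemma ex_RInt_dsvar x : dom x -> ex_RInt (dsvar x) a b.
Proof.
  intros hx. apply (ex_RInt_continuous (dsvar x)). intros t ht.
  apply continuous_dsvar; auto. apply ab_I. rewrite Rmin_left, Rmax_right in ht; lra.
Qed.

Definition Lvar (x : R) : R := RInt (dsvar x) a b.

Lemma is_arclength_var x : dom x -> is_arclength n I (Fvar x) a b (Lvar x).
Proof.
  intros hx. exists (newframe n e Gvar Qvar Cvar x), (nphi x).
  split; [apply second_order_var; auto|]. split.
  - intros t ht. rewrite nphi_10 by auto. apply speed_pos; auto.
  - assert (Hext : forall t, Rmin a b < t < Rmax a b -> dsvar x t = ds n (nphi x) t).
    { intros t ht. rewrite Rmin_left, Rmax_right in ht by lra. symmetry. apply ds_var; auto.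
      apply ab_I; lra. }
    assert (E : ex_RInt (ds n (nphi x)) a b)
      by (apply (ex_RInt_ext (dsvar x)); auto; apply ex_RInt_dsvar; auto).
    exists (ex_RInt_Reals_0 _ _ _ E). rewrite <- RInt_Reals. apply RInt_ext. auto.
Qed.

(** * First variation for a compactly supported section *)

Context (c d : R).
Hypothesis supp : a < c /\ c <= d /\ d < b.
Hypothesis y_supp : forall A t, (t < c \/ d < t) -> y A t = 0.

Lemma outside_locally t : I t -> (t < c \/ d < t) -> locally t (fun s => I s /\ (s < c \/ d < s)).
Proof.
  intros ht h. apply filter_and; [apply open_interval_locally; auto|].
  destruct h as [h|h].
  - apply (filter_imp (fun s => s < c)); [auto|]. apply (open_lt c t h).
  - apply (filter_imp (fun s => d < s)); [auto|]. apply (open_gt d t h).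
Qed.

Lemma ynorm_outside t : (t < c \/ d < t) -> ynorm t = 0.
Proof. intros h. apply ssum_zero. intros. rewrite y_supp by auto. ring. Qed.

Lemma Derive_outside A t : I t -> (t < c \/ d < t) -> Derive (y A) t = 0.
Proof.
  intros ht h. rewrite (Derive_ext_loc _ (fun _ => 0)); [apply Derive_const|].
  apply (filter_imp _ _ (fun s hs => y_supp A s (proj2 hs)) (outside_locally t ht h)).
Qed.

Lemma gcomp_outside A x t : I t -> (t < c \/ d < t) -> gcomp A x t = phi t A 0%nat.
Proof.
  intros ht h. unfold gcomp, zeta. rewrite ynorm_outside, Derive_outside by auto.
  rewrite ssum_zero by (intros; rewrite y_supp by auto; ring). field.
Qed.

Lemma wcomp_outside A x t : dom x -> I t -> (t < c \/ d < t) -> (2 <= A <= n)%nat -> wcomp A x t = 0.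
Proof.
  intros hx ht h HA. unfold wcomp. rewrite gcomp_outside, phi_A0 by auto. ring.
Qed.

Lemma xcomp_2_outside x t : dom x -> I t -> (t < c \/ d < t) -> xcomp 2 x t = 0.
Proof.
  intros hx ht h. rewrite xcomp_eq, Dop_Wvar_A by (auto; lia).
  unfold kappa. rewrite wcomp_outside, y_supp by (auto; lia).
  assert (E : Dt (wcomp 2) x t = 0).
  { unfold Dt. rewrite (Derive_ext_loc _ (fun _ => 0)); [apply Derive_const|].
    apply (filter_imp (fun s => I s /\ (s < c \/ d < s))); [|apply outside_locally; auto].
    intros s [hs hs']. apply wcomp_outside; auto; lia. }
  rewrite E, Wvar_S, !ssum_zero.
  - ring.
  - intros. rewrite y_supp by auto. ring.
  - intros A HA. destruct (Nat.eq_dec A 1) as [->|h'].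
    + rewrite phi_A1 by (auto; lia). ring.
    + rewrite wcomp_outside by (auto; lia). ring.
Qed.

(** Integration of [dsvar <= energy] with the expansion [energy_O2]; [C] bounds the remainder
    factor, whence [K = C (b - a)]. *)
Lemma Lvar_le : exists K, 0 <= K /\ forall x, dom x ->
  Lvar x <= Lvar 0 + x / 2 * RInt first_var a b + x * x * K.
Proof.
  destruct energy_O2 as (r & Gr & Hr).
  destruct (Gen_bounded I a b delta ab_I r Gr) as (C & HC & HrC).
  exists (C * (b - a)). split; [apply Rmult_le_pos; lra|]. intros x hx.
  assert (I1 : is_RInt (fun t => phi t 1%nat 0%nat) a b (Lvar 0)).
  { apply (is_RInt_ext (dsvar 0)).
    - intros t ht. rewrite Rmin_left, Rmax_right in ht by lra. apply dsvar_at0. apply ab_I; lra.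
    - apply (RInt_correct (dsvar 0)). apply ex_RInt_dsvar. apply dom_0. }
  (* The exact derivative disappears: [a] and [b] lie outside the support of [Y], where [xcomp 2]
     vanishes. *)
  assert (I2 : is_RInt (Dt (xcomp 2) x) a b 0).
  { replace 0 with (minus (xcomp 2 x b) (xcomp 2 x a)).
    - apply (is_RInt_derive (xcomp 2 x)).
      + intros t ht. rewrite Rmin_left, Rmax_right in ht by lra.
        apply (Gen_is_derive I a b delta); auto. gen; lia.
      + intros t ht. rewrite Rmin_left, Rmax_right in ht by lra.
        apply Gen_continuous; auto. gen; lia.
    - rewrite !xcomp_2_outside by (auto; lra). unfold minus, plus, opp; simpl; ring. }
  assert (I3 : is_RInt first_var a b (RInt first_var a b)).
  { apply (RInt_correct first_var). apply (is_RInt_Gen (fun _ t => first_var t) 0); auto using dom_0. gen. }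
  assert (I4 : is_RInt (fun t => (phi t 1%nat 0%nat + / 2 * Dt (xcomp 2) x t)
     + (x / 2 * first_var t + x * x * C)) a b
     ((Lvar 0 + / 2 * 0) + (x / 2 * RInt first_var a b + (b - a) * (x * x * C)))).
  { apply (is_RInt_plus (V := R_NormedModule)); apply (is_RInt_plus (V := R_NormedModule)); auto.
    - apply (is_RInt_scal (V := R_NormedModule)); auto.
    - apply (is_RInt_scal (V := R_NormedModule)); auto.
    - apply (is_RInt_const (V := R_NormedModule)). }
  assert (I5 : is_RInt (dsvar x) a b (Lvar x))
    by (apply (RInt_correct (dsvar x)); apply ex_RInt_dsvar; auto).
  assert (L := is_RInt_le _ _ a b _ _ (Rlt_le _ _ a_lt_b) I5 I4).
  eapply Rle_trans; [apply L|right; field]. clear L.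
  intros t ht. assert (ht' : I t) by (apply ab_I; lra).
  eapply Rle_trans; [apply dsvar_le; auto|].
  assert (E := Hr x t hx ht'). assert (B := HrC x t hx (conj (Rlt_le _ _ (proj1 ht)) (Rlt_le _ _ (proj2 ht)))).
  assert (B' := Rle_trans _ _ _ (Rle_abs _) B).
  assert (x * x * r x t <= x * x * C) by (apply Rmult_le_compat_l; [apply Rle_0_sqr|auto]).
  simpl in E. lra.
Qed.

Lemma cont2_continuity_2d_pt h x t : continuity_2d_pt h x t -> cont2 h x t.
Proof.
  intros H eps heps. destruct (H (mkposreal eps heps)) as [del Hdel].
  exists del. split; [apply cond_pos|]. intros. apply Hdel; auto.
Qed.

(** A quadratic polynomial in the parameter has only three nonzero parameter derivatives, so the
    whole table of mixed partial derivatives can be written down. *)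
Lemma smooth2_quadratic (U : R -> R -> Prop) (J : R -> Prop) g0 g1 g2 :
  (forall x t, U x t -> J t) -> smooth_on J g0 -> smooth_on J g1 -> smooth_on J g2 ->
  smooth2 U (fun x t => g0 t + x * g1 t + x * x * g2 t).
Proof.
  intros HU [D0 [E0 H0]] [D1 [E1 H1]] [D2 [E2 H2]].
  exists (fun j k x t => match j with
    | 0%nat => D0 k t + x * D1 k t + x * x * D2 k t
    | 1%nat => D1 k t + 2 * x * D2 k t
    | 2%nat => 2 * D2 k t
    | _ => 0 end).
  split; [intros; rewrite E0, E1, E2; reflexivity|].
  intros j k x t Ut. assert (Jt := HU x t Ut).
  assert (C : forall (D : nat -> R -> R), (forall k t, J t -> derivable_pt_lim (D k) t (D (S k) t)) ->
     continuity_2d_pt (fun _ t => D k t) x t).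
  { intros D HD. apply (continuity_1d_2d_pt_comp (D k) (fun _ t => t)).
    - apply derivable_continuous_pt. exists (D (S k) t). apply HD; auto.
    - apply continuity_2d_pt_id2. }
  assert (C0 := C D0 H0). assert (C1 := C D1 H1). assert (C2 := C D2 H2).
  split; [|split].
  - apply is_derive_Reals. destruct j as [|[|[|j]]]; auto_derive; auto; ring.
  - assert (K0 := proj1 (is_derive_Reals _ _ _) (proj2 (is_derive_Reals _ _ _) (H0 k t Jt))).
    apply is_derive_Reals.
    assert (K1 : is_derive (D0 k) t (D0 (S k) t)) by (apply is_derive_Reals; auto).
    assert (K2 : is_derive (D1 k) t (D1 (S k) t)) by (apply is_derive_Reals; auto).
    assert (K3 : is_derive (D2 k) t (D2 (S k) t)) by (apply is_derive_Reals; auto).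
    destruct j as [|[|[|j]]].
    + apply @is_derive_plus; [apply @is_derive_plus; auto|].
      * apply is_derive_scal; auto.
      * apply is_derive_scal; auto.
    + apply @is_derive_plus; auto. apply is_derive_scal; auto.
    + apply is_derive_scal; auto.
    + apply @is_derive_const.
  - apply cont2_continuity_2d_pt.
    assert (Cx : continuity_2d_pt (fun x _ => x) x t) by apply continuity_2d_pt_id1.
    destruct j as [|[|[|j]]].
    + apply continuity_2d_pt_plus; [apply continuity_2d_pt_plus; auto|]; 
        apply continuity_2d_pt_mult; auto. apply continuity_2d_pt_mult; auto.
    + apply continuity_2d_pt_plus; auto. apply continuity_2d_pt_mult; auto.
      apply continuity_2d_pt_mult; auto. apply continuity_2d_pt_const.
    + apply continuity_2d_pt_mult; auto. apply continuity_2d_pt_const.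
    + apply continuity_2d_pt_const.
Qed.

Lemma variation_Fvar : variation n I F a b delta Fvar.
Proof.
  split; [auto|]. split; [|split; [|split]].
  - intros i Hi. unfold Fvar. apply (smooth2_quadratic _ I (fun t => F t i)
      (fun t => kap t * ssum n (fun A => y A t * e t i A))
      (fun t => kap t * (ynorm t / 2) * e t i (S n))).
    + intros; tauto.
    + apply F_curve; auto.
    + apply (Gen_smooth_on I a b delta I_open (fun _ t => kap t * ssum n (fun A => y A t * e t i A)) 0);
        auto using dom_0. gen.
    + apply (Gen_smooth_on I a b delta I_open (fun _ t => kap t * (ynorm t / 2) * e t i (S n)) 0);
        auto using dom_0. gen.
  - intros. apply Fvar_0.
  - intros; apply curve_Fvar; auto.
  - exists c, d. repeat split; try apply supp. intros x t hx ht h i Hi.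
    unfold Fvar. rewrite ynorm_outside, ssum_zero by (auto; intros; rewrite y_supp by auto; ring).
    field.
Qed.

Hypothesis F_geodesic : conformal_geodesic n I F.

Lemma RInt_first_var : RInt first_var a b = 0.
Proof.
  destruct F_geodesic as [_ H].
  assert (D := H a b I_a I_b a_lt_b delta Fvar variation_Fvar Lvar (fun x hx => is_arclength_var x hx)).
  destruct Lvar_le as (K & hK & HL).
  set (J := RInt first_var a b) in *.
  destruct (Req_dec J 0) as [|hJ]; auto. exfalso.
  assert (pJ : 0 < Rabs J) by (apply Rabs_pos_lt; auto).
  destruct (D (Rabs J / 4)) as [del Hdel]; [lra|].
  (* The last bound gives [h K <= |J| / 4]. The upper estimate then forces a difference quotient of
     size at least [|J| / 2 - |J| / 4], whereas the vanishing derivative makes it smaller than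
     [|J| / 4]. *)
  set (h := Rmin (Rmin (delta / 2) (del / 2)) (Rabs J / (4 * (K + 1)))).
  assert (pd := cond_pos del).
  assert (hh : 0 < h).
  { repeat apply Rmin_glb_lt; try lra. apply Rdiv_lt_0_compat; lra. }
  assert (h1 : h <= delta / 2) by (eapply Rle_trans; [apply Rmin_l|apply Rmin_l]).
  assert (h2 : h <= del / 2) by (eapply Rle_trans; [apply Rmin_l|apply Rmin_r]).
  assert (h3 : h * (4 * (K + 1)) <= Rabs J).
  { apply Rle_trans with (Rabs J / (4 * (K + 1)) * (4 * (K + 1))).
    - apply Rmult_le_compat_r; [lra|]. apply Rmin_r.
    - right. field. lra. }
  destruct (Rle_dec 0 J) as [s|s].
  (* The increment is taken with the sign opposite to [J], so that the upper bound falls below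
     [Lvar 0]. *)
  - rewrite (Rabs_pos_eq J) in * by auto.
    assert (A := HL (- h) ltac:(lra)).
    assert (B := Hdel (- h) ltac:(lra) ltac:(rewrite Rabs_Ropp, Rabs_pos_eq; lra)).
    rewrite Rplus_0_l, Rminus_0_r in B. apply Rabs_def2 in B.
    assert (E : (Lvar (- h) - Lvar 0) / - h * h = - (Lvar (- h) - Lvar 0)) by (field; lra).
    assert ((Lvar (- h) - Lvar 0) / - h * h < J / 4 * h) by (apply Rmult_lt_compat_r; lra).
    nra.
  - rewrite (Rabs_left J) in * by lra.
    assert (A := HL h ltac:(lra)).
    assert (B := Hdel h ltac:(lra) ltac:(rewrite Rabs_pos_eq; lra)).
    rewrite Rplus_0_l, Rminus_0_r in B. apply Rabs_def2 in B.
    assert (E : (Lvar h - Lvar 0) / h * h = Lvar h - Lvar 0) by (field; lra).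
    assert (- (- J / 4) * h < (Lvar h - Lvar 0) / h * h) by (apply Rmult_lt_compat_r; lra).
    nra.
Qed.

(** * The Euler-Lagrange expression by integration by parts *)

Definition theta_index (A : nat) : bool := andb (Nat.leb 3 A) (Nat.leb A n).

Lemma theta_index_true A : (3 <= A <= n)%nat -> theta_index A = true.
Proof. intros. unfold theta_index. rewrite !(proj2 (Nat.leb_le _ _)) by lia. reflexivity. Qed.

Lemma theta_index_false A : ~ (3 <= A <= n)%nat -> theta_index A = false.
Proof.
  intros h. unfold theta_index. destruct (Nat.leb_spec 3 A); destruct (Nat.leb_spec A n); auto. lia.
Qed.

(** Components of [X], and below of [nabla X / ds], extended by zero outside [3..n]: sums over
    [Theta] become sums over [1..n], where the connection form is skew. *)
Definition Qcomp (A : nat) (t : R) : R :=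
  if theta_index A then phi t A 2%nat * / phi t 1%nat 0%nat else 0.

Definition Pcomp (A : nat) (t : R) : R :=
  if theta_index A then / phi t 1%nat 0%nat *
    (Derive (Qcomp A) t + ssum n (fun B => phi t A B * Qcomp B t)) else 0.

(** Component [A] of [nabla P - v (2 mu + |q|^2) q], where [v mu = phi^0_1]. *)
Definition ELcomp (A : nat) (t : R) : R :=
  if theta_index A then
    Derive (Pcomp A) t + ssum n (fun B => phi t A B * Pcomp B t)
    - (2 * phi t 0%nat 1%nat + phi t 1%nat 0%nat * ssum n (fun B => Qcomp B t * Qcomp B t)) * Qcomp A t
  else 0.

Lemma Gen_Qcomp A : (1 <= A <= n)%nat -> Gen (fun _ t => Qcomp A t).
Proof. intros. unfold Qcomp. destruct (theta_index A); gen. Qed.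
Local Hint Extern 2 (Gen (fun _ t => Qcomp _ t)) => (apply Gen_Qcomp; lia) : gen.

Lemma Gen_Qcomp' A : (1 <= A <= n)%nat -> Gen (fun _ t => Derive (Qcomp A) t).
Proof. intros. apply (Gen_Dt I a b delta I_open (fun _ t => Qcomp A t)). gen. Qed.
Local Hint Extern 2 (Gen (fun _ t => Derive (Qcomp _) t)) => (apply Gen_Qcomp'; lia) : gen.

Lemma Gen_Pcomp A : (1 <= A <= n)%nat -> Gen (fun _ t => Pcomp A t).
Proof. intros. unfold Pcomp. destruct (theta_index A); gen. Qed.
Local Hint Extern 2 (Gen (fun _ t => Pcomp _ t)) => (apply Gen_Pcomp; lia) : gen.
Local Hint Extern 2 (Gen (fun _ => Pcomp _)) => (apply Gen_Pcomp; lia) : gen.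
Local Hint Extern 2 (Gen (fun _ => Qcomp _)) => (apply Gen_Qcomp; lia) : gen.
Local Hint Extern 2 (Gen (fun _ => zv _)) => (apply Gen_zv; lia) : gen.
Local Hint Extern 2 (Gen (fun _ => y _)) => (apply Gen_y) : gen.

Lemma Gen_Pcomp' A : (1 <= A <= n)%nat -> Gen (fun _ t => Derive (Pcomp A) t).
Proof. intros. apply (Gen_Dt I a b delta I_open (fun _ t => Pcomp A t)). gen. Qed.
Local Hint Extern 2 (Gen (fun _ t => Derive (Pcomp _) t)) => (apply Gen_Pcomp'; lia) : gen.

Lemma Gen_ELcomp A : (1 <= A <= n)%nat -> Gen (fun _ t => ELcomp A t).
Proof. intros. unfold ELcomp. destruct (theta_index A); gen. Qed.
Local Hint Extern 2 (Gen (fun _ t => ELcomp _ t)) => (apply Gen_ELcomp; lia) : gen.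

Lemma phi_skew_sum t (f g : nat -> R) : I t ->
  ssum n (fun A => f A * ssum n (fun B => phi t A B * g B))
  = - ssum n (fun A => g A * ssum n (fun B => phi t A B * f B)).
Proof.
  intros ht.
  rewrite (ssum_ext n _ (fun A => ssum n (fun B => f A * (phi t A B * g B))))
    by (intros; rewrite ssum_scal; reflexivity).
  rewrite ssum_swap.
  replace (- ssum n (fun A => g A * ssum n (fun B => phi t A B * f B)))
    with (-1 * ssum n (fun A => g A * ssum n (fun B => phi t A B * f B))) by ring.
  rewrite <- ssum_scal. apply ssum_ext. intros B HB.
  rewrite <- ssum_scal, <- ssum_scal. apply ssum_ext. intros A HA.
  rewrite (phi_AB t A B) by auto. ring.
Qed.

Lemma phi_2_Qcomp t A : I t -> (1 <= A <= n)%nat ->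
  phi t 2%nat A = - (phi t 1%nat 0%nat * Qcomp A t).
Proof.
  intros ht HA. unfold Qcomp. assert (hv := v_pos t ht). rewrite (phi_AB t 2 A) by (auto; lia).
  destruct (Nat.le_gt_cases 3 A).
  - rewrite theta_index_true by lia. field. lra.
  - rewrite theta_index_false by lia.
    assert (h : (A = 1 \/ A = 2)%nat) by lia. destruct h as [-> | ->].
    + rewrite phi_1A by (auto; lia). ring.
    + rewrite phi_22 by auto. ring.
Qed.

(** The term [<P, Y> - <X, nabla Y / ds>] left by the two integrations by parts that free [Y] of its
    derivatives. *)
Definition boundary (t : R) : R :=
  ssum n (fun A => Pcomp A t * y A t) - ssum n (fun A => Qcomp A t * zv A t).

Lemma Derive_boundary t : I t -> Derive boundary t =
  ssum n (fun A => Derive (Pcomp A) t * y A t + Pcomp A t * Derive (y A) t)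
  - ssum n (fun A => Derive (Qcomp A) t * zv A t + Qcomp A t * Derive (zv A) t).
Proof.
  intros ht.
  change (Derive boundary t) with (Dt (fun _ t => ssum n (fun A => Pcomp A t * y A t)
    - ssum n (fun A => Qcomp A t * zv A t)) 0 t).
  rewrite (Dt_minus I a b delta I_open (fun _ t => ssum n (fun A => Pcomp A t * y A t))
    (fun _ t => ssum n (fun A => Qcomp A t * zv A t))) by (auto using dom_0; gen).
  rewrite (Dt_ssum I a b delta I_open n (fun A _ t => Pcomp A t * y A t))
    by (auto using dom_0; intros; gen).
  rewrite (Dt_ssum I a b delta I_open n (fun A _ t => Qcomp A t * zv A t))
    by (auto using dom_0; intros; gen).
  f_equal; apply ssum_ext; intros A HA.
  - apply (Dt_mult I a b delta I_open (fun _ => Pcomp A) (fun _ => y A) 0 t); [gen|gen|apply dom_0|auto].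
  - apply (Dt_mult I a b delta I_open (fun _ => Qcomp A) (fun _ => zv A) 0 t); [gen|gen|apply dom_0|auto].
Qed.

(** The coefficients of the Euler-Lagrange equation arise as follows. One [phi^0_1 <q, Y>] comes
    from [zv 2 = - <q, Y>] in [first_var], the other from the summand [y_A phi^0_1] of [xfirst];
    together they give [2 mu]. The cubic term comes from index 2: differentiating [X] produces an
    [e_2] component [- v |q|^2], which is paired with [zv 2]. *)
Lemma first_var_by_parts t : I t ->
  first_var t = Derive boundary t - ssum n (fun A => y A t * ELcomp A t).
Proof.
  intros ht. assert (hv := v_pos t ht). rewrite Derive_boundary by auto.
  set (v := phi t 1%nat 0%nat) in *. set (w := phi t 0%nat 1%nat).
  set (QQ := ssum n (fun B => Qcomp B t * Qcomp B t)).
  set (Qy := ssum n (fun A => Qcomp A t * y A t)).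
  set (om := fun (f : nat -> R) A => ssum n (fun B => phi t A B * f B)).
  assert (z2 : zv 2 t = - Qy).
  { unfold zv, zeta. rewrite Derive_y_theta by lia. fold v.
    rewrite (ssum_ext n _ (fun B => (- v) * (Qcomp B t * y B t)))
      by (intros; rewrite phi_2_Qcomp by auto; fold v; ring).
    rewrite ssum_scal. fold Qy. field. lra. }
  assert (F1 : first_var t = w * Qy - ssum n (fun A => Qcomp A t * Derive (zv A) t)
     - ssum n (fun A => Qcomp A t * om (fun B => zv B t) A) + w * Qy).
  { unfold first_var. fold w. rewrite z2.
    rewrite (ssum_ext n _ (fun A => (w * (Qcomp A t * y A t) - Qcomp A t * Derive (zv A) t)
       - Qcomp A t * om (fun B => zv B t) A)).
    - rewrite !ssum_minus, ssum_scal. fold Qy. ring.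
    - intros A HA. rewrite phi_2_Qcomp by auto. unfold xfirst, om. fold v w. field. lra. }
  assert (F2 : ssum n (fun A => y A t * ELcomp A t) =
     ssum n (fun A => Derive (Pcomp A) t * y A t) + ssum n (fun A => y A t * om (fun B => Pcomp B t) A)
     - (2 * w + v * QQ) * Qy).
  { unfold Qy. rewrite <- ssum_scal, <- ssum_plus, <- ssum_minus. apply ssum_ext. intros A HA.
    unfold ELcomp. destruct (Nat.le_gt_cases 3 A).
    - rewrite theta_index_true by lia. unfold om. fold v w QQ. ring.
    - rewrite (y_theta A) by lia. ring. }
  assert (F3 : ssum n (fun A => Derive (Qcomp A) t * zv A t) =
     v * ssum n (fun A => Pcomp A t * zv A t)
     - ssum n (fun A => zv A t * om (fun B => Qcomp B t) A) + v * QQ * Qy).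
  { assert (O2' : om (fun B => Qcomp B t) 2%nat = - v * QQ).
    { unfold om, QQ. rewrite <- ssum_scal. apply ssum_ext. intros.
      rewrite phi_2_Qcomp by auto. fold v. ring. }
    replace (v * QQ * Qy) with (ssum n (fun A => (zv A t * om (fun B => Qcomp B t) A) * unitv 2%nat A)).
    2:{ rewrite ssum_unitv, z2, O2' by lia. ring. }
    rewrite <- ssum_scal, <- ssum_minus, <- ssum_plus. apply ssum_ext. intros A HA.
    destruct (Nat.le_gt_cases 3 A).
    - rewrite unitv_diff by lia. unfold Pcomp. rewrite theta_index_true by lia. unfold om. fold v.
      field. lra.
    - assert (E : Derive (Qcomp A) t = 0).
      { rewrite (Derive_ext _ (fun _ => 0)); [apply Derive_const|].
        intros. unfold Qcomp. rewrite theta_index_false by lia. reflexivity. }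
      rewrite E. unfold Pcomp. rewrite theta_index_false by lia.
      assert (h : (A = 1 \/ A = 2)%nat) by lia. destruct h as [-> | ->].
      + unfold zv. rewrite zeta_1 by auto. ring.
      + rewrite unitv_same. ring. }
  assert (F4 : v * ssum n (fun A => Pcomp A t * zv A t) =
     ssum n (fun A => Pcomp A t * Derive (y A) t) + ssum n (fun A => Pcomp A t * om (fun B => y B t) A)).
  { rewrite <- ssum_scal, <- ssum_plus. apply ssum_ext. intros A HA.
    unfold zv, zeta, om. fold v. field. lra. }
  assert (S1 := phi_skew_sum t (fun A => Qcomp A t) (fun A => zv A t) ht).
  assert (S2 := phi_skew_sum t (fun A => Pcomp A t) (fun A => y A t) ht).
  cbv beta in S1, S2.
  change (fun A => Qcomp A t * ssum n (fun B => phi t A B * zv B t))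
    with (fun A => Qcomp A t * om (fun B => zv B t) A) in S1.
  change (fun A => zv A t * ssum n (fun B => phi t A B * Qcomp B t))
    with (fun A => zv A t * om (fun B => Qcomp B t) A) in S1.
  change (fun A => Pcomp A t * ssum n (fun B => phi t A B * y B t))
    with (fun A => Pcomp A t * om (fun B => y B t) A) in S2.
  change (fun A => y A t * ssum n (fun B => phi t A B * Pcomp B t))
    with (fun A => y A t * om (fun B => Pcomp B t) A) in S2.
  rewrite F1, F2, !ssum_plus, F3. lra.
Qed.

Lemma boundary_outside t : I t -> (t < c \/ d < t) -> boundary t = 0.
Proof.
  intros ht h. unfold boundary. rewrite !ssum_zero.
  - ring.
  - intros A HA. unfold zv, zeta. rewrite Derive_outside by auto.
    rewrite ssum_zero by (intros; rewrite y_supp by auto; ring). ring.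
  - intros. rewrite y_supp by auto. ring.
Qed.

Lemma RInt_ELcomp : is_RInt (fun t => ssum n (fun A => y A t * ELcomp A t)) a b 0.
Proof.
  assert (Gb : Gen (fun _ t => boundary t)) by (unfold boundary; gen).
  assert (I1 : is_RInt first_var a b 0).
  { rewrite <- RInt_first_var.
    apply (RInt_correct first_var). apply (is_RInt_Gen (fun _ t => first_var t) 0); auto using dom_0. gen. }
  assert (I2 : is_RInt (Derive boundary) a b 0).
  { replace 0 with (minus (boundary b) (boundary a)).
    - apply (is_RInt_derive boundary).
      + intros t ht. rewrite Rmin_left, Rmax_right in ht by lra.
        apply (Gen_is_derive I a b delta I_open (fun _ t => boundary t) 0); auto using dom_0.
      + intros t ht. rewrite Rmin_left, Rmax_right in ht by lra.
        apply (Gen_continuous (Dt (fun _ t => boundary t)) 0); auto using dom_0.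
        apply (Gen_Dt I a b delta I_open); auto.
    - rewrite !boundary_outside by (auto; lra). unfold minus, plus, opp; simpl; ring. }
  apply (is_RInt_ext (fun t => minus (Derive boundary t) (first_var t))).
  - intros t ht. rewrite Rmin_left, Rmax_right in ht by lra.
    rewrite first_var_by_parts by (apply ab_I; lra). unfold minus, plus, opp; simpl; ring.
  - replace 0 with (minus 0 0) by (unfold minus, plus, opp; simpl; ring).
    apply (is_RInt_minus (V := R_NormedModule)); auto.
Qed.

End SpecialFrame.

(** * Bump functions and the Euler-Lagrange equation *)

(** With [k = m + 1], the inequality [x / k <= exp (x / k)] is raised to the power [k]. *)
Lemma pow_le_exp m x : 0 < x -> x ^ S m <= INR (S m) ^ S m * exp x.
Proof.
  intros hx. assert (hm : 0 < INR (S m)) by (apply lt_0_INR; lia).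
  assert (E : forall k z, exp (INR k * z) = exp z ^ k).
  { induction k as [|k IH]; intros z.
    - simpl. rewrite Rmult_0_l. apply exp_0.
    - rewrite S_INR, Rmult_plus_distr_r, exp_plus, IH. simpl. rewrite Rmult_1_l. ring. }
  replace x with (INR (S m) * (x / INR (S m))) at 1 2 by (field; lra).
  rewrite Rpow_mult_distr, E. apply Rmult_le_compat_l; [apply pow_le; lra|].
  assert (hz : 0 < x / INR (S m)) by (apply Rdiv_lt_0_compat; auto).
  apply pow_incr. split; [lra|].
  assert (H := exp_ineq1 (x / INR (S m))). lra.
Qed.

(** For [k = 0] the standard flat function. The extra powers of [1 / u] make the linear span of the
    family closed under differentiation. *)
Definition flat (k : nat) (u : R) : R :=
  if Rlt_dec 0 u then (/ u) ^ k * exp (- / u) else 0.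

Lemma flat_pos k u : 0 < u -> flat k u = (/ u) ^ k * exp (- / u).
Proof. intros h. unfold flat. destruct (Rlt_dec 0 u); [auto|lra]. Qed.

Lemma flat_neg k u : u <= 0 -> flat k u = 0.
Proof. intros h. unfold flat. destruct (Rlt_dec 0 u); [lra|auto]. Qed.

Lemma flat_ge0 k u : 0 <= flat k u.
Proof.
  destruct (Rle_dec u 0); [rewrite flat_neg; lra|].
  rewrite flat_pos by lra. apply Rmult_le_pos; [|left; apply exp_pos].
  apply pow_le. left. apply Rinv_0_lt_compat. lra.
Qed.

(** A quadratic bound makes the derivative at 0 vanish; it is [pow_le_exp] at [1 / u] with exponent
    [k + 2], two powers being left over as [u * u]. *)
Lemma flat_le k u : flat k u <= INR (S (S k)) ^ S (S k) * (u * u).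
Proof.
  assert (hC : 0 <= INR (S (S k)) ^ S (S k)) by (apply pow_le, pos_INR).
  destruct (Rle_dec u 0).
  { rewrite flat_neg by auto. apply Rmult_le_pos; auto. apply Rle_0_sqr. }
  rewrite flat_pos by lra. assert (hu : 0 < / u) by (apply Rinv_0_lt_compat; lra).
  assert (H := pow_le_exp (S k) (/ u) hu). rewrite exp_Ropp.
  assert (he := exp_pos (/ u)).
  apply Rmult_le_reg_r with (exp (/ u)); auto.
  apply Rmult_le_reg_r with (/ u * / u); [apply Rmult_lt_0_compat; auto|].
  replace ((/ u) ^ k * / exp (/ u) * exp (/ u) * (/ u * / u)) with ((/ u) ^ S (S k))
    by (simpl; field; lra).
  eapply Rle_trans; [apply H|]. right. field. lra.
Qed.

Lemma is_derive_flat k u : is_derive (flat k) u (flat (S (S k)) u - INR k * flat (S k) u).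
Proof.
  destruct (Rtotal_order u 0) as [h|[h|h]].
  - rewrite !flat_neg by lra. replace (0 - INR k * 0) with 0 by ring.
    apply is_derive_ext_loc with (fun _ => 0); [|apply @is_derive_const].
    apply (filter_imp (fun s => s < 0)); [|apply (open_lt 0 u h)].
    intros s hs. rewrite flat_neg; auto. lra.
  - subst u. rewrite !flat_neg by lra. replace (0 - INR k * 0) with 0 by ring.
    apply is_derive_Reals. intros eps heps.
    set (C := INR (S (S k)) ^ S (S k)).
    assert (hC : 0 <= C) by (apply pow_le, pos_INR).
    assert (hd : 0 < eps / (C + 1)) by (apply Rdiv_lt_0_compat; lra).
    exists (mkposreal _ hd). intros h hh0 hh. simpl in hh.
    rewrite Rplus_0_l, (flat_neg k 0) by lra. rewrite !Rminus_0_r.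
    unfold Rdiv. rewrite Rabs_mult, Rabs_inv, (Rabs_pos_eq (flat k h)) by apply flat_ge0.
    assert (ha : 0 < Rabs h) by (apply Rabs_pos_lt; auto).
    apply Rmult_lt_reg_r with (Rabs h); auto.
    replace (flat k h * / Rabs h * Rabs h) with (flat k h) by (field; lra).
    assert (H := flat_le k h). fold C in H.
    assert (E : h * h = Rabs h * Rabs h) by (rewrite <- Rabs_mult, Rabs_pos_eq; [auto|apply Rle_0_sqr]).
    rewrite E in H.
    assert (H' : Rabs h * (C + 1) < eps).
    { apply Rmult_lt_reg_r with (/ (C + 1)); [apply Rinv_0_lt_compat; lra|].
      replace (Rabs h * (C + 1) * / (C + 1)) with (Rabs h) by (field; lra). exact hh. }
    eapply Rle_lt_trans; [exact H|]. nra.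
  - rewrite !flat_pos by lra.
    apply is_derive_ext_loc with (fun u => (/ u) ^ k * exp (- / u)).
    + apply (filter_imp (fun s => 0 < s)); [|apply (open_gt 0 u h)].
      intros s hs. rewrite flat_pos; auto.
    + auto_derive; [lra|]. destruct k as [|k].
      * simpl. field. lra.
      * rewrite S_INR. simpl. rewrite <- ?S_INR. simpl. field. lra.
Qed.

(** An algebra closed under differentiation, so that one derivative suffices to obtain smoothness of
    all orders. *)
Inductive bump_alg : (R -> R) -> Prop :=
| bump_flat k s r : bump_alg (fun t => flat k (s * t + r))
| bump_plus f g : bump_alg f -> bump_alg g -> bump_alg (fun t => f t + g t)
| bump_scal c f : bump_alg f -> bump_alg (fun t => c * f t)
| bump_mult f g : bump_alg f -> bump_alg g -> bump_alg (fun t => f t * g t).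

Lemma bump_alg_derive f : bump_alg f -> exists f', bump_alg f' /\ forall t, is_derive f t (f' t).
Proof.
  induction 1 as [k s r|f g Hf [f' [Gf Df]] Hg [g' [Gg Dg]]|c f Hf [f' [Gf Df]]
    |f g Hf [f' [Gf Df]] Hg [g' [Gg Dg]]].
  - exists (fun t => s * (flat (S (S k)) (s * t + r) + (- INR k) * flat (S k) (s * t + r))). split.
    + apply bump_scal, bump_plus; [|apply bump_scal]; apply bump_flat.
    + intros t. replace (flat (S (S k)) (s * t + r) + (- INR k) * flat (S k) (s * t + r))
        with (flat (S (S k)) (s * t + r) - INR k * flat (S k) (s * t + r)) by ring.
      apply (is_derive_comp (flat k) (fun t => s * t + r)); [apply is_derive_flat|].
      auto_derive; auto. ring.
  - exists (fun t => f' t + g' t). split; [apply bump_plus; auto|].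
    intros. apply @is_derive_plus; auto.
  - exists (fun t => c * f' t). split; [apply bump_scal; auto|]. intros. apply is_derive_scal; auto.
  - exists (fun t => f' t * g t + f t * g' t). split.
    + apply bump_plus; apply bump_mult; auto.
    + intros. apply is_derive_Rmult; auto.
Qed.

Lemma bump_alg_smooth (I : R -> Prop) f : bump_alg f -> smooth_on I f.
Proof.
  intros H. assert (K : forall k, exists g, bump_alg g /\ forall t, Derive_n f k t = g t).
  { induction k as [|k [g [Gg Eg]]].
    - exists f. auto.
    - destruct (bump_alg_derive g Gg) as (g' & Gg' & D). exists g'. split; auto.
      intros t. simpl. rewrite (Derive_ext _ g) by auto. apply is_derive_unique. auto. }
  exists (fun k t => Derive_n f k t). split; auto. intros k t _.
  destruct (K k) as (g & Gg & Eg). destruct (bump_alg_derive g Gg) as (g' & _ & D).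
  apply is_derive_Reals. simpl. apply Derive_correct.
  exists (g' t). apply is_derive_ext with g; auto.
Qed.

Lemma bump_exists (I : R -> Prop) c d : exists h, smooth_on I h /\
  (forall t, 0 <= h t) /\ (forall t, c < t < d -> 0 < h t) /\
  (forall t, t < c \/ d < t -> h t = 0).
Proof.
  exists (fun t => flat 0 (1 * t + (- c)) * flat 0 ((-1) * t + d)).
  split; [apply bump_alg_smooth; apply bump_mult; apply bump_flat|]. split; [|split].
  - intros. apply Rmult_le_pos; apply flat_ge0.
  - intros t ht. rewrite !flat_pos by lra. simpl.
    apply Rmult_lt_0_compat; rewrite Rmult_1_l; apply exp_pos.
  - intros t [h|h].
    + rewrite (flat_neg 0 (1 * t + - c)) by lra. ring.
    + rewrite (flat_neg 0 (-1 * t + d)) by lra. ring.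
Qed.

Lemma is_RInt_nonneg_zero f a b t0 :
  a < t0 < b -> (forall t, a <= t <= b -> continuous f t) -> (forall t, a <= t <= b -> 0 <= f t) ->
  is_RInt f a b 0 -> f t0 = 0.
Proof.
  intros h0 hc hp H. assert (hf := hp t0 ltac:(lra)).
  destruct (Req_dec (f t0) 0) as [|hne]; auto. exfalso.
  assert (L : locally t0 (fun t => 0 < f t)).
  { apply (hc t0 ltac:(lra) (fun z => 0 < z)). apply (open_gt 0 (f t0)). lra. }
  destruct L as [r Hr]. assert (hr := cond_pos r).
  set (l := Rmax a (t0 - r / 2)). set (u := Rmin b (t0 + r / 2)).
  assert (a <= l /\ t0 - r / 2 <= l) by (split; [apply Rmax_l|apply Rmax_r]).
  assert (u <= b /\ u <= t0 + r / 2) by (split; [apply Rmin_l|apply Rmin_r]).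
  assert (l < t0) by (apply Rmax_lub_lt; lra). assert (t0 < u) by (apply Rmin_glb_lt; lra).
  assert (ex : forall x y, a <= x -> x <= y -> y <= b -> ex_RInt f x y).
  { intros x y hx hxy hy. apply (ex_RInt_continuous f). intros t ht.
    rewrite Rmin_left, Rmax_right in ht by lra. apply hc; lra. }
  assert (P1 : 0 <= RInt f a l) by (apply RInt_ge_0; [lra|apply ex; lra|intros; apply hp; lra]).
  assert (P2 : 0 <= RInt f u b) by (apply RInt_ge_0; [lra|apply ex; lra|intros; apply hp; lra]).
  assert (P3 : 0 < RInt f l u).
  { apply RInt_gt_0; [lra| |].
    - intros t ht. apply Hr. change (Rabs (t - t0) < r). apply Rabs_def1; lra.
    - intros t ht. apply hc; lra. }
  assert (E1 := RInt_Chasles f a l u (ex a l ltac:(lra) ltac:(lra) ltac:(lra))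
     (ex l u ltac:(lra) ltac:(lra) ltac:(lra))).
  assert (E2 := RInt_Chasles f a u b (ex a u ltac:(lra) ltac:(lra) ltac:(lra))
     (ex u b ltac:(lra) ltac:(lra) ltac:(lra))).
  unfold plus in E1, E2. simpl in E1, E2. rewrite (is_RInt_unique _ _ _ _ H) in E2. lra.
Qed.

Lemma euler_lagrange n I F e phi :
  (3 <= n)%nat -> is_open_interval I -> curve n I F -> conformal_geodesic n I F ->
  special_third_order_frame n I F e phi -> (forall t, I t -> 0 < phi t 1%nat 0%nat) ->
  forall t A, I t -> (1 <= A <= n)%nat -> ELcomp n phi A t = 0.
Proof.
  intros hn hI hF hG hS hv t0 A0 It0 HA0.
  destruct hI as (hI1 & hI2 & hI3). assert (hI : is_open_interval I) by (repeat split; auto).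
  destruct (hI3 t0 It0) as (r & hr & Hr).
  set (a := t0 - r / 2). set (b := t0 + r / 2).
  assert (ab_I : forall t, a <= t <= b -> I t).
  { intros t ht. apply Hr. apply Rabs_def1; unfold a, b in ht; lra. }
  assert (hab : a < b) by (unfold a, b; lra).
  assert (Ia : I a) by (apply ab_I; lra). assert (Ib : I b) by (apply ab_I; lra).
  destruct (bump_exists I (t0 - r / 4) (t0 + r / 4)) as (h & hs & hp & hpos & hz).
  (* These functions do not involve [eps], so membership is established with the provisional value
     [delta = 1]; the actual [delta] depends on a bound for the section [y] built from them. *)
  assert (GE : forall A, (1 <= A <= n)%nat -> Gen I a b 1 (fun _ t => ELcomp n phi A t)).
  { intros A HA. apply (Gen_ELcomp n I F e phi hn hI hS a b 1); auto; lra. }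
  assert (Gphi : forall i j, (i <= S n)%nat -> (j <= S n)%nat -> Gen I a b 1 (fun _ t => phi t i j)).
  { intros. apply (Gen_phi' n I F e phi); auto. }
  assert (Gh : Gen I a b 1 (fun _ t => h t)) by (apply Gen_smooth; auto).
  set (y := fun A t => if theta_index n A then h t * ELcomp n phi A t else 0).
  assert (Gy : forall A, Gen I a b 1 (fun _ t => y A t)).
  { intros A. unfold y. destruct (theta_index n A) eqn:E; [|apply Gen_const].
    apply Gen_mult; auto. apply GE. unfold theta_index in E. apply andb_prop in E.
    destruct E as [E1 E2]. apply Nat.leb_le in E1, E2. lia. }
  assert (ys : forall A, smooth_on I (y A)).
  { intros A. apply (Gen_smooth_on I a b 1 hI (fun _ t => y A t) 0); auto. lra. }
  assert (yo : forall A t, t < t0 - r / 4 \/ t0 + r / 4 < t -> y A t = 0).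
  { intros A t ht. unfold y. destruct (theta_index n A); auto. rewrite hz by auto. ring. }
  (* Divided by [v], the condition [y_small] says that [eps^2] times this function is at least
     -1. *)
  assert (Gk : Gen I a b 1 (fun _ t => phi t 0%nat 1%nat * (ynorm n y t * / phi t 1%nat 0%nat))).
  { apply Gen_mult; [apply Gphi; lia|]. apply Gen_mult.
    - unfold ynorm. apply (Gen_ssum I a b 1 n (fun A _ t => y A t * y A t)).
      intros; apply Gen_mult; auto.
    - apply (Gen_vinv n I F e phi hn hI hS a b 1); auto. lra. }
  destruct (Gen_bounded I a b 1 ab_I _ Gk) as (C & hC & HC).
  (* Then [delta^2 C <= 1] for every [C >= 0]. Outside [[a, b]] the section vanishes and the
     condition reduces to [v / 2 <= v]. *)
  set (delta := / (C + 1)).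
  assert (hd : 0 < delta) by (apply Rinv_0_lt_compat; lra).
  assert (hdC : delta * (C + 1) = 1) by (unfold delta; field; lra).
  assert (small : forall x t, - delta < x < delta -> I t ->
    phi t 1%nat 0%nat / 2 <= phi t 1%nat 0%nat + x * x * (phi t 0%nat 1%nat * (ynorm n y t / 2))).
  { intros x t hx ht. assert (hvt := hv t ht).
    destruct (Rle_dec a t) as [h1|h1]; [destruct (Rle_dec t b) as [h2|h2]|].
    - assert (K := HC 0 t ltac:(lra) (conj h1 h2)).
      set (k := phi t 0%nat 1%nat * (ynorm n y t * / phi t 1%nat 0%nat)) in *.
      replace (phi t 0%nat 1%nat * (ynorm n y t / 2)) with (k * (phi t 1%nat 0%nat / 2))
        by (unfold k; field; lra).
      assert (hxx : x * x <= delta * delta) by nra.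
      assert (hk : - C <= k) by (apply Rabs_le_between in K; lra).
      assert (x * x * C <= 1).
      { apply Rle_trans with (delta * delta * C); [apply Rmult_le_compat_r; auto|]. nra. }
      assert (0 <= x * x) by nra.
      assert (- 1 <= x * x * k) by nra. nra.
    - unfold ynorm. rewrite (ssum_zero n) by (intros; rewrite yo by (unfold b in h2; lra); ring). lra.
    - unfold ynorm. rewrite (ssum_zero n) by (intros; rewrite yo by (unfold a in h1; lra); ring). lra. }
  assert (R0 := RInt_ELcomp n I F e phi hn hI hS a b delta ab_I hv hd Ia Ib hab y ys).
  specialize (R0 ltac:(intros A t hA; unfold y; rewrite theta_index_false; auto) small hF
    (t0 - r / 4) (t0 + r / 4) ltac:(unfold a, b; lra) yo hG).
  assert (E : forall A t, y A t * ELcomp n phi A t = h t * (ELcomp n phi A t * ELcomp n phi A t)).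
  { intros A t. unfold y. destruct (theta_index n A) eqn:E; [ring|].
    unfold ELcomp. rewrite E. ring. }
  assert (Z : ssum n (fun A => y A t0 * ELcomp n phi A t0) = 0).
  { apply (is_RInt_nonneg_zero (fun t => ssum n (fun A => y A t * ELcomp n phi A t)) a b t0); auto.
    - unfold a, b; lra.
    - intros t ht. apply (Gen_continuous I hI a b 1
        (fun _ t => ssum n (fun A => y A t * ELcomp n phi A t)) 0); auto; [|lra].
      apply (Gen_ssum I a b 1 n (fun A _ t => y A t * ELcomp n phi A t)).
      intros; apply Gen_mult; auto.
    - intros t ht. apply rsum_nonneg. intros k hk. rewrite E.
      apply Rmult_le_pos; auto. apply Rle_0_sqr. }
  rewrite (ssum_ext n _ (fun A => h t0 * (ELcomp n phi A t0 * ELcomp n phi A t0))), ssum_scal in Z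
    by (intros; apply E).
  assert (h0 := hpos t0 ltac:(lra)).
  apply Rmult_integral in Z. destruct Z as [Z|Z]; [lra|].
  assert (W := rsum_nonneg_zero n _ (fun i _ => Rle_0_sqr (ELcomp n phi (S i) t0)) Z (A0 - 1) ltac:(lia)).
  cbv beta in W. replace (S (A0 - 1)) with A0 in W by lia. apply Rsqr_0_uniq. exact W.
Qed.

(** * Linear systems and Lorentzian spans *)

(** The argument of Gronwall: the sum of squares [E] satisfies [|E'| <= L E], so it cannot leave 0
    in either direction of time. *)
Lemma linear_ode_zero N (f : nat -> R -> R) (M : nat -> nat -> R -> R) a b K t0 t1 :
  0 <= K -> a <= t0 <= b -> a <= t1 <= b ->
  (forall i t, (i < N)%nat -> a <= t <= b ->
     is_derive (f i) t (rsum N (fun j => M i j t * f j t))) ->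
  (forall i j t, (i < N)%nat -> (j < N)%nat -> a <= t <= b -> Rabs (M i j t) <= K) ->
  (forall i, (i < N)%nat -> f i t0 = 0) ->
  forall i, (i < N)%nat -> f i t1 = 0.
Proof.
  intros hK h0 h1 hD hM hf.
  set (E := fun t => rsum N (fun i => f i t * f i t)).
  set (E' := fun t => rsum N (fun i => 2 * (f i t * rsum N (fun j => M i j t * f j t)))).
  assert (DE : forall t, a <= t <= b -> is_derive E t (E' t)).
  { intros t ht. apply (is_derive_rsum N (fun i t => f i t * f i t)). intros i Hi.
    replace (2 * (f i t * rsum N (fun j => M i j t * f j t))) with
      (rsum N (fun j => M i j t * f j t) * f i t + f i t * rsum N (fun j => M i j t * f j t)) by ring.
    apply is_derive_Rmult; apply hD; auto. }
  assert (rsum_le : forall k g g', (forall i, (i < k)%nat -> g i <= g' i) -> rsum k g <= rsum k g').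
  { intros k g g' H. assert (0 <= rsum k (fun i => g' i - g i)).
    { apply rsum_nonneg. intros i Hi. assert (h := H i Hi). lra. }
    rewrite rsum_minus in H0. lra. }
  (* Each product satisfies [2 |M_ij f_i f_j| <= K (f_i^2 + f_j^2)]; summing over [i] and [j] gives
     [2 N K E]. *)
  set (L := 2 * INR N * K).
  assert (rsum_const : forall k c, rsum k (fun _ => c) = INR k * c).
  { induction k as [|k IH]; intros c; simpl rsum; [simpl; ring|]. rewrite IH, S_INR. ring. }
  assert (BE : forall t s, a <= t <= b -> s * s = 1 -> s * E' t <= L * E t).
  { intros t s ht hs. unfold E'. rewrite <- rsum_scal.
    apply Rle_trans with (rsum N (fun i => rsum N (fun j => K * (f i t * f i t) + K * (f j t * f j t)))).
    - apply rsum_le. intros i Hi.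
      replace (s * (2 * (f i t * rsum N (fun j => M i j t * f j t)))) with
        (rsum N (fun j => (2 * s * f i t) * (M i j t * f j t))) by (rewrite rsum_scal; ring).
      apply rsum_le. intros j Hj. assert (hm := hM i j t Hi Hj ht).
      apply Rle_trans with (Rabs (2 * s * f i t * (M i j t * f j t))); [apply Rle_abs|].
      replace (2 * s * f i t * (M i j t * f j t)) with (M i j t * (2 * s * (f i t * f j t))) by ring.
      rewrite Rabs_mult.
      apply Rle_trans with (K * Rabs (2 * s * (f i t * f j t))).
      + apply Rmult_le_compat_r; [apply Rabs_pos|auto].
      + rewrite <- Rmult_plus_distr_l. apply Rmult_le_compat_l; auto.
        assert (q1 := Rle_0_sqr (s * f i t - f j t)). assert (q2 := Rle_0_sqr (s * f i t + f j t)).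
        unfold Rsqr in q1, q2.
        assert (e : s * f i t * (s * f i t) = f i t * f i t)
          by (replace (s * f i t * (s * f i t)) with ((s * s) * (f i t * f i t)) by ring; rewrite hs; ring).
        apply Rabs_le. lra.
    - right. unfold E, L.
      rewrite (rsum_ext N _ (fun i => (INR N * K) * (f i t * f i t) + K * rsum N (fun j => f j t * f j t))).
      + rewrite rsum_plus, rsum_scal, rsum_const. ring.
      + intros i Hi. rewrite rsum_plus, rsum_const, rsum_scal. ring. }
  assert (E0 : E t0 = 0) by (apply rsum_zero; intros; rewrite hf by auto; ring).
  assert (Ep : forall t, 0 <= E t) by (intros; apply rsum_nonneg; intros; apply Rle_0_sqr).
  assert (E1 : E t1 = 0).
  (* The sign [s] treats both directions at once: [s] times the derivative of [E exp (- L s t)] is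
     nonpositive, hence its value at [t1] is at most the value 0 at [t0]. *)
  { set (s := if Rle_dec t0 t1 then 1 else -1).
    assert (hs : s * s = 1) by (unfold s; destruct (Rle_dec t0 t1); ring).
    set (G := fun t => E t * exp (- (L * s * t))).
    set (G' := fun t => (E' t - L * s * E t) * exp (- (L * s * t))).
    assert (DG : forall t, a <= t <= b -> is_derive G t (G' t)).
    { intros t ht. unfold G'.
      replace ((E' t - L * s * E t) * exp (- (L * s * t))) with
        (E' t * exp (- (L * s * t)) + E t * (- (L * s) * exp (- (L * s * t)))) by ring.
      apply (is_derive_Rmult E (fun t => exp (- (L * s * t)))); auto.
      auto_derive; auto. ring. }
    assert (GE : G t1 <= G t0).
    { destruct (MVT_gen G t0 t1 G') as (m & hm & Hm).
      - intros t ht. apply DG. split; [apply Rle_trans with (Rmin t0 t1)|apply Rle_trans with (Rmax t0 t1)];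
          try lra; [apply Rmin_glb|apply Rmax_lub]; lra.
      - intros t ht. apply derivable_continuous_pt. exists (G' t). apply is_derive_Reals, DG.
        split; [apply Rle_trans with (Rmin t0 t1)|apply Rle_trans with (Rmax t0 t1)];
          try lra; [apply Rmin_glb|apply Rmax_lub]; lra.
      - assert (hm' : a <= m <= b).
        { split; [apply Rle_trans with (Rmin t0 t1)|apply Rle_trans with (Rmax t0 t1)];
          try lra; [apply Rmin_glb|apply Rmax_lub]; lra. }
        assert (B := BE m s hm' hs). assert (ex := exp_pos (- (L * s * m))).
        assert (C : s * G' m <= 0).
        { unfold G'. replace (s * ((E' m - L * s * E m) * exp (- (L * s * m)))) with
            ((s * E' m - (s * s) * (L * E m)) * exp (- (L * s * m))) by ring.
          rewrite hs. assert (0 <= (L * E m - s * E' m) * exp (- (L * s * m)))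
            by (apply Rmult_le_pos; lra). lra. }
        unfold s in C. destruct (Rle_dec t0 t1).
        + assert (0 <= - G' m * (t1 - t0)) by (apply Rmult_le_pos; lra). lra.
        + assert (0 <= G' m * (t0 - t1)) by (apply Rmult_le_pos; lra). lra. }
    unfold G in GE. rewrite E0, Rmult_0_l in GE. assert (ex := exp_pos (- (L * s * t1))).
    assert (h := Ep t1). destruct h as [h|h]; [|auto].
    assert (0 < E t1 * exp (- (L * s * t1))) by (apply Rmult_lt_0_compat; auto). lra. }
  intros i Hi.
  assert (Z := rsum_nonneg_zero N _ (fun i _ => Rle_0_sqr (f i t1)) E1 i Hi).
  apply Rsqr_0_uniq. exact Z.
Qed.

(** * Spans and the projection onto a Lorentzian span *)

Local Notation vnth k L := (nth k L (fun _ => 0 : R)).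

Lemma lincomb_rsum (L : list vec) : forall cs i, length cs = length L ->
  lincomb cs L i = rsum (length L) (fun k => nth k cs 0 * vnth k L i).
Proof.
  induction L as [|w L IH]; intros [|c cs] i H; simpl in H; try discriminate; [reflexivity|].
  change (lincomb (c :: cs) (w :: L) i) with (c * w i + lincomb cs L i).
  rewrite IH by congruence. simpl length. rewrite rsum_first. reflexivity.
Qed.

Lemma in_span_iff n L v : in_span n L v <->
  exists c : nat -> R, forall i, (i <= S n)%nat -> v i = rsum (length L) (fun k => c k * vnth k L i).
Proof.
  split.
  - intros (cs & hl & H). exists (fun k => nth k cs 0). intros i Hi. rewrite H by auto.
    apply lincomb_rsum; auto.
  - intros (c & H). exists (map c (List.seq 0 (length L))).
    assert (hl : length (map c (List.seq 0 (length L))) = length L)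
      by (rewrite length_map, length_seq; auto).
    split; [exact hl|]. intros i Hi. rewrite lincomb_rsum, H by auto.
    apply rsum_ext. intros k Hk. f_equal.
    rewrite (nth_indep _ 0 (c 0%nat)) by (rewrite length_map, length_seq; auto).
    rewrite map_nth, seq_nth by auto. reflexivity.
Qed.

Lemma in_span_ext n L v v' : (forall i, (i <= S n)%nat -> v i = v' i) -> in_span n L v -> in_span n L v'.
Proof. intros E (cs & hl & H). exists cs. split; auto. intros. rewrite <- E; auto. Qed.

Lemma in_span_plus n L v w : in_span n L v -> in_span n L w -> in_span n L (fun i => v i + w i).
Proof.
  rewrite !in_span_iff. intros [c Hc] [d Hd]. exists (fun k => c k + d k). intros i Hi.
  rewrite Hc, Hd, <- rsum_plus by auto. apply rsum_ext; intros; ring.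
Qed.

Lemma in_span_scal n L x v : in_span n L v -> in_span n L (fun i => x * v i).
Proof.
  rewrite !in_span_iff. intros [c Hc]. exists (fun k => x * c k). intros i Hi.
  rewrite Hc, <- rsum_scal by auto. apply rsum_ext; intros; ring.
Qed.

Lemma in_span_rsum n L k (c : nat -> R) (f : nat -> vec) :
  (forall j, (j < k)%nat -> in_span n L (f j)) ->
  in_span n L (fun i => rsum k (fun j => c j * f j i)).
Proof.
  induction k as [|k IH]; intros H; simpl.
  - rewrite in_span_iff. exists (fun _ => 0). intros. rewrite rsum_scal. ring.
  - apply (in_span_plus n L (fun i => rsum k (fun j => c j * f j i)) (fun i => c k * f k i)); auto.
    apply in_span_scal; auto.
Qed.

Lemma in_span_nth n L k : (k < length L)%nat -> in_span n L (vnth k L).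
Proof.
  intros Hk. apply in_span_iff. exists (fun j => if Nat.eqb j k then 1 else 0). intros i Hi.
  rewrite (rsum_single _ k); auto.
  - rewrite Nat.eqb_refl. ring.
  - intros j Hj h. rewrite (proj2 (Nat.eqb_neq j k) h). ring.
Qed.

Lemma in_span_In n L v : In v L -> in_span n L v.
Proof.
  intros H. destruct (In_nth L v (fun _ => 0) H) as (k & Hk & E). rewrite <- E.
  apply in_span_nth; auto.
Qed.

Lemma in_span_trans n L L' v :
  (forall w, In w L -> in_span n L' w) -> in_span n L v -> in_span n L' v.
Proof.
  intros H Hv. apply in_span_iff in Hv. destruct Hv as [c Hc].
  apply in_span_ext with (fun i => rsum (length L) (fun k => c k * vnth k L i)).
  - intros; symmetry; auto.
  - apply in_span_rsum. intros j Hj. apply H. apply nth_In; auto.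
Qed.

Lemma in_span_map_comb n M L v : in_span n L v -> in_span n (map (comb n M) L) (comb n M v).
Proof.
  rewrite !in_span_iff, length_map. intros [c Hc]. exists c. intros i Hi.
  rewrite (comb_ext n M v (fun j => rsum (length L) (fun k => c k * vnth k L j))) by (intros; apply Hc; auto).
  rewrite (comb_rsum n M (length L) (fun k j => c k * vnth k L j)).
  apply rsum_ext. intros k Hk. rewrite comb_scal. f_equal.
  rewrite (nth_indep (map (comb n M) L) _ (comb n M (fun _ => 0))) by (rewrite length_map; auto).
  rewrite map_nth. reflexivity.
Qed.

Lemma lorentz_basis_map_comb n M W :
  isometry n M -> lorentz_basis n W -> lorentz_basis n (map (comb n M) W).
Proof.
  intros HM [hn H]. split.
  - destruct W; [congruence|discriminate].
  - rewrite length_map. intros k l Hk Hl. rewrite <- H by auto.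
    rewrite (nth_indep (map (comb n M) W) (n := k) _ (comb n M (fun _ => 0))) by (rewrite length_map; auto).
    rewrite (nth_indep (map (comb n M) W) (fun _ => 0) (comb n M (fun _ => 0))) by (rewrite length_map; auto).
    rewrite !map_nth. apply mink_comb_iso; auto.
Qed.

Lemma lorentz_basis_snoc n W z :
  lorentz_basis n W -> mink n z z = 1 -> (forall w, In w W -> mink n w z = 0) ->
  lorentz_basis n (W ++ z :: nil).
Proof.
  intros [hn H] hz ho. split; [destruct W; discriminate|].
  assert (hW : (0 < length W)%nat) by (destruct W; [congruence|simpl; lia]).
  rewrite length_app. simpl length. intros k l Hk Hl.
  assert (N1 : forall k, (k < length W)%nat -> vnth k (W ++ z :: nil) = vnth k W)
    by (intros; apply app_nth1; auto).
  assert (N2 : vnth (length W) (W ++ z :: nil) = z).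
  { rewrite app_nth2, Nat.sub_diag by lia. reflexivity. }
  destruct (Nat.eq_dec k (length W)) as [->|hk]; destruct (Nat.eq_dec l (length W)) as [->|hl'].
  - rewrite N2, Nat.eqb_refl, (proj2 (Nat.eqb_neq _ 0)) by lia. auto.
  - rewrite N2, N1, (proj2 (Nat.eqb_neq (length W) l)) by lia. rewrite mink_sym.
    apply ho. apply nth_In. lia.
  - rewrite N2, N1, (proj2 (Nat.eqb_neq k (length W))) by lia. apply ho. apply nth_In. lia.
  - rewrite !N1 by lia. apply H; lia.
Qed.

Definition lorentz_sign (k : nat) : R := if Nat.eqb k 0 then -1 else 1.

(** Orthogonal projection onto the span of a Lorentz basis [W]; the sign corrects for its time-like
    first vector. *)
Definition lproj (n : nat) (W : list vec) (v : vec) : vec := fun i =>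
  rsum (length W) (fun k => lorentz_sign k * mink n (vnth k W) v * vnth k W i).

Lemma lproj_orth n W v k : lorentz_basis n W -> (k < length W)%nat ->
  mink n (vnth k W) (fun i => v i - lproj n W v i) = 0.
Proof.
  intros [_ H] Hk. rewrite mink_minus_r. unfold lproj.
  rewrite (mink_sym n (vnth k W) (fun i => rsum _ _)).
  rewrite (mink_comb n (length W) (fun k => lorentz_sign k * mink n (vnth k W) v) (fun k => vnth k W)).
  rewrite (rsum_single _ k); auto.
  - rewrite H, Nat.eqb_refl by auto. unfold lorentz_sign. destruct (Nat.eqb k 0); ring.
  - intros j Hj h. rewrite H, (proj2 (Nat.eqb_neq j k) h) by auto. ring.
Qed.

Lemma lproj_selfadjoint n W u v :
  mink n (fun i => v i - lproj n W v i) u = mink n v (fun i => u i - lproj n W u i).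
Proof.
  rewrite mink_minus, mink_minus_r. f_equal. unfold lproj.
  rewrite (mink_sym n v (fun i => rsum _ _)).
  rewrite (mink_comb n (length W) (fun k => lorentz_sign k * mink n (vnth k W) v) (fun k => vnth k W)).
  rewrite (mink_comb n (length W) (fun k => lorentz_sign k * mink n (vnth k W) u) (fun k => vnth k W)).
  apply rsum_ext; intros; ring.
Qed.

Lemma mink_nondegenerate n r : (forall u, mink n r u = 0) -> forall i, (i <= S n)%nat -> r i = 0.
Proof.
  intros H i Hi. assert (h : (i = 0 \/ i = S n \/ 1 <= i <= n)%nat) by lia.
  destruct h as [->|[->|h]].
  - assert (K := H (unitv (S n))). rewrite mink_unitvS in K. lra.
  - assert (K := H (unitv 0)). rewrite mink_unitv0 in K. lra.
  - rewrite <- (mink_unitv n r i h). auto.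
Qed.

(** The projection is self-adjoint, so the residual of [v] paired with any [u] equals [v] paired
    with the residual of [u], which is orthogonal to [W]. Hence the residual of [v] is orthogonal to
    everything, and the form is nondegenerate. *)
Lemma in_span_double_orth n W v :
  lorentz_basis n W ->
  (forall u, (forall w, In w W -> mink n w u = 0) -> mink n v u = 0) ->
  in_span n W v.
Proof.
  intros HW H. apply in_span_ext with (lproj n W v).
  - intros i Hi. assert (v i - lproj n W v i = 0); [|lra].
    apply (mink_nondegenerate n (fun i => v i - lproj n W v i)); auto.
    intros u. rewrite lproj_selfadjoint. apply H. intros w Hw.
    destruct (In_nth W w (fun _ => 0) Hw) as (k & Hk & E). rewrite <- E.
    apply lproj_orth; auto.
  - apply (in_span_rsum n W (length W) (fun k => lorentz_sign k * mink n (vnth k W) v) (fun k => vnth k W)).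
    intros. apply in_span_nth; auto.
Qed.

(** * A Lorentz basis of [V] by orthonormalization *)

Definition theta_type (n : nat) (z : vec) : Prop :=
  forall i, (i <= S n)%nat -> ~ (3 <= i <= n)%nat -> z i = 0.

Lemma theta_type_mink n z w : (2 <= n)%nat -> theta_type n z -> mink n z w = sumTheta n (fun A => z A * w A).
Proof.
  intros hn H. rewrite mink_ssum, ssum_first2, !H by lia. ring.
Qed.

Lemma theta_type_null n z : (2 <= n)%nat -> theta_type n z ->
  0 <= mink n z z /\ (mink n z z = 0 -> forall i, (i <= S n)%nat -> z i = 0).
Proof.
  intros hn H. rewrite theta_type_mink by auto. split.
  - apply rsum_nonneg. intros; apply Rle_0_sqr.
  - intros E i Hi. destruct (Nat.le_gt_cases 3 i); [|apply H; lia].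
    destruct (Nat.eq_dec i (S n)) as [->|]; [apply H; lia|].
    assert (Z := rsum_nonneg_zero (n - 2) _ (fun k _ => Rle_0_sqr (z (k + 3)%nat)) E (i - 3) ltac:(lia)).
    cbv beta in Z. replace (i - 3 + 3)%nat with i in Z by lia. apply Rsqr_0_uniq; auto.
Qed.

(** Since [<e_0, e_(n+1)> = -1], the normalized sum of these null vectors has square -1 and their
    normalized difference has square 1. *)
Definition lorentz_base (n : nat) : list vec :=
  (fun i => / sqrt 2 * (unitv 0 i + unitv (S n) i)) ::
  (fun i => / sqrt 2 * (unitv 0 i - unitv (S n) i)) :: unitv 1 :: unitv 2 :: nil.

Lemma sqrt2_inv : / sqrt 2 * / sqrt 2 = / 2.
Proof. rewrite <- Rinv_mult, sqrt_sqrt by lra. reflexivity. Qed.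

Lemma lorentz_base_basis n : (2 <= n)%nat -> lorentz_basis n (lorentz_base n).
Proof.
  intros hn. split; [discriminate|]. assert (s := sqrt2_inv).
  destruct (nullframe_unit n) as [pp qq pq pB qB BB _].
  assert (Sp : mink n (unitv (S n)) (unitv 0) = -1) by (rewrite mink_sym; auto).
  assert (Ap : forall A, (1 <= A <= n)%nat -> mink n (unitv A) (unitv 0) = 0)
    by (intros; rewrite mink_sym; auto).
  assert (Aq : forall A, (1 <= A <= n)%nat -> mink n (unitv A) (unitv (S n)) = 0)
    by (intros; rewrite mink_sym; auto).
  simpl length.
  intros [|[|[|[|k]]]] [|[|[|[|l]]]] Hk Hl; try lia; simpl;
    rewrite ?mink_scal, ?mink_scal_r, ?mink_plus, ?mink_minus, ?mink_plus_r, ?mink_minus_r,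
      ?pp, ?qq, ?pq, ?Sp, ?pB, ?qB, ?BB, ?Ap, ?Aq by lia; simpl; try ring.
  - replace (/ sqrt 2 * (/ sqrt 2 * (0 + -1 + (-1 + 0)))) with (-2 * (/ sqrt 2 * / sqrt 2)) by ring.
    rewrite s. lra.
  - replace (/ sqrt 2 * (/ sqrt 2 * (0 - -1 - (-1 - 0)))) with (2 * (/ sqrt 2 * / sqrt 2)) by ring.
    rewrite s. lra.
Qed.

Lemma lorentz_base_span n L : In (unitv 0) L -> In (unitv (S n)) L -> In (unitv 1) L -> In (unitv 2) L ->
  forall w, In w (lorentz_base n) -> in_span n L w.
Proof.
  intros H0 HS H1 H2 w [<-|[<-|[<-|[<-|[]]]]]; try (apply in_span_In; auto; fail).
  - apply in_span_scal. apply in_span_plus; apply in_span_In; auto.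
  - apply in_span_scal. apply in_span_ext with (fun i => unitv 0 i + (-1) * unitv (S n) i); [intros; ring|].
    apply in_span_plus; [|apply in_span_scal]; apply in_span_In; auto.
Qed.

Lemma lorentz_base_gens n W : (forall w, In w (lorentz_base n) -> In w W) ->
  in_span n W (unitv 0) /\ in_span n W (unitv (S n)) /\ in_span n W (unitv 1) /\ in_span n W (unitv 2).
Proof.
  intros H. assert (s := sqrt2_inv).
  assert (h2 : sqrt 2 <> 0) by (apply Rgt_not_eq, sqrt_lt_R0; lra).
  assert (Hp := in_span_In n W _ (H _ (or_introl eq_refl))).
  assert (Hm := in_span_In n W _ (H _ (or_intror (or_introl eq_refl)))).
  repeat split.
  - apply in_span_ext with (fun i => / sqrt 2 * (/ sqrt 2 * (unitv 0 i + unitv (S n) i))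
      + / sqrt 2 * (/ sqrt 2 * (unitv 0 i - unitv (S n) i))).
    + intros i _. replace (/ sqrt 2 * (/ sqrt 2 * (unitv 0 i + unitv (S n) i))
      + / sqrt 2 * (/ sqrt 2 * (unitv 0 i - unitv (S n) i))) with
       ((/ sqrt 2 * / sqrt 2) * (2 * unitv 0 i)) by ring. rewrite s. field.
    + apply in_span_plus; apply (in_span_scal n W (/ sqrt 2)); auto.
  - apply in_span_ext with (fun i => / sqrt 2 * (/ sqrt 2 * (unitv 0 i + unitv (S n) i))
      + (- / sqrt 2) * (/ sqrt 2 * (unitv 0 i - unitv (S n) i))).
    + intros i _. replace (/ sqrt 2 * (/ sqrt 2 * (unitv 0 i + unitv (S n) i))
      + (- / sqrt 2) * (/ sqrt 2 * (unitv 0 i - unitv (S n) i))) with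
       ((/ sqrt 2 * / sqrt 2) * (2 * unitv (S n) i)) by ring. rewrite s. field.
    + apply in_span_plus; [apply (in_span_scal n W (/ sqrt 2)); auto|apply (in_span_scal n W (- / sqrt 2)); auto].
  - apply in_span_In, H. simpl. auto.
  - apply in_span_In, H. simpl. auto.
Qed.

(** A Gram-Schmidt step: [z] is normalized and appended unless it vanishes. *)
Lemma lorentz_extend n W z : (2 <= n)%nat ->
  lorentz_basis n W -> theta_type n z -> (forall w, In w W -> mink n w z = 0) ->
  exists W', lorentz_basis n W' /\ (forall w, In w W -> In w W') /\
    (length W' <= S (length W))%nat /\ (length W <= length W')%nat /\ in_span n W' z /\
    forall w, In w W' -> In w W \/ exists k, w = (fun i => k * z i).
Proof.
  intros hn HW Hz Ho. destruct (theta_type_null n z hn Hz) as [H0 H1].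
  destruct (Req_dec (mink n z z) 0) as [E|E].
  - exists W. repeat split; auto; try apply HW.
    apply in_span_iff. exists (fun _ => 0). intros i Hi. rewrite H1, rsum_scal by auto. ring.
  - assert (hs : 0 < sqrt (mink n z z)) by (apply sqrt_lt_R0; lra).
    set (k := / sqrt (mink n z z)).
    exists (W ++ (fun i => k * z i) :: nil). split; [|split; [|split; [|split; [|split]]]].
    + apply lorentz_basis_snoc; auto.
      * rewrite mink_scal, mink_scal_r. unfold k.
        rewrite <- (sqrt_sqrt (mink n z z)) at 3 by lra. field. lra.
      * intros w Hw. rewrite mink_scal_r, Ho by auto. ring.
    + intros w Hw. apply in_or_app. auto.
    + rewrite length_app. simpl. lia.
    + rewrite length_app. lia.
    + apply in_span_ext with (fun i => / k * (k * z i)).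
      * intros i _. unfold k. field. lra.
      * apply (in_span_scal n _ (/ k) (fun i => k * z i)). apply in_span_In. apply in_or_app. simpl. auto.
    + intros w Hw. apply in_app_or in Hw. destruct Hw as [Hw|[<-|[]]]; eauto.
Qed.

Ltac in_list := repeat (first [left; reflexivity | right]).

(** The span of [e_0, e_1, e_2, e_(n+1)] is already Lorentzian of dimension 4, and its orthogonal
    complement contains [Theta], on which the form is positive definite. Each of [q] and [p]
    therefore adds at most one space-like vector. *)
Lemma lorentz_span_exists n q p : (2 <= n)%nat -> theta_type n q -> theta_type n p ->
  exists W, (4 <= length W <= 6)%nat /\ lorentz_basis n W /\
    (forall w, In w (unitv 0 :: unitv 1 :: unitv 2 :: unitv (S n) :: q :: p :: nil) -> in_span n W w) /\
    (forall w, In w W -> in_span n (unitv 0 :: unitv 1 :: unitv 2 :: unitv (S n) :: q :: p :: nil) w).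
Proof.
  intros hn Hq Hp. set (L := unitv 0 :: unitv 1 :: unitv 2 :: unitv (S n) :: q :: p :: nil).
  assert (base_orth : forall z, theta_type n z -> forall w, In w (lorentz_base n) -> mink n w z = 0).
  { intros z Hz w Hw. rewrite mink_sym, theta_type_mink by auto. apply rsum_zero.
    intros k Hk. destruct Hw as [<-|[<-|[<-|[<-|[]]]]]; rewrite !unitv_diff by lia; ring. }
  destruct (lorentz_extend n (lorentz_base n) q hn (lorentz_base_basis n hn) Hq (base_orth q Hq))
    as (W1 & B1 & I1 & U1 & L1 & S1 & M1).
  set (p' := fun i => p i - lproj n W1 p i).
  (* Only a multiple of [q] can have a nonzero product with [p], so subtracting the projection
     leaves [p'] in [Theta]. *)
  assert (w1type : forall w, In w W1 -> mink n w p <> 0 -> theta_type n w).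
  { intros w Hw h. destruct (M1 w Hw) as [Hb|(k & ->)].
    - exfalso. apply h. apply base_orth; auto.
    - intros i Hi h'. rewrite Hq by auto. ring. }
  assert (Hp' : theta_type n p').
  { intros i Hi h. unfold p', lproj. rewrite Hp, rsum_zero; auto; [ring|].
    intros k Hk. destruct (Req_dec (mink n (vnth k W1) p) 0) as [E|E]; [rewrite E; ring|].
    rewrite (w1type (vnth k W1)); auto; [ring|]. apply nth_In; auto. }
  destruct (lorentz_extend n W1 p' hn B1 Hp') as (W2 & B2 & I2 & U2 & L2 & S2 & M2).
  { intros w Hw. destruct (In_nth W1 w (fun _ => 0) Hw) as (k & Hk & E). rewrite <- E.
    apply lproj_orth; auto. }
  assert (pr : forall L', (forall w, In w W1 -> in_span n L' w) -> in_span n L' (lproj n W1 p)).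
  { intros L' H'. apply (in_span_rsum n L' (length W1) (fun k => lorentz_sign k * mink n (vnth k W1) p)
      (fun k => vnth k W1)). intros. apply H'. apply nth_In; auto. }
  assert (LB : forall w, In w (lorentz_base n) -> in_span n L w)
    by (apply lorentz_base_span; unfold L; in_list).
  assert (LW1 : forall w, In w W1 -> in_span n L w).
  { intros w Hw. destruct (M1 w Hw) as [Hb|(k & ->)]; auto.
    apply in_span_scal. apply in_span_In. unfold L; in_list. }
  destruct (lorentz_base_gens n W2) as (G0 & GS & G1 & G2); [auto|].
  exists W2. split; [|split; [auto|split]].
  - change (length (lorentz_base n)) with 4%nat in *. lia.
  - intros w [<-|[<-|[<-|[<-|[<-|[<-|[]]]]]]]; auto.
    + apply in_span_trans with W1; auto. intros. apply in_span_In; auto.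
    + apply in_span_ext with (fun i => p' i + lproj n W1 p i); [intros; unfold p'; ring|].
      apply in_span_plus; auto. apply pr. intros. apply in_span_In; auto.
  - intros w Hw. destruct (M2 w Hw) as [Hw1|(k & ->)]; auto.
    apply in_span_scal. apply in_span_ext with (fun i => p i + (-1) * lproj n W1 p i);
      [intros; unfold p'; ring|].
    apply in_span_plus; [apply in_span_In; unfold L; in_list|]. apply in_span_scal. auto.
Qed.

(** * Constancy of the span *)

Lemma finite_bound k (P : nat -> R -> Prop) :
  (forall i, (i < k)%nat -> exists C, P i C) ->
  (forall i C C', C <= C' -> P i C -> P i C') ->
  exists K, 0 <= K /\ forall i, (i < k)%nat -> P i K.
Proof.
  intros H Hm. induction k as [|k IH].
  - exists 0. split; [lra|]. intros; lia.
  - destruct IH as (K & hK & IH); [auto|]. destruct (H k) as (C & HC); [auto|].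
    exists (Rmax K C). split; [eapply Rle_trans; [exact hK|apply Rmax_l]|].
    intros i Hi. destruct (Nat.eq_dec i k) as [->|h].
    + eapply Hm; [apply Rmax_r|auto].
    + eapply Hm; [apply Rmax_l|apply IH; lia].
Qed.

Lemma in_span_orth n L v u :
  (forall w, In w L -> mink n w u = 0) -> in_span n L v -> mink n v u = 0.
Proof.
  intros H Hv. apply in_span_iff in Hv. destruct Hv as [c Hc].
  rewrite (mink_ext n v (fun i => rsum (length L) (fun k => c k * nth k L (fun _ => 0) i)) u u) by auto.
  rewrite (mink_comb n (length L) c (fun k => nth k L (fun _ => 0))). apply rsum_zero.
  intros k Hk. rewrite H; [ring|]. apply nth_In; auto.
Qed.

Section ConstantSpan.

Context (n : nat) (I : R -> Prop) (F : R -> vec) (e phi : R -> nat -> nat -> R).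
Hypothesis n_ge3 : (3 <= n)%nat.
Hypothesis I_open : is_open_interval I.
Hypothesis F_curve : curve n I F.
Hypothesis F_geodesic : conformal_geodesic n I F.
Hypothesis e_special : special_third_order_frame n I F e phi.
Hypothesis v_pos : forall t, I t -> 0 < phi t 1%nat 0%nat.

Local Notation Q A t := (Qcomp n phi A t).
Local Notation P A t := (Pcomp n phi A t).

Definition gen_comp (k : nat) (t : R) : vec :=
  match k with
  | 0%nat => unitv 0
  | 1%nat => unitv 1
  | 2%nat => unitv 2
  | 3%nat => unitv (S n)
  | 4%nat => fun A => Q A t
  | _ => fun A => P A t
  end.

(** The matrix of the linear system satisfied by the generators of [V]. *)
Definition gen_matrix (k j : nat) (t : R) : R :=
  let v := phi t 1%nat 0%nat in
  let w := phi t 0%nat 1%nat in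
  let QQ := ssum n (fun B => Q B t * Q B t) in
  let QP := ssum n (fun B => Q B t * P B t) in
  match k, j with
  | 0%nat, 1%nat => v
  | 1%nat, 0%nat => w | 1%nat, 3%nat => v
  | 2%nat, 0%nat => v | 2%nat, 4%nat => v
  | 3%nat, 1%nat => w | 3%nat, 2%nat => v
  | 4%nat, 2%nat => - (v * QQ) | 4%nat, 5%nat => v
  | 5%nat, 2%nat => - (v * QP) | 5%nat, 4%nat => 2 * w + v * QQ
  | _, _ => 0
  end.

Lemma Qcomp_out A t : ~ (3 <= A <= n)%nat -> Q A t = 0.
Proof. intros h. unfold Qcomp. rewrite theta_index_false by auto. reflexivity. Qed.

Lemma Pcomp_out A t : ~ (3 <= A <= n)%nat -> P A t = 0.
Proof. intros h. unfold Pcomp. rewrite theta_index_false by auto. reflexivity. Qed.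

Lemma psi_sum t (c : vec) : I t ->
  ssum n (fun A => phi t 0%nat A * c A)
  = phi t 0%nat 1%nat * c 1%nat + phi t 1%nat 0%nat * c 2%nat.
Proof.
  intros ht. rewrite ssum_first2 by lia. unfold sumTheta.
  rewrite rsum_zero.
  - rewrite (phi_02 n I F e phi) by auto. ring.
  - intros k Hk. rewrite (phi_0b n I F e phi) by (auto; lia). ring.
Qed.

Lemma phi_A_unitv t A j : (1 <= j <= n)%nat -> ssum n (fun B => phi t A B * unitv j B) = phi t A j.
Proof. intros. apply ssum_unitv; auto. Qed.

Lemma psi_A t A : I t -> (1 <= A <= n)%nat ->
  phi t 0%nat A = phi t 0%nat 1%nat * unitv 1 A + phi t 1%nat 0%nat * unitv 2 A.
Proof.
  intros ht HA. rewrite <- (psi_sum t (fun B => unitv B A)) by auto.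
  rewrite (ssum_single n A) by (auto; intros B _ h; rewrite unitv_diff by auto; ring).
  rewrite unitv_same. ring.
Qed.

Lemma Dt_gen_const t (u : vec) i x : Dt (fun _ _ => u i) x t = 0.
Proof. unfold Dt. apply Derive_const. Qed.

Lemma phi_10 t A : I t -> (1 <= A <= n)%nat -> phi t A 0%nat = phi t 1%nat 0%nat * unitv 1 A.
Proof.
  intros ht HA. destruct (Nat.eq_dec A 1) as [->|h].
  - rewrite unitv_same. ring.
  - rewrite unitv_diff, (phi_A0 n I F e phi) by (auto; lia). ring.
Qed.

Lemma euler_lagrange_P t A : I t -> (3 <= A <= n)%nat ->
  Derive (Pcomp n phi A) t + ssum n (fun B => phi t A B * P B t)
  = (2 * phi t 0%nat 1%nat + phi t 1%nat 0%nat * ssum n (fun B => Q B t * Q B t)) * Q A t.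
Proof.
  intros ht HA.
  assert (E := euler_lagrange n I F e phi n_ge3 I_open F_curve F_geodesic e_special v_pos t A ht ltac:(lia)).
  unfold ELcomp in E. rewrite theta_index_true in E by lia. lra.
Qed.

Lemma Derive_out (f : nat -> R -> R) A t :
  (forall t, f A t = 0) -> Derive (f A) t = 0.
Proof.
  intros H. rewrite (Derive_ext _ (fun _ => 0)) by auto. apply Derive_const.
Qed.

Lemma index_12 A : (1 <= A <= n)%nat -> ~ (3 <= A <= n)%nat -> A = 1%nat \/ A = 2%nat.
Proof. lia. Qed.

Lemma phi_2_sum t (c : vec) : I t ->
  ssum n (fun B => phi t 2%nat B * c B) = - (phi t 1%nat 0%nat * ssum n (fun B => Q B t * c B)).
Proof.
  intros ht. replace (- (phi t 1%nat 0%nat * ssum n (fun B => Q B t * c B)))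
    with ((- phi t 1%nat 0%nat) * ssum n (fun B => Q B t * c B)) by ring.
  rewrite <- ssum_scal. apply ssum_ext. intros B HB.
  rewrite (phi_2_Qcomp n I F e phi) by auto. ring.
Qed.

Lemma phi_1_sum t (c : vec) : I t -> ssum n (fun B => phi t 1%nat B * c B) = 0.
Proof. intros ht. apply ssum_zero. intros. rewrite (phi_1A n I F e phi) by auto. ring. Qed.

(** Rows 0 to 4 are the structure equations together with the definition of [P]; the Euler-Lagrange
    equation enters in row 5 alone, where it keeps the derivative of [P] inside the span. The [e_2]
    entries of rows 4 and 5 come from [phi^2_B = - v q^B]. *)
Lemma Dop_gen_comp k t i : I t -> (k < 6)%nat -> (i <= S n)%nat ->
  Dop n phi (fun _ => gen_comp k) 0 t i = rsum 6 (fun j => gen_matrix k j t * gen_comp j t i).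
Proof.
  intros ht Hk. assert (hv := v_pos t ht). revert i. apply (index_cases n n_ge3).
  - rewrite (Dop_0 n I F e phi) by auto. rewrite psi_sum by auto.
    destruct k as [|[|[|[|[|[|k]]]]]]; [| | | | | |lia]; simpl; 
      rewrite ?Dt_gen_const, ?unitv_same, ?Qcomp_out, ?Pcomp_out by lia.
    + rewrite !unitv_diff by lia. ring.
    + rewrite !unitv_diff by lia. ring.
    + rewrite !unitv_diff by lia. ring.
    + rewrite !unitv_diff by lia. ring.
    + unfold Dt. rewrite (Derive_out (Qcomp n phi)) by (intros; apply Qcomp_out; lia).
      rewrite !unitv_diff by lia. ring.
    + unfold Dt. rewrite (Derive_out (Pcomp n phi)) by (intros; apply Pcomp_out; lia).
      rewrite !unitv_diff by lia. ring.
  - rewrite (Dop_S n I F e phi) by auto.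
    destruct k as [|[|[|[|[|[|k]]]]]]; [| | | | | |lia]; simpl;
      rewrite ?Dt_gen_const, ?unitv_same, ?Qcomp_out, ?Pcomp_out by lia.
    + rewrite !unitv_diff by lia. ring.
    + rewrite !unitv_diff by lia. ring.
    + rewrite !unitv_diff by lia. ring.
    + rewrite !unitv_diff by lia. ring.
    + unfold Dt. rewrite (Derive_out (Qcomp n phi)) by (intros; apply Qcomp_out; lia).
      rewrite !unitv_diff by lia. ring.
    + unfold Dt. rewrite (Derive_out (Pcomp n phi)) by (intros; apply Pcomp_out; lia).
      rewrite !unitv_diff by lia. ring.
  - intros A HA. rewrite (Dop_A n I F e phi), phi_10, (psi_A t A) by auto.
    destruct k as [|[|[|[|[|[|k]]]]]]; [| | | | | |lia]; simpl; rewrite ?Dt_gen_const.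
    + rewrite unitv_same, ssum_unitv0, (unitv_diff (S n) 0), (unitv_diff A (S n)), (unitv_diff A 0) by lia. ring.
    + rewrite phi_A_unitv, (phi_A1 n I F e phi), (unitv_diff 0 1), (unitv_diff (S n) 1),
        (unitv_diff A (S n)), (unitv_diff A 0) by (auto; lia). ring.
    + rewrite phi_A_unitv, (unitv_diff 0 2), (unitv_diff (S n) 2),
        (unitv_diff A (S n)), (unitv_diff A 0) by (auto; lia).
      rewrite (phi_AB n I F e phi n_ge3 I_open e_special t A 2) by (auto; lia).
      rewrite (phi_2_Qcomp n I F e phi) by auto. ring.
    + rewrite unitv_same, ssum_unitv0, (unitv_diff 0 (S n)), (unitv_diff A (S n)), (unitv_diff A 0) by lia. ring.
    + rewrite !(Qcomp_out 0), !(Qcomp_out (S n)), (unitv_diff A (S n)), (unitv_diff A 0) by lia.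
      change (Dt (fun _ t => Q A t) 0 t) with (Derive (Qcomp n phi A) t).
      destruct (Nat.le_gt_cases 3 A).
      * unfold Pcomp. rewrite theta_index_true, (unitv_diff A 2), (unitv_diff A 1) by lia. field. lra.
      * rewrite (Derive_out (Qcomp n phi)) by (intros; apply Qcomp_out; lia).
        rewrite Pcomp_out by lia.
        destruct (index_12 A) as [-> | ->]; [lia|lia| |].
        -- rewrite phi_1_sum, (unitv_diff 1 2) by (auto; lia). ring.
        -- rewrite phi_2_sum, unitv_same by auto. ring.
    + rewrite !(Pcomp_out 0), !(Pcomp_out (S n)), (unitv_diff A (S n)), (unitv_diff A 0) by lia.
      change (Dt (fun _ t => P A t) 0 t) with (Derive (Pcomp n phi A) t).
      destruct (Nat.le_gt_cases 3 A).
      * assert (E := euler_lagrange_P t A ht ltac:(lia)).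
        rewrite (unitv_diff A 2), (unitv_diff A 1) by lia. lra.
      * rewrite (Derive_out (Pcomp n phi)) by (intros; apply Pcomp_out; lia).
        rewrite Qcomp_out by lia.
        destruct (index_12 A) as [-> | ->]; [lia|lia| |].
        -- rewrite phi_1_sum, (unitv_diff 1 2) by (auto; lia). ring.
        -- rewrite phi_2_sum, unitv_same by auto. ring.
Qed.

Lemma gens_orth_const u t0 t1 : I t0 -> I t1 ->
  (forall k, (k < 6)%nat -> mink n (comb n (e t0) (gen_comp k t0)) u = 0) ->
  forall k, (k < 6)%nat -> mink n (comb n (e t1) (gen_comp k t1)) u = 0.
Proof.
  intros h0 h1 H0.
  set (a := Rmin t0 t1). destruct I_open as (_ & I_conv & I_nbhd).
  destruct (I_nbhd (Rmax t0 t1)) as (r & hr & Hr).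
  { unfold Rmax. destruct (Rle_dec t0 t1); auto. }
  (* The interval is enlarged to the right so that [a < b] also when [t0 = t1], as the lemmas on
     [Gen] require. *)
  set (b := Rmax t0 t1 + r / 2).
  assert (ha0 : a <= t0) by apply Rmin_l. assert (ha1 : a <= t1) by apply Rmin_r.
  assert (hb0 : t0 < b) by (assert (h := Rmax_l t0 t1); unfold b; lra).
  assert (hb1 : t1 < b) by (assert (h := Rmax_r t0 t1); unfold b; lra).
  assert (Ia : I a) by (unfold a, Rmin; destruct (Rle_dec t0 t1); auto).
  assert (Ib : I b) by (apply Hr; unfold b; rewrite Rabs_pos_eq; lra).
  assert (ab_I : forall t, a <= t <= b -> I t) by (intros t ht; apply (I_conv a t b); auto).
  assert (hab : a < b) by lra.
  assert (GQ : forall A, (1 <= A <= n)%nat -> Gen I a b 1 (fun _ t => Q A t)).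
  { intros A HA. apply (Gen_Qcomp n I F e phi n_ge3 I_open e_special a b 1); auto; lra. }
  assert (GP : forall A, (1 <= A <= n)%nat -> Gen I a b 1 (fun _ t => P A t)).
  { intros A HA. apply (Gen_Pcomp n I F e phi n_ge3 I_open e_special a b 1); auto; lra. }
  assert (Gphi : forall i j, (i <= S n)%nat -> (j <= S n)%nat -> Gen I a b 1 (fun _ t => phi t i j)).
  { intros. apply (Gen_phi' n I F e phi); auto. }
  assert (Gv : Gen I a b 1 (fun _ t => phi t 1%nat 0%nat)) by (apply Gphi; lia).
  assert (Gw : Gen I a b 1 (fun _ t => phi t 0%nat 1%nat)) by (apply Gphi; lia).
  assert (GQQ : Gen I a b 1 (fun _ t => ssum n (fun B => Q B t * Q B t))).
  { apply (Gen_ssum I a b 1 n (fun B _ t => Q B t * Q B t)). intros. apply Gen_mult; auto. }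
  assert (GQP : Gen I a b 1 (fun _ t => ssum n (fun B => Q B t * P B t))).
  { apply (Gen_ssum I a b 1 n (fun B _ t => Q B t * P B t)). intros. apply Gen_mult; auto. }
  assert (GM : forall k j, Gen I a b 1 (fun _ t => gen_matrix k j t)).
  { intros k j. assert (G0 := Gen_const I a b 1 0). assert (G2 := Gen_const I a b 1 2).
    unfold gen_matrix.
    destruct k as [|[|[|[|[|[|k]]]]]]; destruct j as [|[|[|[|[|[|j]]]]]]; cbv beta zeta iota; auto;
      [apply (Gen_opp I a b 1 (fun _ t => phi t 1%nat 0%nat * ssum n (fun B => Q B t * Q B t)))
      |apply (Gen_opp I a b 1 (fun _ t => phi t 1%nat 0%nat * ssum n (fun B => Q B t * P B t)))
      |apply Gen_plus]; apply Gen_mult; auto. }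
  assert (BM : forall k j, exists C, forall t, a <= t <= b -> Rabs (gen_matrix k j t) <= C).
  { intros k j. destruct (Gen_bounded I a b 1 ab_I _ (GM k j)) as (C & _ & HC).
    exists C. intros t ht. apply (HC 0 t); auto. lra. }
  destruct (finite_bound 6 (fun k C => forall j, (j < 6)%nat -> forall t, a <= t <= b ->
     Rabs (gen_matrix k j t) <= C)) as (K & hK & HK).
  { intros k _. destruct (finite_bound 6 (fun j C => forall t, a <= t <= b ->
      Rabs (gen_matrix k j t) <= C)) as (K & _ & HK); [intros; apply BM| |exists K; auto].
    intros j C C' hC H t ht. eapply Rle_trans; [apply H; auto|auto]. }
  { intros k C C' hC H j Hj t ht. eapply Rle_trans; [apply H; auto|auto]. }
  apply (linear_ode_zero 6 (fun k t => mink n (comb n (e t) (gen_comp k t)) u) gen_matrix a b K t0 t1);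
    auto; try lra.
  intros k t Hk ht. assert (It := ab_I t ht).
  assert (GV : Gvec n I a b 1 (fun _ => gen_comp k)).
  { assert (G0 : Gen I a b 1 (fun _ _ => 0)) by apply Gen_const.
    intros i Hi. destruct k as [|[|[|[|[|[|k]]]]]]; simpl; try apply Gen_const; [| |lia].
    - destruct (Nat.le_gt_cases 1 i); [destruct (Nat.le_gt_cases i n); [apply GQ; auto|]|];
        (apply Gen_ext with (fun _ _ => 0); auto; intros; symmetry; apply Qcomp_out; lia).
    - destruct (Nat.le_gt_cases 1 i); [destruct (Nat.le_gt_cases i n); [apply GP; auto|]|];
        (apply Gen_ext with (fun _ _ => 0); auto; intros; symmetry; apply Pcomp_out; lia). }
  assert (D := is_derive_mink n (fun t => comb n (e t) (gen_comp k t)) (fun _ => u)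
     (comb n (e t) (Dop n phi (fun _ => gen_comp k) 0 t)) (fun _ => 0) t).
  replace (rsum 6 (fun j => gen_matrix k j t * mink n (comb n (e t) (gen_comp j t)) u)) with
    (mink n (comb n (e t) (Dop n phi (fun _ => gen_comp k) 0 t)) u
      + mink n (comb n (e t) (gen_comp k t)) (fun _ => 0)).
  - apply D.
    + intros i Hi.
      apply (is_derive_comb n I e phi I_open (special_mc n I F e phi e_special) a b 1
        (fun _ => gen_comp k) 0 t i GV ltac:(lra) It Hi).
    + intros. apply @is_derive_const.
  - rewrite (mink_ext n (comb n (e t) (gen_comp k t)) (comb n (e t) (gen_comp k t)) (fun _ => 0) (fun i => 0 * u i))
      by (auto; intros; ring).
    rewrite mink_scal_r, Rmult_0_l, Rplus_0_r.
    rewrite <- (mink_comb n 6 (fun j => gen_matrix k j t) (fun j => comb n (e t) (gen_comp j t))).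
    apply mink_ext; auto. intros i Hi.
    rewrite (comb_ext n (e t) _ (fun l => rsum 6 (fun j => gen_matrix k j t * gen_comp j t l)))
      by (intros; apply Dop_gen_comp; auto).
    rewrite (comb_rsum n (e t) 6 (fun j l => gen_matrix k j t * gen_comp j t l)).
    apply rsum_ext. intros. apply comb_scal.
Qed.

Definition gen_list (t : R) : list vec :=
  unitv 0 :: unitv 1 :: unitv 2 :: unitv (S n) :: (fun A => Q A t) :: (fun A => P A t) :: nil.

Definition vgen_list (t : R) : list vec := map (comb n (e t)) (gen_list t).

Lemma vgen_list_In t w : In w (vgen_list t) <->
  exists k, (k < 6)%nat /\ w = comb n (e t) (gen_comp k t).
Proof.
  unfold vgen_list, gen_list. simpl. split.
  - intros [<-|[<-|[<-|[<-|[<-|[<-|[]]]]]]];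
      [exists 0%nat|exists 1%nat|exists 2%nat|exists 3%nat|exists 4%nat|exists 5%nat];
      (split; [lia|reflexivity]).
  - intros (k & Hk & ->). destruct k as [|[|[|[|[|[|k]]]]]]; simpl; auto 10.
Qed.

Lemma vgen_span_exists t : I t -> exists W, (4 <= length W <= 6)%nat /\ lorentz_basis n W /\
  (forall w, In w (vgen_list t) -> in_span n W w) /\
  (forall w, In w W -> in_span n (vgen_list t) w).
Proof.
  intros ht.
  destruct (lorentz_span_exists n (fun A => Q A t) (fun A => P A t)) as (W & HL & HB & H1 & H2).
  - lia.
  - intros i Hi h. apply Qcomp_out; auto.
  - intros i Hi h. apply Pcomp_out; auto.
  - exists (map (comb n (e t)) W). rewrite length_map. split; [auto|]. split.
    + apply lorentz_basis_map_comb; auto. apply (special_iso n I F e phi); auto.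
    + split.
      * intros w Hw. apply in_map_iff in Hw. destruct Hw as (g & <- & Hg).
        apply in_span_map_comb. apply H1. exact Hg.
      * intros w Hw. apply in_map_iff in Hw. destruct Hw as (g & <- & Hg).
        apply in_span_map_comb. apply H2. exact Hg.
Qed.

(** A vector orthogonal to [W] is orthogonal to the generators at [t'], hence by the linear system
    to those at [t]; the double orthogonal brings these back into the span of [W]. *)
Lemma vgen_in_span t t' W : I t -> I t' -> lorentz_basis n W ->
  (forall w, In w (vgen_list t') -> in_span n W w) ->
  forall w, In w (vgen_list t) -> in_span n W w.
Proof.
  intros ht ht' HB H w Hw. apply in_span_double_orth; auto. intros u Hu.
  apply vgen_list_In in Hw. destruct Hw as (k & Hk & ->).
  apply (gens_orth_const u t' t); auto. intros j Hj. apply in_span_orth with W; auto.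
  apply H. apply vgen_list_In. exists j. auto.
Qed.

Lemma constant_span : exists W, (4 <= length W <= 6)%nat /\ lorentz_basis n W /\
  forall t, I t -> forall v, in_span n (vgen_list t) v <-> in_span n W v.
Proof.
  destruct I_open as ((t0 & h0) & _ & _).
  destruct (vgen_span_exists t0 h0) as (W & HL & HB & H1 & H2).
  exists W. split; [auto|]. split; [auto|]. intros t ht v. split; intros Hv.
  - apply in_span_trans with (vgen_list t); auto. apply vgen_in_span with t0; auto.
  - apply in_span_trans with W; auto. intros w Hw.
    apply in_span_trans with (vgen_list t0); auto. intros g Hg.
    (* The reverse inclusion is the same argument with [t0] and [t] exchanged, starting from a
       Lorentz basis of the span at [t]. *)
    destruct (vgen_span_exists t ht) as (W' & _ & HB' & H1' & H2').
    apply in_span_trans with W'; auto. apply vgen_in_span with t0 t; auto.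
Qed.

End ConstantSpan.

(** * Reduction to positive speed *)

(** If [phi^1_0] vanished at [t], every component of the derivative of [e_0] would vanish there, and
    the derivative of [F = kap e_0] would be a multiple of [F], against the immersion condition. *)
Lemma special_speed_nonzero n I F e phi :
  (3 <= n)%nat -> is_open_interval I -> curve n I F -> special_third_order_frame n I F e phi ->
  forall t, I t -> phi t 1%nat 0%nat <> 0.
Proof.
  intros hn hI hF hS t ht E.
  destruct (kap_frame n I F e phi hn hS t ht) as [hk _].
  apply (proj2 (proj2 hF) t ht (fun i => Derive (kap n F e) t * e t i 0%nat)).
  - intros i Hi. apply is_derive_Reals.
    apply is_derive_ext_loc with (fun s => kap n F e s * e s i 0%nat).
    { apply (filter_imp I); [|apply open_interval_locally; auto].
      intros s hs. symmetry. apply (kap_frame n I F e phi); auto. }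
    replace (Derive (kap n F e) t * e t i 0%nat) with
      (Derive (kap n F e) t * e t i 0%nat + kap n F e t * comb n (e t) (fun a => phi t a 0%nat) i).
    + apply is_derive_Rmult.
      (* The values 0, 0, 1 for [a], [b], [delta] are placeholders: differentiability in [t] at
         [eps = 0] is all that is wanted. *)
      * apply (Gen_is_derive I 0 0 1 hI (fun _ => kap n F e) 0 t); auto; [|lra].
        apply (Gen_kap n I F e phi); auto.
      * apply (frame_is_derive n I e phi (special_mc n I F e phi hS)); auto; lia.
    + rewrite (comb_ext n (e t) _ (fun _ => 0 * 0)).
      * rewrite comb_scal. ring.
      * intros j Hj. destruct (Nat.eq_dec j 0) as [->|h0]; [rewrite (phi_00 n I F e phi); auto; ring|].
        destruct (Nat.eq_dec j (S n)) as [->|hSn]; [rewrite (phi_S0 n I F e phi); auto; ring|].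
        destruct (Nat.eq_dec j 1) as [->|h1]; [rewrite E; ring|].
        rewrite (phi_A0 n I F e phi) by (auto; lia). ring.
  - exists (Derive (kap n F e) t / kap n F e t). intros i Hi.
    rewrite (proj2 (kap_frame n I F e phi hn hS t ht)) by auto. field. auto.
Qed.

Lemma nonvanishing_sign (I : R -> Prop) (v : R -> R) :
  is_open_interval I -> (forall t, I t -> continuity_pt v t) -> (forall t, I t -> v t <> 0) ->
  (forall t, I t -> 0 < v t) \/ (forall t, I t -> v t < 0).
Proof.
  intros ((t0 & h0) & hc & _) hv hn.
  assert (K : forall (w : R -> R) x y, (forall t, I t -> continuity_pt w t) -> (forall t, I t -> w t <> 0) ->
     I x -> I y -> x < y -> w x < 0 -> 0 < w y -> False).
  { intros w x y cw nw Ix Iy hxy hx hy.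
    destruct (IVT_interv w x y) as (z & hz & Ez); auto.
    - intros z hz. apply cw. apply (hc x z y); auto.
    - apply (nw z); auto. apply (hc x z y); auto. }
  assert (co : forall t, I t -> continuity_pt (fun s => - v s) t)
    by (intros; apply continuity_pt_opp; auto).
  assert (no : forall t, I t -> - v t <> 0) by (intros t ht; assert (h := hn t ht); lra).
  assert (same : forall x y, I x -> I y -> 0 < v x -> v y < 0 -> False).
  { intros x y Ix Iy hx hy. destruct (Rtotal_order x y) as [h|[->|h]].
    - apply (K (fun s => - v s) x y); auto; lra.
    - lra.
    - apply (K v y x); auto. }
  destruct (Rtotal_order (v t0) 0) as [h|[h|h]].
  - right. intros t ht. destruct (Rtotal_order (v t) 0) as [h'|[h'|h']]; auto.
    + exfalso. apply (hn t); auto.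
    + exfalso. apply (same t t0); auto.
  - exfalso. apply (hn t0); auto.
  - left. intros t ht. destruct (Rtotal_order (v t) 0) as [h'|[h'|h']]; auto.
    + exfalso. apply (same t0 t); auto.
    + exfalso. apply (hn t); auto.
Qed.

(** * Reversal of [e_1] and [e_2] *)

Lemma moeb_ext n M M' :
  (forall i j, (i <= S n)%nat -> (j <= S n)%nat -> M i j = M' i j) -> moeb n M -> moeb n M'.
Proof.
  intros E [H (g & gc & gi & g0 & g1)]. split; [apply isometry_ext with M; auto|].
  exists g. repeat split; auto. intros i j Hi Hj. rewrite g1; auto.
Qed.

(** A path from [M] to [M] with its columns 1 and 2 negated. *)
Definition rot12 (M : nat -> nat -> R) (u : R) (i j : nat) : R :=
  if Nat.eqb j 1 then cos (PI * u) * M i 1%nat + sin (PI * u) * M i 2%nat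
  else if Nat.eqb j 2 then cos (PI * u) * M i 2%nat - sin (PI * u) * M i 1%nat
  else M i j.

Lemma isometry_rot12 n M u : (2 <= n)%nat -> isometry n M -> isometry n (rot12 M u).
Proof.
  intros hn H. set (c := cos (PI * u)). set (s := sin (PI * u)).
  assert (cs : c * c + s * s = 1).
  { assert (h := sin2_cos2 (PI * u)). unfold Rsqr in h. unfold c, s. lra. }
  assert (C1 : forall w, mink n (col (rot12 M u) 1) w = c * mink n (col M 1) w + s * mink n (col M 2) w).
  { intros w. rewrite <- (mink_scal n c), <- (mink_scal n s).
    rewrite <- (mink_plus n (fun i => c * col M 1 i) (fun i => s * col M 2 i)). reflexivity. }
  assert (C2 : forall w, mink n (col (rot12 M u) 2) w = c * mink n (col M 2) w - s * mink n (col M 1) w).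
  { intros w. rewrite <- (mink_scal n c), <- (mink_scal n s).
    rewrite <- (mink_minus n (fun i => c * col M 2 i) (fun i => s * col M 1 i)). reflexivity. }
  assert (Cj : forall j w, j <> 1%nat -> j <> 2%nat -> mink n (col (rot12 M u) j) w = mink n (col M j) w).
  { intros j w h1 h2. apply mink_ext; auto. intros. unfold col, rot12.
    rewrite (proj2 (Nat.eqb_neq j 1)), (proj2 (Nat.eqb_neq j 2)) by auto. reflexivity. }
  destruct (nullframe_unit n) as [pp qq pq pB qB BB _].
  assert (HM : forall j k, (j <= S n)%nat -> (k <= S n)%nat ->
    mink n (col M j) (col M k) = mink n (unitv j) (unitv k)) by exact H.
  assert (swap : forall w j, mink n w (col (rot12 M u) j) = mink n (col (rot12 M u) j) w)
    by (intros; apply mink_sym).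
  apply isometry_intro.
  - rewrite Cj, swap, Cj, HM by lia. auto.
  - rewrite Cj, swap, Cj, HM by lia. auto.
  - rewrite Cj, swap, Cj, HM by lia. rewrite mink_sym. auto.
  - intros A HA. rewrite Cj, swap by lia.
    destruct (Nat.eq_dec A 1) as [->|h1]; [|destruct (Nat.eq_dec A 2) as [->|h2]].
    + rewrite C1, !HM, !(mink_sym n _ (unitv 0)), !pB by lia. ring.
    + rewrite C2, !HM, !(mink_sym n _ (unitv 0)), !pB by lia. ring.
    + rewrite Cj, HM, mink_sym, pB by lia. ring.
  - intros A HA. rewrite Cj, swap by lia.
    destruct (Nat.eq_dec A 1) as [->|h1]; [|destruct (Nat.eq_dec A 2) as [->|h2]].
    + rewrite C1, !HM, !(mink_sym n _ (unitv (S n))), !qB by lia. ring.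
    + rewrite C2, !HM, !(mink_sym n _ (unitv (S n))), !qB by lia. ring.
    + rewrite Cj, HM, mink_sym, qB by lia. ring.
  - intros A B HA HB.
    destruct (Nat.eq_dec A 1) as [->|h1]; [|destruct (Nat.eq_dec A 2) as [->|h2]];
    (destruct (Nat.eq_dec B 1) as [->|k1]; [|destruct (Nat.eq_dec B 2) as [->|k2]]);
    rewrite ?C1, ?C2, ?(Cj A) by lia; rewrite !swap; rewrite ?C1, ?C2, ?(Cj B) by lia;
    rewrite !HM, !BB by lia;
    repeat match goal with |- context [Nat.eqb ?x ?y] =>
      destruct (Nat.eqb_spec x y); try lia end; try lra; try congruence.
Qed.

(** Two columns are negated since a single sign change leaves the identity component. *)
Definition flip_sign (j : nat) : R := if orb (Nat.eqb j 1) (Nat.eqb j 2) then -1 else 1.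

Lemma flip_sign_sqr j : flip_sign j * flip_sign j = 1.
Proof. unfold flip_sign. destruct (orb _ _); ring. Qed.

Lemma flip_sign_other j : j <> 1%nat -> j <> 2%nat -> flip_sign j = 1.
Proof.
  intros. unfold flip_sign. rewrite (proj2 (Nat.eqb_neq j 1)), (proj2 (Nat.eqb_neq j 2)) by auto.
  reflexivity.
Qed.

Definition flip_frame (e : R -> nat -> nat -> R) (t : R) (i j : nat) : R := flip_sign j * e t i j.
Definition flip_form (phi : R -> nat -> nat -> R) (t : R) (i j : nat) : R :=
  flip_sign i * flip_sign j * phi t i j.

Lemma moeb_flip n (M : nat -> nat -> R) :
  (2 <= n)%nat -> moeb n M -> moeb n (fun i j => flip_sign j * M i j).
Proof.
  intros hn H. apply moeb_ext with (rot12 M 1).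
  - intros i j _ _. unfold rot12, flip_sign. rewrite Rmult_1_r, cos_PI, sin_PI.
    destruct (Nat.eqb_spec j 1) as [->|]; [simpl; ring|].
    destruct (Nat.eqb_spec j 2) as [->|]; simpl; ring.
  - apply (moeb_path n M (rot12 M)); auto.
    + intros i j u _ _ _. unfold rot12. apply derivable_continuous_pt.
      destruct (Nat.eqb j 1); [reg|]. destruct (Nat.eqb j 2); reg.
    + intros u _. apply isometry_rot12; auto. apply H.
    + intros i j _ _. unfold rot12. rewrite Rmult_0_r, cos_0, sin_0.
      destruct (Nat.eqb_spec j 1) as [->|]; [ring|].
      destruct (Nat.eqb_spec j 2) as [->|]; ring.
Qed.

Lemma psq_flip n phi t : psq n (flip_form phi) t = psq n phi t.
Proof.
  unfold psq. apply rsum_ext. intros k _. unfold flip_form, Rdiv.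
  replace (flip_sign 0) with 1 by reflexivity. replace (flip_sign 1) with (-1) by reflexivity.
  replace (-1 * 1 * phi t 1%nat 0%nat) with (- phi t 1%nat 0%nat) by ring.
  rewrite Rinv_opp. unfold flip_sign. destruct (orb _ _); simpl; ring.
Qed.

Lemma ds_flip n phi t : ds n (flip_form phi) t = - ds n phi t.
Proof.
  unfold ds. rewrite psq_flip. unfold flip_form.
  replace (flip_sign 0) with 1 by reflexivity. replace (flip_sign 1) with (-1) by reflexivity. ring.
Qed.

(** The normalization survives because [ds], [phi^1_0] and [phi^0_2] all change sign. *)
Lemma special_flip n I F e phi : (2 <= n)%nat ->
  special_third_order_frame n I F e phi ->
  special_third_order_frame n I F (flip_frame e) (flip_form phi).
Proof.
  intros hn [[[Hs Hf] [Hm H2]] H3].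
  assert (s0 : flip_sign 0 = 1) by reflexivity. assert (s1 : flip_sign 1 = -1) by reflexivity.
  assert (s2 : flip_sign 2 = -1) by reflexivity.
  split; [split; [split|split]|].
  - intros i j Hi Hj. destruct (Hs i j Hi Hj) as (D & D0 & HD).
    exists (fun k t => flip_sign j * D k t). split.
    + intros t. rewrite D0. reflexivity.
    + intros k t ht. apply derivable_pt_lim_scal. auto.
  - intros t ht. destruct (Hf t ht) as [Hmo (lam & hl & E)]. split.
    + apply moeb_flip; auto.
    + exists lam. split; auto. intros i Hi. unfold flip_frame. rewrite s0, E by auto. ring.
  - intros t ht i j Hi Hj. unfold flip_frame.
    rewrite (rsum_ext _ _ (fun a => flip_sign j * (phi t a j * e t i a))).
    + rewrite rsum_scal. apply derivable_pt_lim_scal. apply Hm; auto.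
    + intros a _. unfold flip_form.
      replace (flip_sign a * flip_sign j * phi t a j * (flip_sign a * e t i a)) with
        ((flip_sign a * flip_sign a) * (flip_sign j * (phi t a j * e t i a))) by ring.
      rewrite flip_sign_sqr. ring.
  - intros t al ht Hal. unfold flip_form. destruct (H2 t al ht Hal) as [-> ->]. split; ring.
  - intros t ht. destruct (H3 t ht) as (h1 & h2 & h3 & h4). rewrite ds_flip. unfold flip_form.
    rewrite s0, s1, s2, h4. rewrite h1 at 1. rewrite h2. repeat split; try ring.
    intros c Hc. rewrite h3 by auto. ring.
Qed.

Lemma qf_flip n phi t c : (3 <= c)%nat -> qf n (flip_form phi) t c = qf n phi t c.
Proof.
  intros Hc. unfold qf, Rdiv. rewrite ds_flip, Rinv_opp. unfold flip_form.
  rewrite flip_sign_other by lia. replace (flip_sign 2) with (-1) by reflexivity. ring.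
Qed.

Lemma sumTheta_ext n f g : (forall c, (3 <= c <= n)%nat -> f c = g c) -> sumTheta n f = sumTheta n g.
Proof. intros H. apply rsum_ext. intros; apply H; lia. Qed.

Lemma Xv_flip n e phi t i : Xv n (flip_frame e) (flip_form phi) t i = Xv n e phi t i.
Proof.
  apply sumTheta_ext. intros c Hc. rewrite qf_flip by lia. unfold flip_frame.
  rewrite flip_sign_other by lia. ring.
Qed.

(** In [X] the signs of [phi^b_2] and [ds] cancel, whereas the further division by [ds] reverses the
    derivative; the span is unaffected. *)
Lemma nablaX_flip n e phi dq t i :
  nablaX_ds n (flip_frame e) (flip_form phi) dq t i = - nablaX_ds n e phi dq t i.
Proof.
  unfold nablaX_ds. replace (- sumTheta n _) with (-1 * sumTheta n (fun c =>
    (dq t c + sumTheta n (fun b => qf n phi t b * phi t c b)) / ds n phi t * e t i c)) by ring.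
  unfold sumTheta at 1 3. rewrite <- rsum_scal. apply rsum_ext. intros k Hk.
  rewrite ds_flip. unfold flip_frame, Rdiv. rewrite flip_sign_other, Rinv_opp by lia.
  rewrite (sumTheta_ext n (fun b => qf n (flip_form phi) t b * flip_form phi t (k + 3)%nat b)
     (fun b => qf n phi t b * phi t (k + 3)%nat b)); [ring|].
  intros c Hc. rewrite qf_flip by lia. unfold flip_form. rewrite !flip_sign_other by lia. ring.
Qed.

Lemma in_span_pairwise n L L' : length L = length L' ->
  (forall k, (k < length L)%nat -> exists x, forall i, (i <= S n)%nat ->
     nth k L (fun _ => 0) i = x * nth k L' (fun _ => 0) i) ->
  forall v, in_span n L v -> in_span n L' v.
Proof.
  intros hl H v Hv. apply in_span_trans with L; auto. intros w Hw.
  destruct (In_nth L w (fun _ => 0) Hw) as (k & Hk & E).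
  destruct (H k Hk) as (x & Hx). rewrite E in Hx.
  apply in_span_ext with (fun i => x * nth k L' (fun _ => 0) i); [intros; symmetry; auto|].
  apply in_span_scal, in_span_nth. exact (eq_ind _ (fun m => (k < m)%nat) Hk _ hl).
Qed.

Lemma V_gens_flip n e phi dq t v :
  in_span n (V_gens n e phi dq t) v <->
  in_span n (V_gens n (flip_frame e) (flip_form phi) dq t) v.
Proof.
  assert (s : forall j i, flip_frame e t i j = flip_sign j * e t i j) by reflexivity.
  assert (s' : forall j i, e t i j = flip_sign j * flip_frame e t i j).
  { intros. unfold flip_frame. rewrite <- Rmult_assoc, flip_sign_sqr. ring. }
  split; apply in_span_pairwise; try reflexivity;
    intros [|[|[|[|[|[|k]]]]]] Hk; simpl in Hk; try lia; simpl; unfold col.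
  - exists (flip_sign 0). intros; apply s'.
  - exists (flip_sign 1). intros; apply s'.
  - exists (flip_sign 2). intros; apply s'.
  - exists (flip_sign (S n)). intros; apply s'.
  - exists 1. intros. rewrite Xv_flip. ring.
  - exists (-1). intros. rewrite nablaX_flip. ring.
  - exists (flip_sign 0). intros; apply s.
  - exists (flip_sign 1). intros; apply s.
  - exists (flip_sign 2). intros; apply s.
  - exists (flip_sign (S n)). intros; apply s.
  - exists 1. intros. rewrite Xv_flip. ring.
  - exists (-1). intros. rewrite nablaX_flip. ring.
Qed.

(** Passage from the generators of the statement, with the derivative [dq] supplied from outside, to
    the zero-extended components [Qcomp] and [Pcomp]; on the open interval [I] the supplied
    derivative is the true one. *)
Lemma V_gens_vgen_list n I F e phi dq t v :
  (3 <= n)%nat -> is_open_interval I -> special_third_order_frame n I F e phi ->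
  (forall t c, I t -> (3 <= c <= n)%nat -> derivable_pt_lim (fun u => qf n phi u c) t (dq t c)) ->
  I t ->
  in_span n (V_gens n e phi dq t) v <-> in_span n (vgen_list n e phi t) v.
Proof.
  intros hn hI hS hq ht.
  assert (qQ : forall s c, I s -> (3 <= c <= n)%nat -> qf n phi s c = Qcomp n phi c s).
  { intros s c hs Hc. unfold qf, Qcomp. rewrite theta_index_true, (special_ds n I F e phi) by auto.
    reflexivity. }
  assert (dQ : forall c, (3 <= c <= n)%nat -> dq t c = Derive (Qcomp n phi c) t).
  { intros c Hc. symmetry. apply is_derive_unique.
    apply is_derive_ext_loc with (fun u => qf n phi u c); [|apply is_derive_Reals; auto].
    apply (filter_imp I); [|apply open_interval_locally; auto]. intros; apply qQ; auto. }
  assert (cT : forall (f : nat -> R) i, (forall A, ~ (3 <= A <= n)%nat -> f A = 0) ->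
    comb n (e t) f i = sumTheta n (fun A => f A * e t i A)).
  { intros f i Hf. unfold comb. rewrite rsum_ends, ssum_first2, !Hf by lia. ring. }
  assert (X4 : forall i, Xv n e phi t i = comb n (e t) (fun A => Qcomp n phi A t) i).
  { intros i. rewrite cT by (intros; apply (Qcomp_out n phi hn); auto).
    apply sumTheta_ext. intros c Hc. rewrite qQ by auto. reflexivity. }
  assert (X5 : forall i, nablaX_ds n e phi dq t i = comb n (e t) (fun A => Pcomp n phi A t) i).
  { intros i. rewrite cT by (intros; apply (Pcomp_out n phi hn); auto).
    apply sumTheta_ext. intros c Hc. unfold Pcomp.
    rewrite theta_index_true, (special_ds n I F e phi), dQ by auto.
    rewrite (ssum_first2 n (fun B => phi t c B * Qcomp n phi B t)) by lia.
    rewrite !(Qcomp_out n phi hn) by lia.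
    rewrite (sumTheta_ext n (fun b => qf n phi t b * phi t c b)
      (fun B => phi t c B * Qcomp n phi B t)) by (intros; rewrite qQ by auto; ring).
    unfold Rdiv. ring. }
  assert (U : forall j i, (j <= S n)%nat -> e t i j = comb n (e t) (unitv j) i)
    by (intros; symmetry; apply comb_unitv; auto).
  unfold vgen_list, gen_list.
  split; apply in_span_pairwise; try reflexivity;
    intros [|[|[|[|[|[|k]]]]]] Hk; simpl in Hk; try lia; simpl; unfold col; exists 1; intros i Hi;
    rewrite ?X4, ?X5, ?comb_unitv by lia; ring.
Qed.

Lemma constant_span_special n I F e phi dq :
  (3 <= n)%nat -> is_open_interval I -> curve n I F -> conformal_geodesic n I F ->
  special_third_order_frame n I F e phi ->
  (forall t c, I t -> (3 <= c <= n)%nat -> derivable_pt_lim (fun u => qf n phi u c) t (dq t c)) ->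
  exists W, (4 <= length W <= 6)%nat /\ lorentz_basis n W /\
    forall t, I t -> forall v, in_span n (V_gens n e phi dq t) v <-> in_span n W v.
Proof.
  intros hn hI hF hG hS hq.
  assert (hv0 := special_speed_nonzero n I F e phi hn hI hF hS).
  assert (G : Gen I 0 0 1 (fun _ t => phi t 1%nat 0%nat)) by (apply (Gen_phi' n I F e phi); auto; lia).
  destruct (nonvanishing_sign I (fun t => phi t 1%nat 0%nat) hI) as [hv|hv]; auto.
  - intros t ht. apply derivable_continuous_pt. eexists. apply is_derive_Reals.
    apply (Gen_is_derive I 0 0 1 hI _ 0 t G); auto. lra.
  - destruct (constant_span n I F e phi hn hI hF hG hS hv) as (W & HL & HB & H).
    exists W. split; [auto|]. split; [auto|]. intros t ht v.
    rewrite (V_gens_vgen_list n I F e phi) by auto. auto.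
  - assert (hS' := special_flip n I F e phi ltac:(lia) hS).
    assert (hv' : forall t, I t -> 0 < flip_form phi t 1%nat 0%nat).
    { intros t ht. assert (h := hv t ht). unfold flip_form.
      replace (flip_sign 0) with 1 by reflexivity. replace (flip_sign 1) with (-1) by reflexivity. lra. }
    assert (hq' : forall t c, I t -> (3 <= c <= n)%nat ->
      derivable_pt_lim (fun u => qf n (flip_form phi) u c) t (dq t c)).
    { intros t c ht Hc. apply is_derive_Reals.
      apply is_derive_ext with (fun u => qf n phi u c); [|apply is_derive_Reals; auto].
      intros; symmetry; apply qf_flip; lia. }
    destruct (constant_span n I F _ _ hn hI hF hG hS' hv') as (W & HL & HB & H).
    exists W. split; [auto|]. split; [auto|]. intros t ht v.
    rewrite V_gens_flip, (V_gens_vgen_list n I F _ _ dq t v hn hI hS' hq' ht). auto.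
Qed.

Theorem mainTheorem6 (n : nat) (I : R -> Prop) (F : R -> vec)
  (e phi : R -> nat -> nat -> R) (dq : R -> nat -> R) :
  (3 <= n)%nat ->
  is_open_interval I ->
  curve n I F ->
  one_generic n I F ->
  conformal_geodesic n I F ->
  special_third_order_frame n I F e phi ->
  (forall t c, I t -> (3 <= c <= n)%nat ->
     derivable_pt_lim (fun u => qf n phi u c) t (dq t c)) ->
  exists W : list vec,
    (4 <= length W <= 6)%nat /\
    lorentz_basis n W /\
    (forall t, I t -> forall v, in_span n (V_gens n e phi dq t) v <-> in_span n W v) /\
    conformal_sphere n (length W - 2) (proj_null_cone n W) /\
    (forall t, I t -> proj_null_cone n W (F t)).
Proof.
  intros hn hI hF _ hG hS hq.
  destruct (constant_span_special n I F e phi dq hn hI hF hG hS hq) as (W & HL & HB & H).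
  exists W. split; [auto|]. split; [auto|]. split; [auto|]. split.
  - exists W. split; [lia|]. split; [auto|]. intros v. reflexivity.
  - intros t ht. destruct (proj1 (proj2 hF) t ht) as [h0 hnull]. split; [auto|]. split; [auto|].
    apply H with t; auto.
    apply in_span_ext with (fun i => kap n F e t * col (e t) 0 i).
    + intros i Hi. symmetry. apply (kap_frame n I F e phi); auto.
    + apply in_span_scal. apply in_span_In. left. reflexivity.
Qed.
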